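(* With a suitable normalization of the deformed Lie bracket $[\cdot,\cdot]_q$ (which is determined only up to a scalar factor; the normalization being independent of $\lambda$), the following holds for every $\lambda\in\mathbb{C}$: the quotient algebra of $\mathcal{A}_{RE}(\mathcal{M})$ by the ideal generated by $\mathrm{Tr}_q(L)-\lambda$ is isomorphic to the member of the two-parameter family $\mathrm{S}_{q,t}(\mathfrak{g})$, $\mathfrak{g}=sl(n)$, obtained by setting $$t=\lambda\,\frac{q-q^{-1}}{\mathrm{Tr}_q(\mathrm{Id})},$$ i.e. to the corresponding one-parameter (in $q$) subfamily.
   Context: Scalars: $\mathbb{C}(q)$, with fractional powers of $q$ adjoined when needed; $\omega=q-q^{-1}$. $\mathcal{M}$ is the algebra of $n\times n$ matrices with units $e^i_j$, $e^i_je^k_l=\delta^k_je^i_l$; $S=q\sum_i e^i_i\otimes e^i_i+\sum_{i\ne j}e^i_j\otimes e^j_i+\omega\sum_{i<k}e^i_i\otimes e^k_k$. The reflection equation algebra $\mathcal{A}_{RE}(\mathcal{M})$ is the unital associative algebra generated by entries of $L=\sum L^i_je^j_i$ with relations $L_2SL_2S=SL_2SL_2$, $L_2=1\otimes L$. Quantum trace of a matrix $B=\sum B^i_je^j_i$ with entries in any algebra: $\mathrm{Tr}_q(B)=\sum_{i=1}^nq^{-2i+2}B^i_i$; so $\mathrm{Tr}_q(\mathrm{Id})=\sum_{i=1}^n q^{-2i+2}$. $\mathcal{U}_q(\mathfrak{g})$, $\mathfrak{g}=sl(n)$, is the quantum universal enveloping algebra with generators $H_i,X_i^\pm$, coproduct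 $\Delta(H_i)=H_i\otimes1+1\otimes H_i$, $\Delta(X_i^\pm)=X_i^\pm\otimes q^{-H_i/2}+q^{H_i/2}\otimes X_i^\pm$, antipode (bar) $\bar H_i=-H_i$, $\overline{X_i^\pm}=-q^{\mp1}X_i^\pm$, and fundamental representation $\rho(H_i)=e^i_i-e^{i+1}_{i+1}$, $\rho(X_i^+)=e^i_{i+1}$, $\rho(X_i^-)=e^{i+1}_i$. The left coadjoint module $\mathcal{M}^*$ is $\mathcal{M}$ with action $x\triangleright A=\rho(x_{(2)})A\rho(\overline{x_{(1)}})$; the generators $L^i_j$ form $\mathcal{M}^*$ via $L^i_j\mapsto e^i_j$. One has $\mathcal{M}^*=\mathfrak{m}_0\oplus\mathfrak{g}$, where $\mathfrak{m}_0$ is spanned by the invariant $\sum_i q^{-2i+2}e^i_i$ and $\mathfrak{g}$ denotes the irreducible submodule generated by $e^n_1$ (the deformed adjoint module). Involution $\tau_{RE}$ on $\mathcal{M}^{*\otimes2}$: identify $\mathcal{M}^*=V\otimes V^*$ by $e^i_j\leftrightarrow e_j\otimes f^i$ ($e_i$ basis of $V$, $f^i$ dual basis). Let $\tau_{V\otimes V}(e_i\otimes e_i)=e_i\otimes e_i$, $\tau_{V\otimes V}(e_i\otimes e_j)=\mathrm{sign}(j-i)\frac{1-q^2}{1+q^2}e_i\otimes e_j+\frac{2q}{1+q^2}e_j\otimes e_i$ ($i\ne j$); $\tau_{V^*\otimes V^*}(f^i\otimes f^i)=f^i\otimes f^i$, $\tau_{V^*\otimes V^*}(f^i\otimes f^j)=\mathrm{sign}(i-j)\frac{1-q^2}{1+q^2}f^i\otimes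 f^j+\frac{2q}{1+q^2}f^j\otimes f^i$ ($i\ne j$); $\tau_{V\otimes V^*}(e_j\otimes f^i)=q^{-1/n}f^i\otimes e_j$ ($i\ne j$), $\tau_{V\otimes V^*}(e_i\otimes f^i)=q^{-1/n}(qf^i\otimes e_i+\omega\sum_{k>i}f^k\otimes e_k)$. Then $\tau_{RE}=(\mathrm{id}\otimes\tau_{V\otimes V^*}\otimes\mathrm{id})(\tau_{V\otimes V}\otimes\tau_{V^*\otimes V^*})(\mathrm{id}\otimes\tau_{V\otimes V^*}^{-1}\otimes\mathrm{id})$, with $(\pm1)$-eigenspaces $I^\pm_{RE}$. Reduction to $\mathfrak{g}^{\otimes2}$: let $p\colon\mathcal{M}^{*\otimes2}\to\mathfrak{g}^{\otimes2}$ be the projection along $\mathfrak{m}_0\otimes\mathcal{M}^*+\mathcal{M}^*\otimes\mathfrak{m}_0$. The $\mathcal{U}_q(\mathfrak{g})$-invariant involution $\tilde\tau_{RE}$ on $\mathfrak{g}^{\otimes2}$ has $(+1)$-eigenspace $I^+_{RE}\cap\mathfrak{g}^{\otimes2}$ (symmetric tensors) and $(-1)$-eigenspace $p(I^-_{RE})$ (antisymmetric tensors). The deformed bracket $[\cdot,\cdot]_q\colon\mathfrak{g}^{\otimes2}\to\mathfrak{g}$ is a nonzero $\mathcal{U}_q(\mathfrak{g})$-equivariant map vanishing on $\tilde\tau_{RE}$-symmetric tensors; it is unique up to a scalar factor and is normalized so as to become the Lie bracket of $sl(n)$ as $q\to1$. $\mathrm{S}_{q,t}(\mathfrak{g})$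 is the quotient of $\mathrm{T}(\mathfrak{g})[t]$ (over the scalars above) by the relations $x\otimes y-\tilde\tau_{RE}(x\otimes y)=t[x,y]_q$, $x,y\in\mathfrak{g}$. *)

(* Defs.v *)
From HB Require Import structures.
From mathcomp Require Import all_boot all_order all_algebra.
From mathcomp Require Import complex.
From mathcomp Require Import boolp classical_sets reals.
From mathcomp Require Import monalg.

Set Implicit Arguments.
Unset Strict Implicit.
Unset Printing Implicit Defensive.

Import GRing.Theory.
Local Open Scope ring_scope.

(* MathComp's algType requires 1 != 0, which is not known a priori for an
   algebra given by generators and relations; hence this variant, over the
   possibly trivial rings pzRingType. *)
Record kalgebra (K : fieldType) := KAlgebra {
  kalg_ring :> pzRingType;
  kalg_scalar : {rmorphism K -> kalg_ring};
  kalg_central : forall a x, kalg_scalar a * x = x * kalg_scalar a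
}.

Definition kalg_isomorphic (K : fieldType) (A B : kalgebra K) : Prop :=
  exists f : {rmorphism A -> B},
    bijective f /\ forall a : K, f (kalg_scalar A a) = kalg_scalar B a.

Section QuotientRing.
Variables (A : pzRingType) (X : set A).

Definition two_sided_ideal (J : set A) : Prop :=
  [/\ J 0, forall x y, J x -> J y -> J (x - y)
    & forall a x b, J x -> J (a * x * b)].

Definition gen_ideal : A -> bool :=
  fun x => `[< forall J, two_sided_ideal J -> (X `<=` J)%classic -> J x >].

Fact gen_ideal_zmod_closed : zmod_closed gen_ideal.
Proof.
split=> [|x y /asboolP hx /asboolP hy]; apply/asboolP => J JI XJ.
  by case: JI.
by case: (JI) => _ JB _; apply: JB; [apply: hx|apply: hy].
Qed.

HB.instance Definition _ :=
  GRing.isZmodClosed.Build A gen_ideal gen_ideal_zmod_closed.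

Lemma gen_idealM a x b : x \in gen_ideal -> a * x * b \in gen_ideal.
Proof.
move=> /asboolP hx; apply/asboolP => J JI XJ.
by case: (JI) => _ _; apply; apply: hx.
Qed.

Lemma gen_idealMl a x : x \in gen_ideal -> a * x \in gen_ideal.
Proof. by move=> /(gen_idealM a 1); rewrite mulr1. Qed.

Lemma gen_idealMr x b : x \in gen_ideal -> x * b \in gen_ideal.
Proof. by move=> /(gen_idealM 1 b); rewrite mul1r. Qed.

Definition gen_ideal_closed : zmodClosed A :=
  GRing.ZmodClosed.clone A gen_ideal _.

Definition quot_ring : Type := Quotient.quot gen_ideal_closed.

HB.instance Definition _ := GRing.Zmodule.on quot_ring.

Definition quot_pi (x : A) : quot_ring := \pi_(Quotient.quot gen_ideal_closed)%qT x.
Definition quot_repr (x : quot_ring) : A := @repr _ (Quotient.quot gen_ideal_closed) x.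

Lemma quot_reprK : cancel quot_repr quot_pi.
Proof. by move=> x; apply: reprK. Qed.

Lemma quot_pi_eq x y : (quot_pi x == quot_pi y) = (x - y \in gen_ideal).
Proof. exact/esym/Quotient.idealrBE. Qed.

Lemma quot_piD : {morph quot_pi : x y / x + y}.
Proof. exact: Quotient.pi_add. Qed.

Lemma quot_piN : {morph quot_pi : x / - x}.
Proof. exact: Quotient.pi_opp. Qed.

Definition quot_one : quot_ring := quot_pi 1.
Definition quot_mul (x y : quot_ring) : quot_ring :=
  quot_pi (quot_repr x * quot_repr y).

Lemma quot_piM x y : quot_pi (x * y) = quot_mul (quot_pi x) (quot_pi y).
Proof.
apply/eqP; rewrite quot_pi_eq.
set x' := quot_repr _; set y' := quot_repr _.
have -> : x * y - x' * y' = (x - x') * y + x' * (y - y').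
  by rewrite mulrBl mulrBr addrA subrK.
apply: rpredD; [apply: gen_idealMr|apply: gen_idealMl];
  by rewrite -quot_pi_eq quot_reprK.
Qed.

Fact quot_mulA : associative quot_mul.
Proof.
move=> x y z; rewrite -[x]quot_reprK -[y]quot_reprK -[z]quot_reprK.
by rewrite -!quot_piM mulrA.
Qed.

Fact quot_mul1 : left_id quot_one quot_mul.
Proof. by move=> x; rewrite -[x]quot_reprK -!quot_piM mul1r. Qed.

Fact quot_1mul : right_id quot_one quot_mul.
Proof. by move=> x; rewrite -[x]quot_reprK -!quot_piM mulr1. Qed.

Fact quot_mulDl : left_distributive quot_mul +%R.
Proof.
move=> x y z; rewrite -[x]quot_reprK -[y]quot_reprK -[z]quot_reprK.
by rewrite -quot_piD -!quot_piM -quot_piD mulrDl.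
Qed.

Fact quot_mulDr : right_distributive quot_mul +%R.
Proof.
move=> x y z; rewrite -[x]quot_reprK -[y]quot_reprK -[z]quot_reprK.
by rewrite -quot_piD -!quot_piM -quot_piD mulrDr.
Qed.

HB.instance Definition _ := GRing.Zmodule_isPzRing.Build quot_ring
  quot_mulA quot_mul1 quot_1mul quot_mulDl quot_mulDr.

Fact quot_pi_zmod_morphism : zmod_morphism quot_pi.
Proof. by move=> x y; rewrite quot_piD quot_piN. Qed.

Fact quot_pi_monoid_morphism : GRing.monoid_morphism quot_pi.
Proof. by split=> // x y; apply: quot_piM. Qed.

HB.instance Definition _ :=
  GRing.isZmodMorphism.Build A quot_ring quot_pi quot_pi_zmod_morphism.
HB.instance Definition _ :=
  GRing.isMonoidMorphism.Build A quot_ring quot_pi quot_pi_monoid_morphism.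

End QuotientRing.

Section Algebras.
Variable K : fieldType.

Fact kquot_central (A : kalgebra K) (X : set A) (a : K) (x : quot_ring X) :
  (quot_pi X \o kalg_scalar A) a * x = x * (quot_pi X \o kalg_scalar A) a.
Proof. by rewrite -[x]quot_reprK /= -!rmorphM kalg_central. Qed.

(* The quotient of A by the two-sided ideal generated by X. *)
Definition kquot (A : kalgebra K) (X : set A) : kalgebra K :=
  KAlgebra (@kquot_central A X).

Fact free_central (I : choiceType) (a : K) (x : {malg K[{fmonom I}]}) :
  (@malgC {fmonom I} K) a * x = x * (@malgC {fmonom I} K) a.
Proof.
rewrite mul_malgC malgM_def malgZ_def fgmulgU.
by apply: eq_bigr => k _; rewrite mulm1 mulrC.
Qed.

Definition free_algebra (I : choiceType) : kalgebra K :=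
  KAlgebra (@free_central I).

Fact free_t_central (I : choiceType) (a : K) (p : {poly {malg K[{fmonom I}]}}) :
  (polyC \o @malgC {fmonom I} K) a * p = p * (polyC \o @malgC {fmonom I} K) a.
Proof. by apply/polyP => i; rewrite /= coefCM coefMC free_central. Qed.

(* Polynomials over the free algebra, in one central indeterminate 'X. *)
Definition free_algebra_t (I : choiceType) : kalgebra K :=
  KAlgebra (@free_t_central I).

End Algebras.

Section LinearAlgebra.
Variable K : fieldType.

(* The vector space with basis I; K^o is K as a module over itself. *)
Definition vec (I : finType) := {ffun I -> K^o}.

Definition bvec (I : finType) (x : I) : vec I := [ffun y => (y == x)%:R].

(* The linear map with prescribed values on the basis. *)
Definition lin_ext (I : finType) (W : vectType K) (b : I -> W) :
    'Hom(vec I, W) :=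
  linfun (fun u : vec I => \sum_x (u x : K) *: b x).

Lemma lin_ext_bvec (I : finType) (W : vectType K) (b : I -> W) (x : I) :
  lin_ext b (bvec x) = b x.
Proof.
pose h := fun u : vec I => \sum_x (u x : K) *: b x.
have lin_h : linear h.
  move=> a u v; rewrite /h scaler_sumr -big_split; apply: eq_bigr => y _ /=.
  by rewrite !ffunE scalerDl scalerA.
pose H := GRing.isLinear.Build K (vec I) W *:%R h lin_h.
pose hl : {linear vec I -> W} := HB.pack h H.
rewrite /lin_ext -[LHS]/(linfun hl (bvec x)) lfunE /= /h (bigD1 x) //= big1.
  by rewrite ffunE eqxx scale1r addr0.
by move=> y /negPf yx; rewrite ffunE yx scale0r.
Qed.

(* vec (I * J) is the tensor product of vec I and vec J. *)
Definition tens (I J : finType) (u : vec I) (v : vec J) : vec (I * J)%type :=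
  [ffun x => u x.1 * v x.2].

Definition tens_hom (I J I' J' : finType) (f : 'Hom(vec I, vec I'))
    (g : 'Hom(vec J, vec J')) :
    'Hom(vec (I * J)%type, vec (I' * J')%type) :=
  lin_ext (fun x => tens (f (bvec x.1)) (g (bvec x.2))).

(* id (x) f (x) id, with the four factors grouped as (1,2),(3,4) on both
   sides. *)
Definition mid_hom (I M J J' L L' : finType)
    (f : 'Hom(vec (J * L)%type, vec (J' * L')%type)) :
    'Hom(vec ((I * J) * (L * M))%type, vec ((I * J') * (L' * M))%type) :=
  lin_ext (fun x => [ffun y =>
    bvec x.1.1 y.1.1 * f (bvec (x.1.2, x.2.1)) (y.1.2, y.2.1)
      * bvec x.2.2 y.2.2]).

End LinearAlgebra.

(* Throughout, s stands for q ^ (1 / 2n), so that every fractional power of q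
   in use is a power of s. Indices are 0-based: i : 'I_n is the index i + 1 of
   the usual formulas. *)
Section QuantumSL.
Variables (K : fieldType) (n : nat) (s : K).

Definition q : K := s ^+ (2 * n).
Definition q_half : K := s ^+ n.
Definition q_root : K := s ^+ 2.
Definition omega : K := q - q^-1.

Local Notation M := 'M[K]_n.

(* The matrix unit e^(i+1)_(j+1); e^i_j e^k_l = delta^k_j e^i_l makes the upper
   index the row. *)
Definition munit (i j : nat) : M :=
  \matrix_(a, b) ((a == i :> nat) && (b == j :> nat))%:R.

(* Elements of End V (x) End V (x) A: F (a, c) (b, d) is the coefficient of
   e^a_b (x) e^c_d. *)
Definition mat2 (A : Type) := 'I_n * 'I_n -> 'I_n * 'I_n -> A.

Definition mat2_mul (A : pzRingType) (F G : mat2 A) : mat2 A :=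
  fun x z => \sum_y F x y * G y z.

Definition Smat : mat2 K := fun x y =>
  let: (a, c) := x in let: (b, d) := y in
  q * [&& a == b, b == c & c == d]%:R
  + [&& a != b, c == b & d == a]%:R
  + omega * [&& a == b, c == d & (a < c)%N]%:R.

Definition L_algebra : kalgebra K := free_algebra K ('I_n * 'I_n)%type.

Definition Lgen (i j : 'I_n) : L_algebra := << fmu (i, j) >>.

(* 1 (x) L, where L = \sum L^i_j e^j_i: the coefficient of e^c_d is L^d_c. *)
Definition L2 : mat2 L_algebra := fun x y =>
  let: (a, c) := x in let: (b, d) := y in if a == b then Lgen d c else 0.

Definition SA : mat2 L_algebra := fun x y => kalg_scalar L_algebra (Smat x y).

Definition RE_relations : set L_algebra := [set r | exists x y,
  r = mat2_mul (mat2_mul (mat2_mul L2 SA) L2) SA x y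
      - mat2_mul (mat2_mul (mat2_mul SA L2) SA) L2 x y]%classic.

Definition A_RE : kalgebra K := kquot RE_relations.

Definition TrqL : A_RE :=
  quot_pi RE_relations
    (\sum_(i < n) kalg_scalar L_algebra (q ^- (2 * i)) * Lgen i i).

Definition TrqId : K := \sum_(i < n) q ^- (2 * i).

Definition A_RE_at (lambda : K) : kalgebra K :=
  @kquot K A_RE [set TrqL - kalg_scalar A_RE lambda]%classic.

(* rho of H_i, X_i^+, X_i^-, q^(H_i/2) and q^(-H_i/2), for i.+1 < n. *)
Definition rhoH (i : nat) : M := munit i i - munit i.+1 i.+1.
Definition rhoX (pos : bool) (i : nat) : M :=
  if pos then munit i i.+1 else munit i.+1 i.
Definition rhoK (i : nat) : M :=
  1%:M + (q_half - 1) *: munit i i + (q_half^-1 - 1) *: munit i.+1 i.+1.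
Definition rhoKV (i : nat) : M :=
  1%:M + (q_half^-1 - 1) *: munit i i + (q_half - 1) *: munit i.+1 i.+1.

(* x |> A = rho(x_(2)) A rho(antipode x_(1)) for x = H_i, X_i^+ or X_i^-,
   q^(H_i/2), q^(-H_i/2), with the coproducts
     H (x) 1 + 1 (x) H,  X (x) q^(-H/2) + q^(H/2) (x) X
   and, the last two being group-like, antipode q^(H/2) = q^(-H/2). *)
Definition actH (i : nat) (A : M) : M :=
  A *m (- rhoH i) + rhoH i *m A.
Definition actX (pos : bool) (i : nat) (A : M) : M :=
  rhoKV i *m A *m ((if pos then - q^-1 else - q) *: rhoX pos i)
  + rhoX pos i *m A *m rhoKV i.
Definition actK (i : nat) (A : M) : M := rhoK i *m A *m rhoKV i.
Definition actKV (i : nat) (A : M) : M := rhoKV i *m A *m rhoK i.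

(* Stability under q^(+-H_i/2) follows from stability under H_i: these act by
   scalars on the eigenspaces of H_i. *)
Definition submodule (U : {vspace M}) : Prop :=
  forall i A, (i.+1 < n)%N -> A \in U ->
    actH i A \in U /\ forall pos, actX pos i A \in U.

Definition generated_submodule (v : M) (U : {vspace M}) : Prop :=
  [/\ submodule U, v \in U
    & forall U', submodule U' -> v \in U' -> (U <= U')%VS].

Definition adjoint_module (g : {vspace M}) : Prop :=
  generated_submodule (munit n.-1 0) g.

Definition m0 : {vspace M} := <[\sum_(i < n) q ^- (2 * i) *: munit i i]>%VS.

(* M* = V (x) V*, with e^i_j <-> e_j (x) f^i at index (j, i). *)
Definition MM := vec K (('I_n * 'I_n) * ('I_n * 'I_n))%type.

Definition vecM (A : M) : vec K ('I_n * 'I_n)%type := [ffun x => A x.2 x.1].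
Definition tensM (A B : M) : MM := tens (vecM A) (vecM B).

Definition VV := vec K ('I_n * 'I_n)%type.

Definition sgn_lt (i j : 'I_n) : K := if (i < j)%N then 1 else -1.

Definition tau_VV : 'End(VV) := lin_ext (fun x : 'I_n * 'I_n => let: (i, j) := x in
  if i == j then bvec K (i, i) else
    (sgn_lt i j * ((1 - q ^+ 2) / (1 + q ^+ 2))) *: bvec K (i, j)
    + ((2 * q) / (1 + q ^+ 2)) *: bvec K (j, i)).

Definition tau_DD : 'End(VV) := lin_ext (fun x : 'I_n * 'I_n => let: (i, j) := x in
  if i == j then bvec K (i, i) else
    (sgn_lt j i * ((1 - q ^+ 2) / (1 + q ^+ 2))) *: bvec K (i, j)
    + ((2 * q) / (1 + q ^+ 2)) *: bvec K (j, i)).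

(* V (x) V* -> V* (x) V; on the left (j, i) is e_j (x) f^i, on the right
   (i, j) is f^i (x) e_j. *)
Definition tau_VD : 'End(VV) := lin_ext (fun x : 'I_n * 'I_n => let: (j, i) := x in
  if i == j then
    q_root^-1 *: (q *: bvec K (i, i)
                  + omega *: \sum_(k < n | (i < k)%N) bvec K (k, k))
  else q_root^-1 *: bvec K (i, j)).

Definition tau_RE : 'End(MM) :=
  (mid_hom 'I_n 'I_n tau_VD
   \o (tens_hom tau_VV tau_DD \o mid_hom 'I_n 'I_n (tau_VD^-1)%VF))%VF.

Definition I_plus : {vspace MM} := lker (tau_RE - \1)%VF.
Definition I_minus : {vspace MM} := lker (tau_RE + \1)%VF.

Definition tens_vs (U W : {vspace M}) : {vspace MM} :=
  <<[seq tensM A B | A <- vbasis U, B <- vbasis W]>>%VS.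

Section Adjoint.
Variable g : {vspace M}.

Definition proj_gg : 'End(MM) :=
  daddv_pi (tens_vs g g) (tens_vs m0 fullv + tens_vs fullv m0).

Definition sym_gg : {vspace MM} := (I_plus :&: tens_vs g g)%VS.
Definition asym_gg : {vspace MM} := (proj_gg @: I_minus)%VS.

(* 1 on sym_gg and -1 on asym_gg; only the restriction to g (x) g matters. *)
Definition tau_tilde : 'End(MM) :=
  (daddv_pi sym_gg asym_gg - daddv_pi asym_gg sym_gg)%VF.

(* A map g (x) g -> g is represented by any linear extension of it to
   M* (x) M* -> M*. *)
Definition deformed_bracket (br : 'Hom(MM, M)) : Prop :=
  let b A B := br (tensM A B) in
  [/\ forall u, u \in tens_vs g g -> br u \in g,
      exists2 u, u \in tens_vs g g & br u != 0,
      forall i A B, (i.+1 < n)%N -> A \in g -> B \in g ->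
        actH i (b A B) = b (actH i A) B + b A (actH i B) /\
        forall pos, actX pos i (b A B)
          = b (actX pos i A) (actKV i B) + b (actK i A) (actX pos i B)
    & forall u, u \in tens_vs g g -> tau_tilde u = u -> br u = 0].

(* T(g)[t]: the tensor algebra T(g) is the free algebra on a basis of g. *)
Definition Tg_t : kalgebra K := free_algebra_t K 'I_(\dim g).

(* The inclusion g -> T(g)[t], extended linearly to M*; the values outside g
   depend on the choice of coord, but do not affect S_relations. *)
Definition g_incl (A : M) : Tg_t :=
  (\sum_(i < \dim g)
     coord (vbasis g) i A *: (<< fmu i >> : {malg K[{fmonom _}]}))%:P.

(* The inclusion g (x) g -> T(g)[t], extended linearly to M* (x) M*: since
   g_incl is linear, tensM A B is sent to g_incl A * g_incl B. *)
Definition gg_incl (u : MM) : Tg_t :=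
  \sum_x kalg_scalar Tg_t (u x)
         * (g_incl (munit x.1.2 x.1.1) * g_incl (munit x.2.2 x.2.1)).

Definition t_var : Tg_t := 'X.

Definition S_relations (br : 'Hom(MM, M)) : set Tg_t :=
  [set r | exists A B, [/\ A \in g, B \in g
    & r = g_incl A * g_incl B - gg_incl (tau_tilde (tensM A B))
          - t_var * g_incl (br (tensM A B))]]%classic.

Definition S_qt (br : 'Hom(MM, M)) : kalgebra K := kquot (S_relations br).

Definition S_qt_at (br : 'Hom(MM, M)) (t0 : K) : kalgebra K :=
  @kquot K (S_qt br)
    [set quot_pi (S_relations br) t_var - kalg_scalar (S_qt br) t0]%classic.

End Adjoint.
End QuantumSL.

Section ClassicalLimit.
Variables (C : fieldType) (n : nat).
Local Notation Cs := {fraction {poly C}}.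

(* The rational function f of s is regular at s = 1, with value c there. *)
Definition value_at1 (f : Cs) (c : C) : Prop :=
  exists a b : {poly C}, [/\ b.[1] != 0, f = tofrac a / tofrac b & c = a.[1] / b.[1]].

Definition mx_value_at1 (A : 'M[Cs]_n) (A1 : 'M[C]_n) : Prop :=
  forall i j, value_at1 (A i j) (A1 i j).

Definition tends_to_Lie_bracket (g : {vspace 'M[Cs]_n})
    (br : 'Hom(MM Cs n, 'M[Cs]_n)) : Prop :=
  forall A B A1 B1, A \in g -> B \in g ->
    mx_value_at1 A A1 -> mx_value_at1 B B1 ->
    mx_value_at1 (br (tensM A B)) (A1 *m B1 - B1 *m A1).

End ClassicalLimit.

(* Main.v *)
(* Write q = s^(2n) and h = q + 1/q. By adjoint_moduleE, g is the space of
   matrices of trace 0. Let Phi be tau_{V (x) V*} acting on the two middle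
   factors; then tau_RE = P Q, where P and Q are commuting involutions,
   conjugate under Phi to tau_{V (x) V} and tau_{V* (x) V*}. The reflection
   equation relations are the combinations L L(Q u - P u), so they span exactly
   the tau_RE-antisymmetric quadratic expressions in the entries of L.

   Let D = sum_i q^(-2i) e^i_i, which spans m_0, and let tr_1 = tr (x) id and
   tr_2 = id (x) tr be the partial traces M* (x) M* -> M*. The bracket is the
   restriction of c tr_1 tau_RE to g (x) g, with c = h^2 / (omega (h^2 - 2)):
   it is equivariant, it vanishes on symmetric tensors, since tr_1 vanishes on
   g (x) g, and on the projection p(u) of an antisymmetric u it equals
   - (2 / omega) (tr_1 u + tr_2 u). Since
     u = p(u) + (D (x) tr_1 u + tr_2 u (x) D) / tr D,
   the substitution L = L_0 + lambda / Tr_q(Id) turns the relation u = 0 of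
   A_RE / (Tr_q L - lambda) into the relation 2 p(u) = t [p(u)]_q of S_{q,t}(g)
   with t = lambda omega / Tr_q(Id), and conversely. As s -> 1 every operator
   tends to the corresponding flip, and the bracket to the commutator. *)
Require Import Defs.
From HB Require Import structures.
From mathcomp Require Import all_boot all_order all_algebra.
From mathcomp Require Import boolp classical_sets monalg ring zify.
From mathcomp Require Import complex reals.

Set Implicit Arguments.
Unset Strict Implicit.
Unset Printing Implicit Defensive.

Import GRing.Theory.
Local Open Scope ring_scope.

(** * Free algebras and quotients *)

(** The obstacle is that [tau_RE] does not preserve g (x) g: the projection p does not commute with
    it, and the defect is what the bracket measures. So the splitting of g (x) g into its symmetric
    and antisymmetric parts has to be proved. The tool is the Hecke operator (h tau + w)/2 attached
    to an involution tau, with w = [omega]. Its eigenvalues are q and -1/q, and its inverse is (h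
    tau - w)/2, because h^2 - w^2 = 4. Each partial trace is a contraction of the two middle factors
    preceded by such an operator, and tensoring with D is the insertion of D there followed by its
    inverse. Everything is thus reduced to one contraction and two commuting involutions. For a of
    trace 0, tr_1 tau_RE sends D (x) a to tr(D) (w^2/h^2) a, and 1 + w^2/h^2 = 2 (h^2 - 2)/h^2
    explains c; here h^2 - 2 is nonzero because q^4 + 1 is. Since L^i_j is e^i_j, the quantum trace
    of L appears as the element D, while the invariant form on M* is the ordinary trace, with tr D =
    Tr_q(Id). As c has a pole at s = 1, the classical limit is taken from a second formula for the
    bracket, valid on g (x) g. The algebras are compared through universal properties. *)

Definition kalg_morphism (K : fieldType) (A B : kalgebra K) (f : A -> B) :=
  forall a, f (kalg_scalar A a) = kalg_scalar B a.

(** A [kalgebra] may be the zero ring, whereas homomorphisms out of monoid algebras and polynomials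
    are built below with an [nzRingType] as target. This dichotomy separates the two cases. *)
Lemma pzRing_trivial_or_nz (B : pzRingType) :
  (1 = 0 :> B) \/ exists B' : nzRingType, (B' : pzRingType) = B.
Proof.
have [|nz] := eqVneq (1 : B) 0; [by left | right].
pose N := GRing.PzSemiRing_isNonZero.Build B nz.
pose B' : nzRingType := HB.pack (GRing.PzRing.sort B) N.
by exists B'; case: B nz @N @B' => ? [].
Qed.

Lemma trivial_rmorphism (A B : pzRingType) :
  1 = 0 :> B -> exists f : {rmorphism A -> B}, True.
Proof.
move=> B10; pose f (x : A) : B := 0.
have fz : zmod_morphism f by move=> x y; rewrite subr0.
have fm : GRing.monoid_morphism f by split=> [|x y]; rewrite /f ?mul0r.
pose fZ := GRing.isZmodMorphism.Build A B f fz.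
pose fM := GRing.isMonoidMorphism.Build A B f fm.
by exists (HB.pack_for {rmorphism A -> B} f fZ fM).
Qed.

Lemma trivial_ring_eq (B : pzRingType) (x y : B) : 1 = 0 :> B -> x = y.
Proof. by move=> B10; rewrite -[x]mulr1 -[y]mulr1 B10 !mulr0. Qed.

Section FreeHom.
Variables (K : fieldType) (I : choiceType).

Lemma free_algebra_hom (B : kalgebra K) (v : I -> B) :
  exists f : {rmorphism free_algebra K I -> B},
    kalg_morphism f /\ forall i, f << fmu i >> = v i.
Proof.
case: B v => B sc scC /= v.
case: (pzRing_trivial_or_nz B) => [B10|[B' eB]].
  have [f _] := trivial_rmorphism (free_algebra K I) B10.
  by exists f; split=> [a|i]; apply: (@trivial_ring_eq B).
subst B.
pose h (m : {fmonom I}) : B' := \prod_(i <- fmonom_val m) v i.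
have hm : mmorphism h.
  by split=> [x y|]; rewrite /h ?fmM ?fm1 ?big_nil // big_cat.
pose hM := isMultiplicative.Build {fmonom I} B' h hm.
pose hh : {mmorphism {fmonom I} -> B'} := HB.pack h hM.
pose f0 : {malg K[{fmonom I}]} -> B' := mmap sc hh.
have fz : zmod_morphism f0 by exact: mmap_is_additive.
have fm : GRing.monoid_morphism f0.
  have comm_hh g m m' : GRing.comm (sc (g : {malg K[{fmonom I}]})@_m) (hh m').
    exact: scC.
  by have [] := commr_mmap_is_multiplicative comm_hh; split.
pose fZ := GRing.isZmodMorphism.Build {malg K[{fmonom I}]} B' f0 fz.
pose fM := GRing.isMonoidMorphism.Build {malg K[{fmonom I}]} B' f0 fm.
exists (HB.pack_for {rmorphism {malg K[{fmonom I}]} -> B'} f0 fZ fM).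
split=> [a|i]; first exact: mmapC.
have f0U : f0 << fmu i >> = sc 1 * h (fmu i) by exact: mmapU.
by apply: (etrans f0U); rewrite (rmorph1 sc) mul1r /h fmU big_seq1.
Qed.

Lemma free_algebra_hom_eq (B : pzRingType)
    (f g : {rmorphism free_algebra K I -> B}) :
  (forall a, f (kalg_scalar (free_algebra K I) a)
             = g (kalg_scalar (free_algebra K I) a)) ->
  (forall i, f << fmu i >> = g << fmu i >>) -> f =1 g.
Proof.
move=> eq_sc eq_gen x.
have monE (m : {fmonom I}) :
    << m >> = \prod_(i <- fmonom_val m) << fmu i >> :> {malg K[{fmonom I}]}.
  case: m => s /=; elim: s => [|i s IHs].
    rewrite big_nil /one /= /fgone; congr << _ >>.
    by apply/eqP; rewrite -val_eqE /= fm1.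
  rewrite big_cons -IHs malgM_def fgmulUU mulr1; congr << _ >>.
  by apply/eqP; rewrite -val_eqE /= fmM fmU.
rewrite [x]monalgE !rmorph_sum.
apply: eq_bigr => m _.
have -> : << x@_m *g m >> = kalg_scalar (free_algebra K I) x@_m
    * (<< m >> : free_algebra K I).
  by rewrite /= malgM_def /malgC fgmulUU mulr1 mul1m.
rewrite !rmorphM /= eq_sc; congr (_ * _).
rewrite monE; elim: (fmonom_val m) => [|i s IHs].
  by rewrite big_nil !rmorph1.
by rewrite big_cons !rmorphM IHs eq_gen.
Qed.

Lemma free_algebra_t_hom (B : kalgebra K) (v : I -> B) (u : B) :
  (forall x, GRing.comm u x) ->
  exists f : {rmorphism free_algebra_t K I -> B},
    [/\ kalg_morphism f, forall i, f (<< fmu i >>%:P) = v i & f 'X = u].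
Proof.
move=> uC; have [f0 [f0K f0v]] := free_algebra_hom v.
case: B u v uC f0 f0K f0v => B sc scC /= u v uC f0 f0K f0v.
case: (pzRing_trivial_or_nz B) => [B10|[B' eB]].
  have [f _] := trivial_rmorphism (free_algebra_t K I) B10.
  by exists f; split=> [a|i|]; apply: (@trivial_ring_eq B).
subst B.
have cu : commr_rmorph f0 u by move=> x; apply: uC.
exists (horner_morph cu : {rmorphism {poly {malg K[{fmonom I}]}} -> B'}).
split=> [a|i|].
- by apply: (etrans (horner_morphC cu _)); apply: f0K.
- by apply: (etrans (horner_morphC cu _)); apply: f0v.
- exact: (horner_morphX cu).
Qed.

Lemma free_algebra_t_hom_eq (B : pzRingType)
    (f g : {rmorphism free_algebra_t K I -> B}) :
  (forall a, f (kalg_scalar (free_algebra_t K I) a)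
             = g (kalg_scalar (free_algebra_t K I) a)) ->
  (forall i, f (<< fmu i >>%:P) = g (<< fmu i >>%:P)) -> f 'X = g 'X -> f =1 g.
Proof.
move=> eq_sc eq_gen eq_X.
have eqC c : f c%:P = g c%:P.
  pose f' : {rmorphism free_algebra K I -> B} := (f \o @polyC _)%FUN.
  pose g' : {rmorphism free_algebra K I -> B} := (g \o @polyC _)%FUN.
  exact: (free_algebra_hom_eq (f := f') (g := g')).
elim/poly_ind => [|p c IHp]; first by rewrite !rmorph0.
by rewrite !rmorphD !rmorphM IHp eq_X eqC.
Qed.

End FreeHom.

Section QuotHom.
Variables (A B : pzRingType) (X : set A) (f : {rmorphism A -> B}).
Hypothesis fX : forall x, X x -> f x = 0.

Lemma quot_hom : exists g : {rmorphism quot_ring X -> B}, forall x, g (quot_pi X x) = f x.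
Proof.
have fI x : x \in gen_ideal X -> f x = 0.
  (* The generated ideal is an intersection of ideals, so it suffices to test it on the kernel of
     [f]. *)
  move/asboolP => /(_ (fun y => f y = 0)%classic); apply; last exact: fX.
  split=> [|x1 y1 fx fy|a x1 b fx]; first exact: rmorph0.
  - by rewrite rmorphB fx fy subrr.
  - by rewrite !rmorphM fx mulr0 mul0r.
have fr x : f (quot_repr (quot_pi X x)) = f x.
  apply/eqP; rewrite -subr_eq0 -rmorphB; apply/eqP/fI.
  by rewrite -quot_pi_eq quot_reprK.
pose g (x : quot_ring X) := f (quot_repr x).
have gz : zmod_morphism g.
  move=> x y; rewrite -[x]quot_reprK -[y]quot_reprK -rmorphB /g !fr.
  exact: rmorphB.
have gm : GRing.monoid_morphism g.
  split=> [|x y]; first by rewrite /g -[1]/(quot_pi X 1) fr rmorph1.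
  rewrite -[x]quot_reprK -[y]quot_reprK -rmorphM /g !fr.
  exact: rmorphM.
pose gZ := GRing.isZmodMorphism.Build (quot_ring X) B g gz.
pose gM := GRing.isMonoidMorphism.Build (quot_ring X) B g gm.
by exists (HB.pack_for {rmorphism quot_ring X -> B} g gZ gM) => x; apply: fr.
Qed.

End QuotHom.

Lemma quot_pi_surj (A : pzRingType) (X : set A) (y : quot_ring X) :
  exists x, y = quot_pi X x.
Proof. by exists (quot_repr y); rewrite quot_reprK. Qed.

Lemma quot_pi_rel (A : pzRingType) (X : set A) x : X x -> quot_pi X x = 0.
Proof.
move=> Xx; apply/eqP; rewrite -[0](rmorph0 (quot_pi X)) quot_pi_eq subr0.
by apply/asboolP => J _; apply.
Qed.

(** * Commuting involutions and partial traces *)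

Definition linear_form (K : fieldType) (V : vectType K) (f : V -> K) : Prop :=
  forall a x y, f (a *: x + y) = a * f x + f y.

Lemma linear_formE (K : fieldType) (V : vectType K) (f : V -> K) :
  linear_form f -> ((forall x y : V, f (x + y)%R = (f x + f y)%R)
   * (forall x : V, f (- x)%R = (- f x)%R)
   * (forall a (x : V), f (a *: x)%R = (a * f x)%R) * (f 0%R = 0%R))%type.
Proof.
move=> fl; have f0 : f 0 = 0.
  by apply: (addIr (f 0)); rewrite add0r -{1}[f 0]mul1r -fl scale1r addr0.
have fZ a x : f (a *: x) = a * f x by rewrite -[a *: x]addr0 fl f0 addr0.
have fD x y : f (x + y) = f x + f y by rewrite -{1}[x]scale1r fl mul1r.
by do !split=> //; move=> x; rewrite -scaleN1r fZ mulN1r.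
Qed.

(* Testing against linear forms reduces identities between vectors to
   identities between scalars, which ring and field decide. *)
Lemma vect_form_ext (K : fieldType) (V : vectType K) (x y : V) :
  (forall f : V -> K, linear_form f -> f x = f y) -> x = y.
Proof.
move=> fxy; rewrite (coord_vbasis (memvf x)) (coord_vbasis (memvf y)).
apply: eq_bigr => i _; congr (_ *: _); apply: fxy => a u v.
exact: (linearP (coord (vbasis fullv) i)).
Qed.

Lemma hom_linE (K : fieldType) (U V : vectType K) (f : 'Hom(U, V)) :
  ((forall x y : U, f (x + y)%R = (f x + f y)%R)
   * (forall x : U, f (- x)%R = (- f x)%R)
   * (forall a (x : U), f (a *: x)%R = (a *: f x)%R) * (f 0%R = 0%R))%type.
Proof. by do !split=> *; rewrite ?linear0 ?linearD ?linearN ?linearZ. Qed.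

Lemma hom_sum (K : fieldType) (U V : vectType K) (f : 'Hom(U, V))
    (I : Type) (r : seq I) (P : pred I) (F : I -> U) :
  f (\sum_(i <- r | P i) F i) = \sum_(i <- r | P i) f (F i).
Proof. exact: linear_sum. Qed.

Ltac vect_linear :=
  apply: vect_form_ext;
  let f := fresh "f" in let fl := fresh "fl" in
  intros f fl; rewrite !(linear_formE fl).

(** A certificate rule: the coefficients [c1], [c2] are supplied by hand, and [ring] or [field]
    checks the combination. *)
Lemma lin_comb2 (K : pzRingType) (l r l1 r1 l2 r2 c1 c2 : K) :
  l1 = r1 -> l2 = r2 -> l - r = c1 * (l1 - r1) + c2 * (l2 - r2) -> l = r.
Proof. by move=> -> -> /eqP; rewrite !subrr !mulr0 addr0 subr_eq0 => /eqP. Qed.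

(* The algebra behind the deformed bracket, with U = M* (x) M*, V = M*,
   tau_RE = P Q, the partial traces tL and tR, dl a = D (x) a, dr a = a (x) D.
   In terms of V (x) V (x) V* (x) V*, t2 contracts the two middle factors, up to
   a scalar, and Y inserts D there; the hypotheses tLE, tRE, dlE and drE hold
   because tL, tR, dl and dr differ from t2 and Y by a Hecke operator. *)
Section TwistedPair.
Variables (K : fieldType) (U V : vectType K).
Variables (P Q : 'End(U)) (tL tR t2 : 'Hom(U, V)) (dl dr Y : 'Hom(V, U)).
Variables (tr : V -> K) (D : V) (q : K).
Local Notation w := (q - q^-1).
Local Notation h := (q + q^-1).
Local Notation tD := (tr D).
Local Notation tau u := (P (Q u)).
Hypothesis tr_form : linear_form tr.
Hypothesis nz2 : 2 != 0 :> K.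
Hypothesis nzq : q != 0.
Hypothesis nzqm : q * q - 1 != 0.
Hypothesis nzqp : q * q + 1 != 0.
Hypothesis nzq4 : q ^+ 4 + 1 != 0.
Hypothesis nztD : tD != 0.
Hypothesis PP : forall u, P (P u) = u.
Hypothesis QQ : forall u, Q (Q u) = u.
Hypothesis PQ : forall u, P (Q u) = Q (P u).
Hypothesis tLE : forall u, tL u = 2^-1 *: (h *: t2 (P u) + w *: t2 u).
Hypothesis tRE : forall u, tR u = 2^-1 *: (h *: t2 (Q u) + w *: t2 u).
Hypothesis dlE : forall a, dl a = 2^-1 *: (h *: P (Y a) - w *: Y a).
Hypothesis drE : forall a, dr a = 2^-1 *: (h *: Q (Y a) - w *: Y a).
Hypothesis t2Y : forall a, t2 (Y a) = tD *: a.
Hypothesis tLdr : forall a, tL (dr a) = tr a *: D.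
Hypothesis tRdl : forall a, tR (dl a) = tr a *: D.
Hypothesis dlD : dl D = dr D.
Hypothesis trt : forall u, tr (tL u) = tr (tR u).

Let nzh : h != 0.
Proof.
have -> : h = (q * q + 1) / q by field.
by rewrite mulf_neq0 ?invr_eq0.
Qed.

Let nzh2 : (q * q + 1) ^+ 2 + -2 * q ^+ 2 != 0.
Proof. by move: nzq4; congr (_ != 0); ring. Qed.

Let lin := hom_linE.
Let trlin := linear_formE tr_form.

Lemma tau_tau u : tau (tau u) = u.
Proof. by rewrite -[Q (P _)]PQ QQ PP. Qed.

(** [tL] is [t2] after the Hecke operator of [P], and [dl] is the inverse of that operator after
    [Y]; the two cancel and leave [t2Y]. *)
Lemma tL_dl a : tL (dl a) = tD *: a.
Proof.
rewrite tLE dlE !lin PP; rewrite -t2Y; vect_linear; field.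
by rewrite nz2 nzq.
Qed.

Lemma tR_dr a : tR (dr a) = tD *: a.
Proof.
rewrite tRE drE !lin QQ; rewrite -t2Y; vect_linear; field.
by rewrite nz2 nzq.
Qed.

(** The difference is a multiple of (P - Q) Y a, and applying P Q exchanges P Y a with Q Y a. *)
Lemma tau_anti a : tau (dl a - dr a) = - (dl a - dr a).
Proof.
by rewrite dlE drE !lin !QQ !PQ PP; vect_linear; ring.
Qed.

Lemma anti_PQ u : tau u = - u -> Q u = - P u.
Proof. by move=> /(congr1 P); rewrite PP lin. Qed.

Lemma sym_PQ u : tau u = u -> Q u = P u.
Proof. by move=> /(congr1 P); rewrite PP. Qed.

Lemma tLR_sym u : tau u = u -> tL u = tR u.
Proof. by move/sym_PQ=> e; rewrite tLE tRE e. Qed.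

(** The [w]-terms of [tLE] and [tRE] are equal, so [trt] compares the [h]-terms alone. *)
Lemma tr_t2 u : tr (t2 (P u)) = tr (t2 (Q u)).
Proof.
have := trt u; rewrite tLE tRE !trlin.
by move/(mulfI (invr_neq0 nz2))/addIr/(mulfI nzh).
Qed.

Lemma tr_t2_anti u : tau u = - u -> tr (t2 (P u)) = 0.
Proof.
move/anti_PQ => e; have := tr_t2 u; rewrite e lin trlin => /eqP.
rewrite -subr_eq0 opprK -mulr2n -mulr_natl mulf_eq0 (negbTE nz2) /=.
by move/eqP.
Qed.

Lemma tr_tL_anti u : tau u = - u -> tr (tL u) = 0.
Proof.
move=> e; rewrite tLE !trlin tr_t2_anti //.
(* [P u] is antisymmetric as well; this kills the remaining term, which contains [t2 u]. *)
have eP : tau (P u) = - P u by rewrite -PQ e lin.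
by have := tr_t2_anti eP; rewrite PP => ->; rewrite !mulr0 addr0 mulr0.
Qed.

(** Expanding [tLdr] and [tRdl] gives two linear equations in t2 P Y a, t2 Q Y a and t2 P Q Y a.
    Their difference identifies the first two, and their sum determines the third. *)
Lemma t2_YPQ a : t2 (P (Y a)) = t2 (Q (Y a)) /\
  h ^+ 2 *: t2 (P (Q (Y a))) = (w ^+ 2 * tD) *: a + (4 * tr a) *: D.
Proof.
have := tLdr a; rewrite tLE drE !lin t2Y.
have := tRdl a; rewrite tRE dlE !lin t2Y -PQ.
set x := t2 (P (Y a)); set y := t2 (Q (Y a)); set z := t2 (P (Q (Y a))).
move=> e1 e2; split; apply: vect_form_ext => f /linear_formE fl.
all: move: (congr1 f e1) (congr1 f e2); rewrite !fl => {}e1 {}e2.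
  apply: (lin_comb2 (c1 := 2 / (h * w)) (c2 := - (2 / (h * w))) e1 e2).
  by field; rewrite nz2 nzq nzqm nzqp.
by apply: (lin_comb2 (c1 := 2 : K) (c2 := 2 : K) e1 e2); field; rewrite nz2 nzq.
Qed.

(** The terms in t2 Q Y a cancel, and (h^2 - w^2)/4 = 1 leaves exactly t2 P Q Y a, known from
    [t2_YPQ]. *)
Lemma tL_tau_dl a : tr a = 0 ->
  tL (tau (dl a)) = (tD * w ^+ 2 / h ^+ 2) *: a.
Proof.
move=> tra; have [exy ez] := t2_YPQ a; move: ez; rewrite tra mulr0 scale0r addr0.
have -> : tau (dl a) = 2^-1 *: (h *: Q (Y a) - w *: P (Q (Y a))).
  by rewrite dlE !lin -PQ PP.
rewrite tLE !lin PP; move=> /(congr1 (fun x => (h ^+ 2)^-1 *: x)).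
rewrite !scalerA mulVf ?expf_neq0 // scale1r => ->.
vect_linear; field.
by rewrite nz2 nzq nzqp.
Qed.

Definition in_gg u := tL u = 0 /\ tR u = 0.

(** The projection onto the common kernel of the partial traces, along the images of [dl] and [dr].
    The last term restores the component along D (x) D, which the middle term removes twice. *)
Definition gg_part u :=
  u - tD^-1 *: (dl (tL u) + dr (tR u)) + (tD ^- 2 * tr (tL u)) *: dl D.

Lemma gg_part_in u : in_gg (gg_part u).
Proof.
rewrite /in_gg /gg_part; split; rewrite !lin ?tL_dl ?tR_dr ?tLdr ?tRdl -?trt.
  by vect_linear; field; rewrite nztD.
by vect_linear; field; rewrite nztD.
Qed.

Lemma gg_part_id u : in_gg u -> gg_part u = u.
Proof.
case=> e1 e2; rewrite /gg_part e1 e2 !lin trlin mulr0 scale0r !addr0.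
by rewrite scaler0 subr0.
Qed.

Lemma gg_part_dl a : gg_part (dl a) = 0.
Proof.
rewrite /gg_part tL_dl tRdl !lin !trlin -dlD.
by vect_linear; field; rewrite nztD.
Qed.

Lemma gg_part_dr a : gg_part (dr a) = 0.
Proof.
rewrite /gg_part tLdr tR_dr !lin !trlin.
by vect_linear; field; rewrite nztD.
Qed.

Definition brk u := (h ^+ 2 / (w * (h ^+ 2 - 2))) *: tL (tau u).

Lemma gg_part_anti u : tau u = - u ->
  gg_part u = u - tD^-1 *: (dl (tL u) + dr (tR u)).
Proof.
by move=> eu; rewrite /gg_part tr_tL_anti // mulr0 scale0r addr0.
Qed.

(** As [dl a - dr a] is antisymmetric, this is [tL_tau_dl] shifted by tL (dl a - dr a) = tD a. *)
Lemma tL_tau_dr a : tr a = 0 ->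
  tL (tau (dr a)) = (tD * w ^+ 2 / h ^+ 2 + tD) *: a.
Proof.
move=> tra; have := congr1 tL (tau_anti a).
rewrite !lin tL_tau_dl // tL_dl tLdr tra scale0r => e.
apply: vect_form_ext => f fl; move/(congr1 f): e; rewrite !(linear_formE fl) => e.
by apply: (lin_comb2 (c1 := -1) (c2 := 0) e e); ring.
Qed.

(** Both [tL u] and [tR u] acquire the factor -(1 + w^2/h^2) = -2 (h^2 - 2)/h^2, which the
    normalization of [brk] turns into -2/w. *)
Lemma brk_gg_part u : tau u = - u ->
  brk (gg_part u) = - (2 / w) *: (tL u + tR u).
Proof.
move=> eu; have trL := tr_tL_anti eu; have trR : tr (tR u) = 0 by rewrite -trt.
rewrite gg_part_anti // /brk !lin eu !lin tL_tau_dl // tL_tau_dr //.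
vect_linear; field.
by rewrite nztD nzqp nzqm nzq nzh2.
Qed.

(** The antisymmetric half [um] of [u] is not yet the right [v]: [gg_part um] differs from [um] by a
    multiple of dl m + dr m, which need not be symmetric. A multiple of [d], the antisymmetric half
    of [dl m], corrects this. *)
Lemma gg_decomposition u : in_gg u ->
  exists2 v, tau v = - v & tau (u - gg_part v) = u - gg_part v.
Proof.
case=> e1 e2.
have [um umE] : exists um, um = 2^-1 *: (u - tau u) by eexists.
have um_anti : tau um = - um.
  by rewrite umE !lin tau_tau; vect_linear; ring.
have up_sym : tau (u - um) = u - um.
  by rewrite !lin um_anti umE; vect_linear; field; rewrite nz2.
have [m mE] : exists m, m = - tL um by eexists.
have tLum : tL um = - m by rewrite mE opprK.
(* The symmetric half [u - um] has equal partial traces, and those of [u] vanish. *)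
have tRum : tR um = - m.
  by have := tLR_sym up_sym; rewrite !lin e1 e2 !add0r tLum => /oppr_inj.
have trm : tr m = 0 by rewrite mE trlin tr_tL_anti ?oppr0.
have [d dE] : exists d, d = 2^-1 *: (dl m - tau (dl m)) by eexists.
have d_anti : tau d = - d by rewrite dE !lin tau_tau; vect_linear; ring.
have tLd : tL d = (2^-1 * (tD - tD * w ^+ 2 / h ^+ 2)) *: m.
  by rewrite dE !lin tL_dl tL_tau_dl //; vect_linear; ring.
have tRd : tR d = (- 2^-1 * (tD + tD * w ^+ 2 / h ^+ 2)) *: m.
  (* The symmetric half of [dl m] has equal partial traces, so [tR d] is obtained from [tL d]. *)
  have /tLR_sym : tau (dl m - d) = dl m - d.
    by rewrite !lin d_anti dE; vect_linear; field; rewrite nz2.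
  rewrite !lin tL_dl tRdl trm tLd scale0r => e.
  apply: vect_form_ext => f fl; move/(congr1 f): e.
  rewrite !(linear_formE fl) => e.
  by apply: (lin_comb2 (c1 := 1) (c2 := 0) e e); field; rewrite nz2 nzq nzqp.
(* The antisymmetric halves of gg_part um - um and of gg_part d are both multiples of d - (dl m - dr
   m)/2, with factors 2/tD and 1 + w^2/h^2; [kappa] is the quotient of these factors. *)
pose kappa := h ^+ 2 / (tD * (h ^+ 2 - 2)).
have v_anti : tau (um - kappa *: d) = - (um - kappa *: d).
  by rewrite !lin um_anti d_anti; vect_linear; ring.
exists (um - kappa *: d) => //.
have tau_dr : tau (dr m) = tau (dl m) + dl m - dr m.
  have := tau_anti m; rewrite !lin => e.
  apply: vect_form_ext => f fl; move/(congr1 f): e.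
  rewrite !(linear_formE fl) => e.
  by apply: (lin_comb2 (c1 := -1) (c2 := 0) e e); ring.
rewrite gg_part_anti // !lin um_anti d_anti tLum tRum tLd tRd !lin tau_dr.
rewrite /kappa dE umE.
vect_linear; field.
by rewrite nztD nzqp nzq nz2 nzh2.
Qed.

(** Applying [tL] to the symmetry hypothesis forces tR u = - tL u. The term subtracted from [u] is
    then a multiple of dl a - dr a, antisymmetric by [tau_anti], so [gg_part u] is symmetric and
    antisymmetric at once. *)
Lemma gg_part_sym_anti u : tau u = - u -> tau (gg_part u) = gg_part u ->
  gg_part u = 0.
Proof.
move=> eu ev; have trL := tr_tL_anti eu; have trR : tr (tR u) = 0 by rewrite -trt.
move: ev; rewrite gg_part_anti // !lin eu.
move eb : (tR u) trR => b trR; move ea : (tL u) trL => a trL ev.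
have tau_dr : tau (dr b) = tau (dl b) + dl b - dr b.
  have := tau_anti b; rewrite !lin => e.
  apply: vect_form_ext => f fl; move/(congr1 f): e.
  rewrite !(linear_formE fl) => e.
  by apply: (lin_comb2 (c1 := -1) (c2 := 0) e e); ring.
have b_a : b = - a.
  move/(congr1 tL): (ev).
  rewrite !lin tL_tau_dl // tL_tau_dr // tL_dl tLdr trR scale0r ea => e.
  apply: vect_form_ext => f fl; move/(congr1 f): e.
  rewrite !(linear_formE fl) => e.
  apply: (lin_comb2 (c1 := - h ^+ 2 / (2 * (h ^+ 2 - 2))) (c2 := 0) e e).
  by field; rewrite nztD nzqp nzq nz2 nzh2.
move: ev; rewrite tau_dr b_a !lin => e.
apply: vect_form_ext => f fl; move/(congr1 f): e.
rewrite !(linear_formE fl) => e.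
by apply: (lin_comb2 (c1 := - 2^-1) (c2 := 0) e e); field; rewrite nz2 nztD.
Qed.

(** Write tau u = u - 2 um with [um] antisymmetric: [tL u] vanishes and [tL um] is traceless. *)
Lemma tr_brk u : in_gg u -> tr (brk u) = 0.
Proof.
case=> e1 _; have [um umE] : exists um, um = 2^-1 *: (u - tau u) by eexists.
have um_anti : tau um = - um.
  by rewrite umE !lin tau_tau; vect_linear; ring.
have -> : brk u = (h ^+ 2 / (w * (h ^+ 2 - 2))) *: tL (u - 2 *: um).
  congr (_ *: tL _); rewrite umE.
  by vect_linear; field; rewrite nz2.
by rewrite !lin e1 !trlin tr_tL_anti // !(mulr0, oppr0, addr0).
Qed.

Lemma brk_sym u : in_gg u -> tau u = u -> brk u = 0.
Proof. by case=> e1 _ e; rewrite /brk e e1 scaler0. Qed.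

(** Eliminating t2 (Q u) by means of tR u = 0 brings out a factor w, which cancels the pole of the
    normalization at q = 1. This is the form whose limit can be taken. *)
Lemma brk_t2 u : in_gg u ->
  brk u = - (h ^+ 2 / (2 * (h ^+ 2 - 2))) *: (t2 u - t2 (tau u)).
Proof.
case=> _; rewrite tRE /brk tLE PP => e.
apply: vect_form_ext => f fl; move/(congr1 f): e.
rewrite !(linear_formE fl) => e.
apply: (lin_comb2 (c1 := h ^+ 2 / (w * (h ^+ 2 - 2))) (c2 := 0) e e).
by field; rewrite nzqm nzq nz2 nzh2.
Qed.

End TwistedPair.

(** * The operators on tensor powers of V and its dual *)

Section VecTheory.
Variable K : fieldType.

Lemma scale_regular (a : K) (x : K^o) : a *: x = a * (x : K) :> K.
Proof. by []. Qed.

Lemma vec_sum (I : finType) (u : vec K I) : u = \sum_x (u x : K) *: bvec K x.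
Proof.
apply/ffunP => y; rewrite sum_ffunE (bigD1 y) //= big1 ?addr0.
  by rewrite !ffunE eqxx; apply: esym (mulr1 _).
by move=> x /negPf xy; rewrite !ffunE eq_sym xy scaler0.
Qed.

Lemma hom_vec (I : finType) (W : vectType K) (f : 'Hom(vec K I, W)) u :
  f u = \sum_x (u x : K) *: f (bvec K x).
Proof.
by rewrite {1}[u]vec_sum linear_sum; apply: eq_bigr => x _; rewrite linearZ.
Qed.

Lemma lin_extE (I : finType) (W : vectType K) (b : I -> W) u :
  lin_ext b u = \sum_x (u x : K) *: b x.
Proof.
by rewrite hom_vec; apply: eq_bigr => x _; rewrite lin_ext_bvec.
Qed.

Lemma hom_vec_ext (I : finType) (W : vectType K) (f g : 'Hom(vec K I, W)) :
  (forall x, f (bvec K x) = g (bvec K x)) -> f = g.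
Proof.
move=> fg; apply/lfunP => u; rewrite !hom_vec.
by apply: eq_bigr => x _; rewrite fg.
Qed.

Lemma tens_bvec (I J : finType) (x : I) (y : J) :
  tens (bvec K x) (bvec K y) = bvec K (x, y).
Proof.
by apply/ffunP => -[a b]; rewrite !ffunE xpair_eqE -natrM mulnb.
Qed.

Lemma tens_linl (I J : finType) (v : vec K J) a (u u' : vec K I) :
  tens (a *: u + u') v = a *: tens u v + tens u' v.
Proof. by apply/ffunP => x; rewrite !ffunE !scale_regular mulrDl mulrA. Qed.

Lemma tens_linr (I J : finType) (u : vec K I) a (v v' : vec K J) :
  tens u (a *: v + v') = a *: tens u v + tens u v'.
Proof. by apply/ffunP => x; rewrite !ffunE !scale_regular mulrDr mulrCA. Qed.

Lemma tens_hom_bvec (I J I' J' : finType) (f : 'Hom(vec K I, vec K I'))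
    (g : 'Hom(vec K J, vec K J')) x :
  tens_hom f g (bvec K x) = tens (f (bvec K x.1)) (g (bvec K x.2)).
Proof. exact: lin_ext_bvec. Qed.

Lemma tens_homE (I J I' J' : finType) (f : 'Hom(vec K I, vec K I'))
    (g : 'Hom(vec K J, vec K J')) u v :
  tens_hom f g (tens u v) = tens (f u) (g v).
Proof.
rewrite lin_extE; apply/ffunP => y; rewrite sum_ffunE !ffunE.
rewrite [f u]hom_vec [g v]hom_vec !sum_ffunE big_distrlr /= pair_bigA /=.
by apply: eq_bigr => x _; rewrite !ffunE !scale_regular /= mulrACA.
Qed.

Lemma tens_hom_comp (I J I' J' I2 J2 : finType)
    (f : 'Hom(vec K I', vec K I2)) (g : 'Hom(vec K J', vec K J2))
    (f' : 'Hom(vec K I, vec K I')) (g' : 'Hom(vec K J, vec K J')) u :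
  tens_hom f g (tens_hom f' g' u) = tens_hom (f \o f')%VF (g \o g')%VF u.
Proof.
rewrite -comp_lfunE; congr (fun_of_lfun _ u).
by apply: hom_vec_ext => x; rewrite comp_lfunE !tens_hom_bvec tens_homE !comp_lfunE.
Qed.

Lemma tens_hom_id (I J : finType) u :
  tens_hom (\1%VF : 'End(vec K I)) (\1%VF : 'End(vec K J)) u = u.
Proof.
rewrite -[RHS]id_lfunE; congr (fun_of_lfun _ u).
by apply: hom_vec_ext => x; rewrite tens_hom_bvec !id_lfunE tens_bvec -surjective_pairing.
Qed.

(** The vector e_i (x) w (x) e_m with [w] in the two middle slots, regrouped as (1,2),(3,4) to match
    [mid_hom]. *)
Definition tmid (I M J L : finType) (i : I) (m : M) (w : vec K (J * L)%type) :
    vec K ((I * J) * (L * M))%type :=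
  [ffun y => bvec K i y.1.1 * w (y.1.2, y.2.1) * bvec K m y.2.2].

Lemma tmid_lin (I M J L : finType) (i : I) (m : M) a (u v : vec K (J * L)%type) :
  tmid i m (a *: u + v) = a *: tmid i m u + tmid i m v.
Proof. by apply/ffunP => y; rewrite !ffunE !scale_regular mulrDr mulrDl mulrCA !mulrA. Qed.

Lemma tmid0 (I M J L : finType) (i : I) (m : M) :
  tmid i m (0 : vec K (J * L)%type) = 0.
Proof. by apply/ffunP => y; rewrite !ffunE mulr0 mul0r. Qed.

Lemma tmidZ (I M J L : finType) (i : I) (m : M) a (u : vec K (J * L)%type) :
  tmid i m (a *: u) = a *: tmid i m u.
Proof. by rewrite -[a *: u]addr0 tmid_lin tmid0 addr0. Qed.

Lemma tmidD (I M J L : finType) (i : I) (m : M) (u v : vec K (J * L)%type) :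
  tmid i m (u + v) = tmid i m u + tmid i m v.
Proof. by rewrite -[u]scale1r tmid_lin !scale1r. Qed.

Lemma tmid_bvec (I M J L : finType) (i : I) (m : M) (j : J) (l : L) :
  tmid i m (bvec K (j, l)) = bvec K ((i, j), (l, m)).
Proof.
apply/ffunP => -[[a b] [c d]]; rewrite !ffunE /= !xpair_eqE -!natrM !mulnb.
by rewrite -!andbA.
Qed.

Lemma tmid_sum (I M J L : finType) (i : I) (m : M) (X : finType) (P : pred X)
    (w : X -> vec K (J * L)%type) :
  tmid i m (\sum_(x | P x) w x) = \sum_(x | P x) tmid i m (w x).
Proof.
apply/ffunP => y; rewrite !ffunE !sum_ffunE mulr_sumr mulr_suml.
by apply: eq_bigr => x _; rewrite !ffunE.
Qed.

Lemma mid_hom_tmid (I M J J' L L' : finType)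
    (f : 'Hom(vec K (J * L)%type, vec K (J' * L')%type)) (i : I) (m : M) w :
  mid_hom I M f (tmid i m w) = tmid i m (f w).
Proof.
rewrite [f w]hom_vec {1}[w]vec_sum !tmid_sum linear_sum /=; apply: eq_bigr => -[j l] _.
by rewrite !tmidZ hom_linE tmid_bvec /mid_hom lin_ext_bvec.
Qed.

Lemma mid_hom_bvec (I M J J' L L' : finType)
    (f : 'Hom(vec K (J * L)%type, vec K (J' * L')%type)) (i : I) (m : M) j l :
  mid_hom I M f (bvec K ((i, j), (l, m))) = tmid i m (f (bvec K (j, l))).
Proof. by rewrite -tmid_bvec mid_hom_tmid. Qed.

Lemma mid_hom_comp (I M J J' J2 L L' L2 : finType)
    (f : 'Hom(vec K (J' * L')%type, vec K (J2 * L2)%type))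
    (g : 'Hom(vec K (J * L)%type, vec K (J' * L')%type)) u :
  mid_hom I M f (mid_hom I M g u) = mid_hom I M (f \o g)%VF u.
Proof.
rewrite -comp_lfunE; congr (fun_of_lfun _ u).
apply: hom_vec_ext => -[[i j] [l m]].
by rewrite comp_lfunE !mid_hom_bvec mid_hom_tmid comp_lfunE.
Qed.

Lemma mid_hom_id (I M J L : finType) u :
  mid_hom I M (\1%VF : 'End(vec K (J * L)%type)) u = u.
Proof.
rewrite -[RHS]id_lfunE; congr (fun_of_lfun _ u).
apply: hom_vec_ext => -[[i j] [l m]].
by rewrite mid_hom_bvec !id_lfunE tmid_bvec.
Qed.

Lemma lfun_right_invK (V : vectType K) (f g : 'End(V)) :
  (forall u, f (g u) = u) -> forall u, g (f u) = u.
Proof.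
move=> fg u.
have g0 : lker g = 0%VS.
  by apply/eqP/lker0P => x y e; rewrite -[x]fg e fg.
have gT : limg g = fullv.
  apply/eqP; rewrite eqEdim subvf /=.
  by have := limg_ker_dim g fullv; rewrite capfv g0 dimv0 add0n => ->.
have: u \in limg g by rewrite gT memvf.
by case/memv_imgP => v _ ->; rewrite fg.
Qed.

(** The inverse [^-1] of a linear map is a total operation; in finite dimension a right inverse
    suffices to identify it. *)
Lemma lfun_right_inv (V : vectType K) (f g : 'End(V)) :
  (forall u, f (g u) = u) -> (f^-1)%VF = g.
Proof.
move=> fg; have gf := lfun_right_invK fg.
have f0 : lker f == 0%VS.
  by apply/lker0P => u v e; rewrite -[u]gf e gf.
by apply/lfunP => u; rewrite -{1}[u]fg lker0_lfunK.
Qed.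

End VecTheory.

Section QuantumOperators.
Variables (K : fieldType) (n : nat) (s : K).
Local Notation q := (q n s).
Local Notation w := (omega n s).
Local Notation h := (q + q^-1).
Local Notation qr := (q_root s).
Local Notation I := 'I_n.
Local Notation M := 'M[K]_n.
Local Notation MM := (MM K n).
Local Notation bv := (bvec K).
Local Notation Dq a := (q ^- (2 * a)).
Hypothesis nzs : s != 0.
Hypothesis nz2 : 2 != 0 :> K.

Let nzq : q != 0. Proof. by rewrite expf_neq0. Qed.
Let nzqr : qr != 0. Proof. by rewrite expf_neq0. Qed.

Lemma omega_telescope (c k : I) : (c < k)%N ->
  w * \sum_(a < n | (c < a)%N && (a < k)%N) Dq a = q^-1 * Dq c - q * Dq k.
Proof.
move=> ck.
have /= <- := big_ord_widen_cond n (fun a => c < a)%N (fun a : nat => Dq a)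
  (ltnW (ltn_ord k)).
have /= <- := big_geq_mkord c.+1 k xpredT (fun a : nat => Dq a).
rewrite mulr_sumr (GRing.telescope_sumr_eq (fun a => - q * Dq a) _ ck).
  by rewrite mulnS exprD; field; rewrite !expf_neq0.
by move=> a _; rewrite mulnS exprD /omega; field; rewrite !expf_neq0.
Qed.

(* The two orders of summation of a triangular array, with weights chosen so
   that the inner sum telescopes. *)
Lemma omega_resum (W : lmodType K) (X : I -> W) (c : I) :
  \sum_(a < n | (c < a)%N) Dq a *: (q *: X a + w *: \sum_(k < n | (a < k)%N) X k)
  = (q^-1 * Dq c) *: \sum_(k < n | (c < k)%N) X k.
Proof.
under eq_bigr => a _ do rewrite scalerDr !scalerA scaler_sumr.
rewrite big_split /= (exchange_big_dep (fun k : I => (c < k)%N)) /=; last first.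
  by move=> a k ca ak; apply: ltn_trans ak.
rewrite -big_split scaler_sumr; apply: eq_bigr => k ck /=.
rewrite -scaler_suml -scalerDl; congr (_ *: _).
have -> : \sum_(a < n | (c < a)%N && (a < k)%N) Dq a * w
    = w * \sum_(a < n | (c < a)%N && (a < k)%N) Dq a.
  by rewrite mulr_sumr; apply: eq_bigr => a _; rewrite mulrC.
by rewrite omega_telescope //; ring.
Qed.

Lemma tau_VV_bvec (i j : I) : tau_VV n s (bv (i, j)) =
  if i == j then bv (i, i) else
    (sgn_lt K i j * ((1 - q ^+ 2) / (1 + q ^+ 2))) *: bv (i, j)
    + ((2 * q) / (1 + q ^+ 2)) *: bv (j, i).
Proof. exact: lin_ext_bvec. Qed.

Lemma tau_DD_bvec (i j : I) : tau_DD n s (bv (i, j)) =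
  if i == j then bv (i, i) else
    (sgn_lt K j i * ((1 - q ^+ 2) / (1 + q ^+ 2))) *: bv (i, j)
    + ((2 * q) / (1 + q ^+ 2)) *: bv (j, i).
Proof. exact: lin_ext_bvec. Qed.

Lemma tau_VD_bvec (j i : I) : tau_VD n s (bv (j, i)) =
  if i == j then
    qr^-1 *: (q *: bv (i, i) + w *: \sum_(k < n | (i < k)%N) bv (k, k))
  else qr^-1 *: bv (i, j).
Proof. exact: lin_ext_bvec. Qed.

(** The explicit inverse of [tau_VD]. On the span of the e_k (x) f^k the latter is triangular with
    constant entries below the diagonal, and the weights q^(2i) q^(-2k) come from inverting it, see
    [omega_resum]. *)
Definition tau_DV : 'End(VV K n) := lin_ext (fun x : I * I => let: (i, j) := x in
  if i == j then
    qr *: (q^-1 *: bv (i, i)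
           - (w * q ^+ (2 * i)) *: \sum_(k < n | (i < k)%N) Dq k *: bv (k, k))
  else qr *: bv (j, i)).

Lemma tau_DV_bvec (i j : I) : tau_DV (bv (i, j)) =
  if i == j then
    qr *: (q^-1 *: bv (i, i)
           - (w * q ^+ (2 * i)) *: \sum_(k < n | (i < k)%N) Dq k *: bv (k, k))
  else qr *: bv (j, i).
Proof. exact: lin_ext_bvec. Qed.

Lemma tau_VD_DV u : tau_VD n s (tau_DV u) = u.
Proof.
rewrite -comp_lfunE -[RHS]id_lfunE; congr (fun_of_lfun _ u).
apply: hom_vec_ext => -[i j]; rewrite comp_lfunE id_lfunE tau_DV_bvec.
have [<-|ij] := eqVneq i j; last first.
  by rewrite hom_linE tau_VD_bvec (negPf ij) scalerA divff // scale1r.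
rewrite !hom_linE linear_sum /=.
under eq_bigr => k _ do rewrite hom_linE tau_VD_bvec eqxx scalerA [_ * qr^-1]mulrC -scalerA.
rewrite -scaler_sumr omega_resum tau_VD_bvec eqxx.
apply: vect_form_ext => f fl; rewrite !(linear_formE fl) /omega.
by field; rewrite nzqr !expf_neq0.
Qed.

Lemma tau_VD_inv : (tau_VD n s)^-1%VF = tau_DV.
Proof. exact: lfun_right_inv tau_VD_DV. Qed.

Lemma tau_DV_VD u : tau_DV (tau_VD n s u) = u.
Proof. exact: lfun_right_invK tau_VD_DV u. Qed.

(* These operators are locked to keep unification from unfolding them. *)
Fact S_VV_key : unit. Proof. by []. Qed.
Definition S_VV : 'End(VV K n) :=
  locked_with S_VV_key ((2^-1 *: (h *: tau_VV n s + w *: \1))%VF).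
Lemma S_VV_unlock : S_VV = (2^-1 *: (h *: tau_VV n s + w *: \1))%VF.
Proof. exact: locked_withE. Qed.
Fact S_DD_key : unit. Proof. by []. Qed.
Definition S_DD : 'End(VV K n) :=
  locked_with S_DD_key ((2^-1 *: (h *: tau_DD n s + w *: \1))%VF).
Lemma S_DD_unlock : S_DD = (2^-1 *: (h *: tau_DD n s + w *: \1))%VF.
Proof. exact: locked_withE. Qed.

Hypothesis nzqp : q * q + 1 != 0.

(** Passing from the involution to the operator with eigenvalues q and -1/q clears the denominators
    1 + q^2. The result is the R-matrix, to be matched with [Smat]. *)
Lemma S_VV_bvec (i j : I) : S_VV (bv (i, j)) =
  if i == j then q *: bv (i, i)
  else bv (j, i) + (w * (j < i)%:R) *: bv (i, j).
Proof.
rewrite S_VV_unlock scale_lfunE add_lfunE !scale_lfunE id_lfunE tau_VV_bvec /sgn_lt.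
have nzqp' : 1 + q ^+ 2 != 0 by rewrite addrC expr2.
have [<-|ij] := eqVneq i j.
  by apply: vect_form_ext => f fl; rewrite !(linear_formE fl) /omega; field; rewrite nz2 nzq.
have -> : (j < i)%N = ~~ (i < j)%N by rewrite ltnNge leq_eqVlt val_eqE (negPf ij).
by apply: vect_form_ext => f fl; rewrite !(linear_formE fl) /omega;
  case: (i < j)%N => /=; field; rewrite nz2 nzq nzqp'.
Qed.

Lemma S_DD_bvec (i j : I) : S_DD (bv (i, j)) =
  if i == j then q *: bv (i, i)
  else bv (j, i) + (w * (i < j)%:R) *: bv (i, j).
Proof.
rewrite S_DD_unlock scale_lfunE add_lfunE !scale_lfunE id_lfunE tau_DD_bvec /sgn_lt.
have nzqp' : 1 + q ^+ 2 != 0 by rewrite addrC expr2.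
have [<-|ij] := eqVneq i j.
  by apply: vect_form_ext => f fl; rewrite !(linear_formE fl) /omega; field; rewrite nz2 nzq.
have -> : (j < i)%N = ~~ (i < j)%N by rewrite ltnNge leq_eqVlt val_eqE (negPf ij).
by apply: vect_form_ext => f fl; rewrite !(linear_formE fl) /omega;
  case: (i < j)%N => /=; field; rewrite nz2 nzq nzqp'.
Qed.

Lemma tau_VV_involution : (tau_VV n s \o tau_VV n s)%VF = \1%VF.
Proof.
have nzqp' : 1 + q ^+ 2 != 0 by rewrite addrC expr2.
apply: hom_vec_ext => -[i j]; rewrite comp_lfunE id_lfunE tau_VV_bvec.
have [<-|ij] := eqVneq i j; first by rewrite tau_VV_bvec eqxx.
rewrite !hom_linE !tau_VV_bvec (eq_sym j) (negPf ij) /sgn_lt.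
have -> : (j < i)%N = ~~ (i < j)%N by rewrite ltnNge leq_eqVlt val_eqE (negPf ij).
by apply: vect_form_ext => f fl; rewrite !(linear_formE fl);
  case: (i < j)%N => /=; field; rewrite nzqp'.
Qed.

Lemma tau_DD_involution : (tau_DD n s \o tau_DD n s)%VF = \1%VF.
Proof.
have nzqp' : 1 + q ^+ 2 != 0 by rewrite addrC expr2.
apply: hom_vec_ext => -[i j]; rewrite comp_lfunE id_lfunE tau_DD_bvec.
have [<-|ij] := eqVneq i j; first by rewrite tau_DD_bvec eqxx.
rewrite !hom_linE !tau_DD_bvec (eq_sym j) (negPf ij) /sgn_lt.
have -> : (j < i)%N = ~~ (i < j)%N by rewrite ltnNge leq_eqVlt val_eqE (negPf ij).
by apply: vect_form_ext => f fl; rewrite !(linear_formE fl);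
  case: (i < j)%N => /=; field; rewrite nzqp'.
Qed.

Fact Phi_key : unit. Proof. by []. Qed.
Definition Phi : 'End(MM) :=
  locked_with Phi_key (mid_hom I I (tau_VD n s)).
Lemma Phi_unlock : Phi = mid_hom I I (tau_VD n s).
Proof. exact: locked_withE. Qed.
Fact Psi_key : unit. Proof. by []. Qed.
Definition Psi : 'End(MM) :=
  locked_with Psi_key (mid_hom I I tau_DV).
Lemma Psi_unlock : Psi = mid_hom I I tau_DV.
Proof. exact: locked_withE. Qed.

Lemma PhiK u : Phi (Psi u) = u.
Proof.
rewrite Phi_unlock Psi_unlock mid_hom_comp -[RHS]mid_hom_id; congr (fun_of_lfun (mid_hom _ _ _) u).
by apply/lfunP => v; rewrite comp_lfunE tau_VD_DV id_lfunE.
Qed.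

Lemma PsiK u : Psi (Phi u) = u.
Proof.
rewrite Phi_unlock Psi_unlock mid_hom_comp -[RHS]mid_hom_id; congr (fun_of_lfun (mid_hom _ _ _) u).
by apply/lfunP => v; rewrite comp_lfunE tau_DV_VD id_lfunE.
Qed.

Lemma Phi_bvec (c a b d : I) : Phi (bv ((c, a), (b, d))) =
  if b == a then
    qr^-1 *: (q *: bv ((c, a), (a, d))
              + w *: \sum_(k < n | (a < k)%N) bv ((c, k), (k, d)))
  else qr^-1 *: bv ((c, b), (a, d)).
Proof.
rewrite Phi_unlock mid_hom_bvec tau_VD_bvec.
have [->|ba] := eqVneq b a; last by rewrite tmidZ tmid_bvec.
rewrite tmidZ tmidD !tmidZ tmid_sum tmid_bvec.
by under eq_bigr do rewrite tmid_bvec.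
Qed.

Fact opP_key : unit. Proof. by []. Qed.
Definition opP : 'End(MM) :=
  locked_with opP_key ((Phi \o tens_hom (tau_VV n s) \1 \o Psi)%VF).
Lemma opP_unlock : opP = (Phi \o tens_hom (tau_VV n s) \1 \o Psi)%VF.
Proof. exact: locked_withE. Qed.
Fact opQ_key : unit. Proof. by []. Qed.
Definition opQ : 'End(MM) :=
  locked_with opQ_key ((Phi \o tens_hom \1 (tau_DD n s) \o Psi)%VF).
Lemma opQ_unlock : opQ = (Phi \o tens_hom \1 (tau_DD n s) \o Psi)%VF.
Proof. exact: locked_withE. Qed.

Lemma opPE u : opP u = Phi (tens_hom (tau_VV n s) \1%VF (Psi u)).
Proof. by rewrite opP_unlock !comp_lfunE. Qed.

Lemma opQE u : opQ u = Phi (tens_hom \1%VF (tau_DD n s) (Psi u)).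
Proof. by rewrite opQ_unlock !comp_lfunE. Qed.

Lemma opP_involution u : opP (opP u) = u.
Proof.
by rewrite !opPE PsiK tens_hom_comp tau_VV_involution comp_lfun1l tens_hom_id PhiK.
Qed.

Lemma opQ_involution u : opQ (opQ u) = u.
Proof.
by rewrite !opQE PsiK tens_hom_comp tau_DD_involution comp_lfun1l tens_hom_id PhiK.
Qed.

(** Conjugated back by [Phi], the two operators act on different tensor factors. *)
Lemma opPQ u : opP (opQ u) = opQ (opP u).
Proof.
by rewrite !opPE !opQE !PsiK ?opPE !tens_hom_comp !comp_lfun1l !comp_lfun1r.
Qed.

Lemma tau_RE_PQ u : tau_RE n s u = opP (opQ u).
Proof.
by rewrite opPE opQE PsiK tens_hom_comp comp_lfun1l comp_lfun1r Phi_unlock Psi_unlock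
  !comp_lfunE tau_VD_inv.
Qed.

Lemma munit_delta (i j : I) : munit K n i j = delta_mx i j.
Proof. by apply/matrixP => a b; rewrite !mxE. Qed.

Lemma mx_sum_munit (A : M) : A = \sum_x A x.2 x.1 *: munit K n x.2 x.1.
Proof.
rewrite {1}[A]matrix_sum_delta exchange_big pair_bigA /=.
by apply: eq_bigr => x _; rewrite munit_delta.
Qed.

Lemma vecM_is_linear : linear (@vecM K n).
Proof. by move=> a A B; apply/ffunP => x; rewrite !ffunE !mxE. Qed.

HB.instance Definition _ :=
  GRing.isLinear.Build K M (vec K (I * I)%type) _ (@vecM K n) vecM_is_linear.

Definition mx_ext (W : vectType K) (b : I * I -> W) : 'Hom(M, W) :=
  (lin_ext b \o linfun (@vecM K n))%VF.

Lemma mx_extE (W : vectType K) (b : I * I -> W) A :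
  mx_ext b A = \sum_x A x.2 x.1 *: b x.
Proof. by rewrite comp_lfunE lin_extE; apply: eq_bigr => x _; rewrite lfunE /= ffunE. Qed.

Lemma vecM_munit (i j : I) : vecM (munit K n i j) = bv (j, i).
Proof.
by apply/ffunP => -[a b]; rewrite !ffunE mxE xpair_eqE andbC.
Qed.

Lemma tensM_linr (A : M) a B C : tensM A (a *: B + C) = a *: tensM A B + tensM A C.
Proof. by rewrite /tensM linearP tens_linr. Qed.

Lemma tensM_linl (A : M) a B C : tensM (a *: B + C) A = a *: tensM B A + tensM C A.
Proof. by rewrite /tensM linearP tens_linl. Qed.

(** The generator of [m0]. As a combination of the generators L^i_j it is the quantum trace of L. *)
Definition Dmx : M := \sum_(i < n) Dq i *: munit K n i i.

Fact tensDl_key : unit. Proof. by []. Qed.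
Definition tensDl : 'Hom(M, MM) :=
  locked_with tensDl_key (mx_ext (fun x => \sum_(a < n) Dq a *: bv ((a, a), x))).
Lemma tensDl_unlock : tensDl = mx_ext (fun x => \sum_(a < n) Dq a *: bv ((a, a), x)).
Proof. exact: locked_withE. Qed.
Fact tensDr_key : unit. Proof. by []. Qed.
Definition tensDr : 'Hom(M, MM) :=
  locked_with tensDr_key (mx_ext (fun x => \sum_(a < n) Dq a *: bv (x, (a, a)))).
Lemma tensDr_unlock : tensDr = mx_ext (fun x => \sum_(a < n) Dq a *: bv (x, (a, a))).
Proof. exact: locked_withE. Qed.

Lemma tensDlE A :
  tensDl A = \sum_x A x.2 x.1 *: \sum_(a < n) Dq a *: bv ((a, a), x).
Proof. by rewrite tensDl_unlock mx_extE. Qed.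

Lemma tensDrE A :
  tensDr A = \sum_x A x.2 x.1 *: \sum_(a < n) Dq a *: bv (x, (a, a)).
Proof. by rewrite tensDr_unlock mx_extE. Qed.

End QuantumOperators.

(** * Partial traces, insertion of D, and their relation to the Hecke operators *)

Section QuantumTraces.
Variables (K : fieldType) (n : nat) (s : K).
Local Notation q := (q n s).
Local Notation w := (omega n s).
Local Notation h := (q + q^-1).
Local Notation qr := (q_root s).
Local Notation I := 'I_n.
Local Notation M := 'M[K]_n.
Local Notation MM := (MM K n).
Local Notation bv := (bvec K).
Local Notation mu := (munit K n).
Local Notation Dq a := (q ^- (2 * a)).
Local Notation D := (Dmx n s).
Local Notation tDl := (tensDl n s).
Local Notation tDr := (tensDr n s).
Local Notation Phi := (Phi n s).
Local Notation Psi := (Psi n s).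
Local Notation S_VV := (S_VV n s).
Local Notation S_DD := (S_DD n s).
Hypothesis nzs : s != 0.
Hypothesis nz2 : 2 != 0 :> K.
Hypothesis nzqp : q * q + 1 != 0.

Let nzq : q != 0. Proof. by rewrite expf_neq0. Qed.
Let nzqr : qr != 0. Proof. by rewrite expf_neq0. Qed.

Lemma tensM_munit (i j k l : I) : tensM (mu i j) (mu k l) = bv ((j, i), (l, k)).
Proof. by rewrite /tensM !vecM_munit tens_bvec. Qed.

Lemma Dmx_diag (i j : I) : D i j = (i == j)%:R * Dq i.
Proof.
rewrite summxE (bigD1 i) //= big1 => [|k ki].
  by rewrite !mxE eqxx addr0 mulrC [j == i :> nat]eq_sym.
by rewrite !mxE [i == k :> nat]eq_sym val_eqE (negPf ki) mulr0.
Qed.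

Lemma linear_mxE (W : lmodType K) (f : M -> W) A : linear f ->
  f A = \sum_x A x.2 x.1 *: f (mu x.2 x.1).
Proof.
move=> lf.
pose F : {linear M -> W} := HB.pack f (GRing.isLinear.Build K M W *:%R f lf).
rewrite -[f A]/(F A) {1}[A]mx_sum_munit linear_sum.
by apply: eq_bigr => x _; rewrite linearZ.
Qed.

Lemma bilinear_mx_ext (W : lmodType K) (f g : M -> M -> W) :
  (forall A, linear (f A)) -> (forall A, linear (f^~ A)) ->
  (forall A, linear (g A)) -> (forall A, linear (g^~ A)) ->
  (forall i j k l : I, f (mu i j) (mu k l) = g (mu i j) (mu k l)) ->
  forall A B, f A B = g A B.
Proof.
move=> fr fl gr gl fg A B.
rewrite (linear_mxE A (fl B)) (linear_mxE A (gl B)).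
apply: eq_bigr => x _; congr (_ *: _).
rewrite (linear_mxE B (fr _)) (linear_mxE B (gr _)).
by apply: eq_bigr => y _; rewrite fg.
Qed.

Lemma tensM_Dl A : tensM D A = tDl A.
Proof.
rewrite (linear_mxE A (tensM_linr D)) tensDlE; apply: eq_bigr => -[j i] _ /=.
rewrite (linear_mxE D (tensM_linl (mu i j))); congr (_ *: _).
rewrite -(pair_bigA _ (fun a b : I => D b a *: tensM (mu b a) (mu i j))) /=.
apply: eq_bigr => a _; rewrite (bigD1 a) //= big1 ?addr0 => [|b ba].
  by rewrite Dmx_diag eqxx mul1r tensM_munit.
by rewrite Dmx_diag (negPf ba) mul0r scale0r.
Qed.

Lemma tensM_Dr A : tensM A D = tDr A.
Proof.
rewrite (linear_mxE A (tensM_linl D)) tensDrE; apply: eq_bigr => -[j i] _ /=.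
rewrite (linear_mxE D (tensM_linr (mu i j))); congr (_ *: _).
rewrite -(pair_bigA _ (fun a b : I => D b a *: tensM (mu i j) (mu b a))) /=.
apply: eq_bigr => a _; rewrite (bigD1 a) //= big1 ?addr0 => [|b ba].
  by rewrite Dmx_diag eqxx mul1r tensM_munit.
by rewrite Dmx_diag (negPf ba) mul0r scale0r.
Qed.

Lemma trace_munit (i j : I) : \tr (mu i j) = (i == j)%:R.
Proof.
rewrite /mxtrace (bigD1 i) //= big1 ?addr0 => [|k ki].
  by rewrite mxE eqxx val_eqE.
by rewrite mxE val_eqE (negPf ki).
Qed.

Fact trL_key : unit. Proof. by []. Qed.
Definition trL : 'Hom(MM, M) :=
  locked_with trL_key (lin_ext (fun x : (I * I) * (I * I) =>
  let: ((j, i), (l, k)) := x in (i == j)%:R *: mu k l)).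
Lemma trL_unlock : trL = lin_ext (fun x : (I * I) * (I * I) =>
  let: ((j, i), (l, k)) := x in (i == j)%:R *: mu k l).
Proof. exact: locked_withE. Qed.
Fact trR_key : unit. Proof. by []. Qed.
Definition trR : 'Hom(MM, M) :=
  locked_with trR_key (lin_ext (fun x : (I * I) * (I * I) =>
  let: ((j, i), (l, k)) := x in (k == l)%:R *: mu i j)).
Lemma trR_unlock : trR = lin_ext (fun x : (I * I) * (I * I) =>
  let: ((j, i), (l, k)) := x in (k == l)%:R *: mu i j).
Proof. exact: locked_withE. Qed.
Fact trM_key : unit. Proof. by []. Qed.
Definition trM : 'Hom(MM, M) :=
  locked_with trM_key (lin_ext (fun x : (I * I) * (I * I) =>
  let: ((c, a), (b, d)) := x in (a == b)%:R *: mu d c)).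
Lemma trM_unlock : trM = lin_ext (fun x : (I * I) * (I * I) =>
  let: ((c, a), (b, d)) := x in (a == b)%:R *: mu d c).
Proof. exact: locked_withE. Qed.

Lemma trL_bvec (j i l k : I) : trL (bv ((j, i), (l, k))) = (i == j)%:R *: mu k l.
Proof. by rewrite trL_unlock lin_ext_bvec. Qed.
Lemma trR_bvec (j i l k : I) : trR (bv ((j, i), (l, k))) = (k == l)%:R *: mu i j.
Proof. by rewrite trR_unlock lin_ext_bvec. Qed.
Lemma trM_bvec (c a b d : I) : trM (bv ((c, a), (b, d))) = (a == b)%:R *: mu d c.
Proof. by rewrite trM_unlock lin_ext_bvec. Qed.

Lemma trL_tens A B : trL (tensM A B) = \tr A *: B.
Proof.
apply: (bilinear_mx_ext (f := fun A B => trL (tensM A B)) (g := fun A B => \tr A *: B)).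
- by move=> C a X Y; rewrite tensM_linr linearP.
- by move=> C a X Y; rewrite tensM_linl linearP.
- by move=> C a X Y; rewrite scalerDr !scalerA mulrC.
- by move=> C a X Y; rewrite linearP scalerDl scalerA.
by move=> i j k l; rewrite tensM_munit trL_bvec trace_munit.
Qed.

Lemma trR_tens A B : trR (tensM A B) = \tr B *: A.
Proof.
apply: (bilinear_mx_ext (f := fun A B => trR (tensM A B)) (g := fun A B => \tr B *: A)).
- by move=> C a X Y; rewrite tensM_linr linearP.
- by move=> C a X Y; rewrite tensM_linl linearP.
- by move=> C a X Y; rewrite linearP scalerDl scalerA.
- by move=> C a X Y; rewrite scalerDr !scalerA mulrC.
by move=> i j k l; rewrite tensM_munit trR_bvec trace_munit.
Qed.

Lemma tens_bvZl (X Y : finType) a (u : vec K X) (v : vec K Y) :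
  tens (a *: u) v = a *: tens u v.
Proof. by apply/ffunP => x; rewrite !ffunE !scale_regular mulrA. Qed.
Lemma tens_bvZr (X Y : finType) a (u : vec K X) (v : vec K Y) :
  tens u (a *: v) = a *: tens u v.
Proof. by apply/ffunP => x; rewrite !ffunE !scale_regular mulrCA. Qed.
Lemma tens_addl (X Y : finType) (u u' : vec K X) (v : vec K Y) :
  tens (u + u') v = tens u v + tens u' v.
Proof. by apply/ffunP => x; rewrite !ffunE mulrDl. Qed.
Lemma tens_addr (X Y : finType) (u : vec K X) (v v' : vec K Y) :
  tens u (v + v') = tens u v + tens u v'.
Proof. by apply/ffunP => x; rewrite !ffunE mulrDr. Qed.

Let tensE := (tens_bvZl, tens_bvZr, tens_addl, tens_addr, tens_bvec).

Lemma sum_delta_gt (W : lmodType K) (a c : I) (X : I -> W) :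
  \sum_(k < n | (a < k)%N) (k == c)%:R *: X k = (a < c)%:R *: X c.
Proof.
have [ac|ca] := ltnP a c.
  rewrite (bigD1 c) //= eqxx big1 ?addr0 // => k /andP[_ /negPf ->].
  by rewrite scale0r.
rewrite scale0r big1 // => k ak; case: eqVneq => [kc|]; last by rewrite scale0r.
by move: ak; rewrite kc ltnNge ca.
Qed.

(** Contracting e_c with the V*-leg that has crossed e_a amounts to crossing e_c with e_a first and
    contracting in the middle. For b = a the tail of [tau_VD] contributes its term k = c, which is
    the [omega] term of [S_VV]. *)
Lemma trL_Phi v : trL (Phi v) = qr^-1 *: trM (tens_hom S_VV \1 v)%VF.
Proof.
rewrite -!comp_lfunE -scale_lfunE; congr (fun_of_lfun _ v).
apply: hom_vec_ext => -[[c a] [b d]].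
rewrite scale_lfunE !comp_lfunE Phi_bvec tens_hom_bvec /= id_lfunE S_VV_bvec //.
have [->|ba] := eqVneq b a; have [->|ca] := eqVneq c a;
  rewrite ?tensE !hom_linE ?hom_sum ?trM_bvec ?trL_bvec ?eqxx //.
- rewrite big1 => [|k ak]; first by rewrite scaler0 addr0.
  by rewrite trL_bvec -val_eqE gtn_eqF // scale0r.
- rewrite (eq_bigr (fun k : I => (k == c)%:R *: mu d k)); last first.
    by move=> k ak; rewrite trL_bvec.
  by rewrite sum_delta_gt [a == c]eq_sym (negPf ca) scale0r scaler0 scale1r scalerA.
- by rewrite [a == b]eq_sym (negPf ba) !scale0r !scaler0.
by rewrite [a == b]eq_sym (negPf ba) scale0r scaler0 addr0 [c == b]eq_sym.
Qed.

Lemma trR_Phi v : trR (Phi v) = qr^-1 *: trM (tens_hom \1 S_DD v)%VF.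
Proof.
rewrite -!comp_lfunE -scale_lfunE; congr (fun_of_lfun _ v).
apply: hom_vec_ext => -[[c a] [b d]].
rewrite scale_lfunE !comp_lfunE Phi_bvec tens_hom_bvec /= id_lfunE S_DD_bvec //.
have [->|ba] := eqVneq b a.
  have [<-|ad] := eqVneq a d;
    rewrite ?tensE !hom_linE ?hom_sum ?trM_bvec ?trR_bvec ?eqxx.
    rewrite big1 => [|k ak]; first by rewrite scaler0 addr0.
    by rewrite trR_bvec eq_sym -val_eqE gtn_eqF // scale0r.
  rewrite (eq_bigr (fun k : I => (k == d)%:R *: mu k c)); last first.
    by move=> k ak; rewrite trR_bvec eq_sym.
  by rewrite sum_delta_gt [d == a]eq_sym (negPf ad) !scale0r scaler0 !add0r scale1r !scalerA mulrA.
have [bd|bd] := eqVneq b d;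
  rewrite ?tensE !hom_linE ?trM_bvec ?trR_bvec [a == b]eq_sym ?(negPf ba).
  by rewrite -bd (negPf ba) !scale0r !scaler0.
by rewrite scale0r scaler0 addr0 [d == a]eq_sym.
Qed.

Fact midD_key : unit. Proof. by []. Qed.
Definition midD : 'Hom(M, MM) :=
  locked_with midD_key (mx_ext (fun x : I * I =>
  \sum_(a < n) Dq a *: bv ((x.1, a), (a, x.2)))).
Lemma midD_unlock : midD = mx_ext (fun x : I * I =>
  \sum_(a < n) Dq a *: bv ((x.1, a), (a, x.2))).
Proof. exact: locked_withE. Qed.

Let shiftE (f : 'End(VV K n)) u : (f - w *: \1)%VF u = f u - w *: u.
Proof. by rewrite add_lfunE opp_lfunE scale_lfunE id_lfunE. Qed.

(** [S_VV - w] is the inverse of [S_VV]. The two correction terms, for a = c and for c < a, survive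
    for a single a; they cancel only after summation over a with the weights q^(-2a). *)
Lemma Phi_S_VV_shift (c a d : I) :
  qr *: Phi (tens_hom (S_VV - w *: \1) \1 (bv ((c, a), (a, d))))%VF
  = bv ((a, a), (c, d))
    + (w * q^-1 * (a == c)%:R) *: \sum_(k < n | (c < k)%N) bv ((c, k), (k, d))
    - (w * (c < a)%:R) *: (q *: bv ((c, a), (a, d))
                           + w *: \sum_(k < n | (a < k)%N) bv ((c, k), (k, d))).
Proof.
rewrite tens_hom_bvec /= id_lfunE shiftE S_VV_bvec //.
have [<-|ca] := eqVneq c a.
  have -> : q *: bv (c, c) - w *: bv (c, c) = q^-1 *: bv (c, c).
    by rewrite -scalerBl /omega; congr (_ *: _); ring.
  rewrite !tensE !hom_linE Phi_bvec !eqxx ltnn mulr0 mulr1 scale0r.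
  by apply: vect_form_ext => f fl; rewrite !(linear_formE fl); field; rewrite nzq.
have -> : bv (a, c) + (w * (a < c)%:R) *: bv (c, a) - w *: bv (c, a)
    = bv (a, c) - (w * (c < a)%:R) *: bv (c, a).
  have -> : (c < a)%N = ~~ (a < c)%N.
    by rewrite ltnNge leq_eqVlt val_eqE [a == c]eq_sym (negPf ca).
  rewrite -addrA -scalerBl -scaleNr; congr (_ + _ *: _).
  by case: (a < c)%N => /=; ring.
rewrite -scaleNr !tensE !hom_linE !Phi_bvec eqxx [a == c]eq_sym (negPf ca) mulr0 scale0r.
by apply: vect_form_ext => f fl; rewrite !(linear_formE fl); field; rewrite nzqr.
Qed.

Lemma Phi_S_DD_shift (c a d : I) :
  qr *: Phi (tens_hom \1 (S_DD - w *: \1) (bv ((c, a), (a, d))))%VF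
  = bv ((c, d), (a, a))
    + (w * q^-1 * (a == d)%:R) *: \sum_(k < n | (d < k)%N) bv ((c, k), (k, d))
    - (w * (d < a)%:R) *: (q *: bv ((c, a), (a, d))
                           + w *: \sum_(k < n | (a < k)%N) bv ((c, k), (k, d))).
Proof.
rewrite tens_hom_bvec /= id_lfunE shiftE S_DD_bvec //.
have [<-|ad] := eqVneq a d.
  have -> : q *: bv (a, a) - w *: bv (a, a) = q^-1 *: bv (a, a).
    by rewrite -scalerBl /omega; congr (_ *: _); ring.
  rewrite !tensE !hom_linE Phi_bvec !eqxx ltnn mulr0 mulr1 scale0r.
  by apply: vect_form_ext => f fl; rewrite !(linear_formE fl); field; rewrite nzq.
have -> : bv (d, a) + (w * (a < d)%:R) *: bv (a, d) - w *: bv (a, d)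
    = bv (d, a) - (w * (d < a)%:R) *: bv (a, d).
  have -> : (d < a)%N = ~~ (a < d)%N.
    by rewrite ltnNge leq_eqVlt val_eqE (negPf ad).
  rewrite -addrA -scalerBl -scaleNr; congr (_ + _ *: _).
  by case: (a < d)%N => /=; ring.
rewrite -scaleNr !tensE !hom_linE !Phi_bvec eqxx [d == a]eq_sym (negPf ad) mulr0 scale0r.
by apply: vect_form_ext => f fl; rewrite !(linear_formE fl); field; rewrite nzqr.
Qed.

(** By [omega_resum] the corrections with c < a add up to a multiple of the tail at c, and this is
    exactly the correction with a = c. *)
Lemma sum_shift_terms (W : lmodType K) (Y X : I -> W) (c : I) :
  \sum_(a < n) Dq a *: (Y a
    + (w * q^-1 * (a == c)%:R) *: \sum_(k < n | (c < k)%N) X k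
    - (w * (c < a)%:R) *: (q *: X a + w *: \sum_(k < n | (a < k)%N) X k))
  = \sum_(a < n) Dq a *: Y a.
Proof.
under eq_bigr => a _ do rewrite -addrA scalerDr.
rewrite big_split /= -[RHS]addr0; congr (_ + _).
under eq_bigr => a _ do rewrite scalerBr.
rewrite sumrB (_ : \sum_a _ = (w * (q^-1 * Dq c)) *: \sum_(k < n | (c < k)%N) X k).
  apply/eqP; rewrite subr_eq0; apply/eqP.
  rewrite -scalerA -omega_resum // scaler_sumr big_mkcond; apply: eq_bigr => a _.
  by case: ifP => _; rewrite ?mulr1 ?mulr0 ?scale0r ?scaler0 // !scalerA mulrC.
set Sc := \sum_(k < n | (c < k)%N) X k.
under eq_bigr => a _ do rewrite scalerA.
rewrite -scaler_suml; congr (_ *: _).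
rewrite (bigD1 c) //= big1 => [|a /negPf ac]; last by rewrite ac !mulr0.
by rewrite eqxx /=; ring.
Qed.

Lemma midDE A :
  midD A = \sum_x A x.2 x.1 *: \sum_(a < n) Dq a *: bv ((x.1, a), (a, x.2)).
Proof. by rewrite midD_unlock mx_extE. Qed.

Lemma tensDl_Phi A :
  tDl A = qr *: Phi (tens_hom (S_VV - w *: \1) \1 (midD A))%VF.
Proof.
rewrite tensDlE midDE !hom_sum scaler_sumr.
apply: eq_bigr => -[c d] _ /=.
rewrite !hom_linE [RHS]scalerA mulrC -scalerA; congr (_ *: _).
rewrite !hom_sum scaler_sumr.
under [RHS]eq_bigr => a _ do
  rewrite !hom_linE scalerA mulrC -scalerA Phi_S_VV_shift.
by rewrite sum_shift_terms.
Qed.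

Lemma tensDr_Phi A :
  tDr A = qr *: Phi (tens_hom \1 (S_DD - w *: \1) (midD A))%VF.
Proof.
rewrite tensDrE midDE !hom_sum scaler_sumr.
apply: eq_bigr => -[c d] _ /=.
rewrite !hom_linE [RHS]scalerA mulrC -scalerA; congr (_ *: _).
rewrite !hom_sum scaler_sumr.
under [RHS]eq_bigr => a _ do
  rewrite !hom_linE scalerA mulrC -scalerA Phi_S_DD_shift.
by rewrite sum_shift_terms.
Qed.

Lemma trM_midD A : trM (midD A) = TrqId n s *: A.
Proof.
rewrite midDE hom_sum {2}[A]mx_sum_munit scaler_sumr.
apply: eq_bigr => -[c d] _ /=.
rewrite hom_linE hom_sum scalerA mulrC -scalerA scaler_suml /=; congr (_ *: _).
by apply: eq_bigr => a _; rewrite hom_linE trM_bvec eqxx scale1r.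
Qed.

Lemma trace_trL_trR u : \tr (trL u) = \tr (trR u).
Proof.
rewrite [trL u]hom_vec [trR u]hom_vec !linear_sum /=.
apply: eq_bigr => -[[j i] [l k]] _; rewrite trL_bvec trR_bvec !mxtraceZ !trace_munit.
by rewrite [X in _ * X]mulrC.
Qed.

Lemma trace_D : \tr D = TrqId n s.
Proof.
rewrite linear_sum; apply: eq_bigr => i _ /=.
by rewrite mxtraceZ trace_munit eqxx mulr1.
Qed.

Lemma tens_hom_scaleDl (f : 'End(VV K n)) a b u :
  tens_hom (a *: f + b *: \1)%VF (\1%VF : 'End(VV K n)) u
  = a *: tens_hom f (\1%VF : 'End(VV K n)) u + b *: u :> MM.
Proof.
rewrite -[X in _ = _ + _ *: X]id_lfunE -!scale_lfunE -add_lfunE.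
congr (fun_of_lfun _ u); apply: hom_vec_ext => -[x y].
rewrite add_lfunE !scale_lfunE !tens_hom_bvec add_lfunE !scale_lfunE !id_lfunE /=.
by rewrite !tensE.
Qed.

Lemma tens_hom_scaleDr (f : 'End(VV K n)) a b u :
  tens_hom (\1%VF : 'End(VV K n)) (a *: f + b *: \1)%VF u
  = a *: tens_hom (\1%VF : 'End(VV K n)) f u + b *: u :> MM.
Proof.
rewrite -[X in _ = _ + _ *: X]id_lfunE -!scale_lfunE -add_lfunE.
congr (fun_of_lfun _ u); apply: hom_vec_ext => -[x y].
rewrite add_lfunE !scale_lfunE !tens_hom_bvec add_lfunE !scale_lfunE !id_lfunE /=.
by rewrite !tensE.
Qed.

Fact tr_mid_key : unit. Proof. by []. Qed.
(** With [mid_D] below, these are the maps [t2] and [Y] of the abstract section; the powers of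
    [q_root] compensate the normalization of [tau_VD]. *)
Definition tr_mid : 'Hom(MM, M) :=
  locked_with tr_mid_key ((qr^-1 *: (trM \o Psi))%VF).
Lemma tr_mid_unlock : tr_mid = (qr^-1 *: (trM \o Psi))%VF.
Proof. exact: locked_withE. Qed.
Fact mid_D_key : unit. Proof. by []. Qed.
Definition mid_D : 'Hom(M, MM) :=
  locked_with mid_D_key ((qr *: (Phi \o midD))%VF).
Lemma mid_D_unlock : mid_D = (qr *: (Phi \o midD))%VF.
Proof. exact: locked_withE. Qed.

Lemma tr_midE u : tr_mid u = qr^-1 *: trM (Psi u).
Proof. by rewrite tr_mid_unlock scale_lfunE comp_lfunE. Qed.

Lemma mid_DE A : mid_D A = qr *: Phi (midD A).
Proof. by rewrite mid_D_unlock scale_lfunE comp_lfunE. Qed.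

Lemma trL_opP u :
  trL u = 2^-1 *: (h *: tr_mid (opP n s u) + w *: tr_mid u).
Proof.
rewrite -{1}[u](PhiK nzs) trL_Phi !tr_midE opPE PsiK //.
rewrite S_VV_unlock scalerDr !scalerA tens_hom_scaleDl !hom_linE.
by apply: vect_form_ext => f fl; rewrite !(linear_formE fl); ring.
Qed.

Lemma trR_opQ u :
  trR u = 2^-1 *: (h *: tr_mid (opQ n s u) + w *: tr_mid u).
Proof.
rewrite -{1}[u](PhiK nzs) trR_Phi !tr_midE opQE PsiK //.
rewrite S_DD_unlock scalerDr !scalerA tens_hom_scaleDr !hom_linE.
by apply: vect_form_ext => f fl; rewrite !(linear_formE fl); ring.
Qed.

Lemma tensDl_opP A :
  tDl A = 2^-1 *: (h *: opP n s (mid_D A) - w *: mid_D A).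
Proof.
rewrite tensDl_Phi opPE mid_DE [Psi _]hom_linE PsiK //.
have -> : (S_VV - w *: \1)%VF = ((2^-1 * h) *: tau_VV n s + (- (2^-1 * w)) *: \1)%VF.
  by rewrite S_VV_unlock; vect_linear; field; rewrite nz2.
rewrite tens_hom_scaleDl !hom_linE.
by apply: vect_form_ext => f fl; rewrite !(linear_formE fl); ring.
Qed.

Lemma tensDr_opQ A :
  tDr A = 2^-1 *: (h *: opQ n s (mid_D A) - w *: mid_D A).
Proof.
rewrite tensDr_Phi opQE mid_DE [Psi _]hom_linE PsiK //.
have -> : (S_DD - w *: \1)%VF = ((2^-1 * h) *: tau_DD n s + (- (2^-1 * w)) *: \1)%VF.
  by rewrite S_DD_unlock; vect_linear; field; rewrite nz2.
rewrite tens_hom_scaleDr !hom_linE.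
by apply: vect_form_ext => f fl; rewrite !(linear_formE fl); ring.
Qed.

Lemma tr_mid_mid_D A : tr_mid (mid_D A) = \tr D *: A.
Proof.
rewrite tr_midE mid_DE !hom_linE PsiK // scalerA mulVf //.
by rewrite scale1r trM_midD trace_D.
Qed.

Lemma trL_tensDr A : trL (tDr A) = \tr A *: D.
Proof. by rewrite -tensM_Dr trL_tens. Qed.

Lemma trR_tensDl A : trR (tDl A) = \tr A *: D.
Proof. by rewrite -tensM_Dl trR_tens. Qed.

Lemma tensDl_D : tDl D = tDr D.
Proof. by rewrite -tensM_Dl -tensM_Dr. Qed.

Lemma trace_form : linear_form (@mxtrace K n).
Proof. by move=> a A B; rewrite linearP. Qed.

End QuantumTraces.

(** * The bracket on g *)

Lemma daddv_pi_eq0 (K : fieldType) (V : vectType K) (U W : {vspace V}) v :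
  (U :&: W = 0)%VS -> v \in W -> daddv_pi U W v = 0.
Proof.
move=> UW vW; have WU : (W :&: U = 0)%VS by rewrite capvC.
have := daddv_pi_add UW (subvP (addvSr U W) _ vW).
by rewrite (daddv_pi_id WU vW) => /eqP; rewrite -subr_eq0 addrK => /eqP.
Qed.

Section DeformedAdjoint.
Variables (K : fieldType) (n : nat) (s : K).
Local Notation q := (q n s).
Local Notation w := (omega n s).
Local Notation h := (q + q^-1).
Local Notation I := 'I_n.
Local Notation M := 'M[K]_n.
Local Notation MM := (MM K n).
Local Notation D := (Dmx n s).
Local Notation tDl := (tensDl n s).
Local Notation tDr := (tensDr n s).
Local Notation trL := (trL K n).
Local Notation trR := (trR K n).
Local Notation P := (opP n s).
Local Notation Q := (opQ n s).
Local Notation tau := (tau_RE n s).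
Hypothesis nzs : s != 0.
Hypothesis nz2 : 2 != 0 :> K.
Hypothesis nzqm : q * q - 1 != 0.
Hypothesis nzqp : q * q + 1 != 0.
Hypothesis nzq4 : q ^+ 4 + 1 != 0.
Hypothesis nztD : TrqId n s != 0.

Let nzq : q != 0. Proof. by rewrite expf_neq0. Qed.
Let nztrD : \tr D != 0. Proof. by rewrite trace_D. Qed.

Let tf := @trace_form K n.
Let PP := opP_involution nzs nzqp.
Let QQ := opQ_involution nzs nzqp.
Let PQ := opPQ (n := n) nzs.
Let tLE := trL_opP nzs nz2 nzqp.
Let tRE := trR_opQ nzs nz2 nzqp.
Let dlE := tensDl_opP nzs nz2 nzqp.
Let drE := tensDr_opQ nzs nz2 nzqp.
Let t2Y := tr_mid_mid_D nzs (n := n).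
Let tLdr := @trL_tensDr K n s.
Let tRdl := @trR_tensDl K n s.
Let dlD := tensDl_D n s.
Let trt := @trace_trL_trR K n.

(** The multiple of D (x) D is written with [trR] after [tDl], which sends A to tr(A) D, so that the
    whole is a composite of linear maps already at hand. *)
Definition gg_proj : 'End(MM) :=
  (\1 - (\tr D)^-1 *: ((tDl \o trL) + (tDr \o trR))
   + (\tr D ^- 2) *: (tDl \o (trR \o (tDl \o trL))))%VF.

Local Notation pp := gg_proj.

Lemma gg_projE u : pp u = gg_part trL trR tDl tDr mxtrace D u.
Proof.
rewrite /gg_part 2!add_lfunE id_lfunE opp_lfunE !scale_lfunE add_lfunE !comp_lfunE.
by rewrite trR_tensDl // hom_linE scalerA.
Qed.

Lemma gg_projP u : in_gg trL trR (pp u).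
Proof.
rewrite gg_projE.
exact: (gg_part_in nz2 nzq nztrD PP QQ tLE tRE dlE drE t2Y tLdr tRdl trt).
Qed.

Lemma gg_proj_id u : in_gg trL trR u -> pp u = u.
Proof. by move=> gu; rewrite gg_projE; apply: gg_part_id. Qed.

Lemma gg_proj_tensDl A : pp (tDl A) = 0.
Proof.
rewrite gg_projE.
exact: (gg_part_dl tf nz2 nzq nztrD PP tLE dlE t2Y tRdl dlD).
Qed.

Lemma gg_proj_tensDr A : pp (tDr A) = 0.
Proof.
rewrite gg_projE.
exact: (gg_part_dr tDl tf nz2 nzq nztrD QQ tRE drE t2Y tLdr).
Qed.

Definition q_bracket : 'Hom(MM, M) :=
  ((h ^+ 2 / (w * (h ^+ 2 - 2))) *: (trL \o tau))%VF.

Lemma q_bracketE u : q_bracket u = brk P Q trL q u.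
Proof. by rewrite scale_lfunE comp_lfunE tau_RE_PQ. Qed.

Lemma q_bracket_anti u : tau u = - u ->
  q_bracket (pp u) = - (2 / w) *: (trL u + trR u).
Proof.
rewrite tau_RE_PQ // => eu; rewrite q_bracketE gg_projE.
exact: (brk_gg_part tf nz2 nzq nzqm nzqp nzq4 nztrD PP QQ PQ tLE tRE dlE drE t2Y tLdr
  tRdl trt).
Qed.

Lemma trace_trL_anti u : tau u = - u -> \tr (trL u) = 0.
Proof.
rewrite tau_RE_PQ // => eu.
exact: (tr_tL_anti tf nz2 nzq nzqp PP PQ tLE tRE trt eu).
Qed.

Lemma gg_proj_anti u : tau u = - u ->
  pp u = u - (\tr D)^-1 *: (tDl (trL u) + tDr (trR u)).
Proof.
rewrite tau_RE_PQ // => eu; rewrite gg_projE.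
exact: (gg_part_anti tDl tDr D tf nz2 nzq nzqp PP PQ tLE tRE trt).
Qed.

Lemma q_bracket_tr_mid u : in_gg trL trR u ->
  q_bracket u = - (h ^+ 2 / (2 * (h ^+ 2 - 2))) *: (tr_mid n s u - tr_mid n s (tau u)).
Proof.
rewrite tau_RE_PQ // q_bracketE.
exact: (brk_t2 nz2 nzq nzqm nzq4 PP tLE tRE).
Qed.

Section TraceZero.
Variable g : {vspace M}.
Hypothesis gE : forall A, (A \in g) = (\tr A == 0).

Lemma tensMBl a (A B C : M) : tensM (A - a *: B) C = tensM A C - a *: tensM B C.
Proof.
by apply/ffunP => x; rewrite !ffunE !mxE scale_regular mulrBl mulrA.
Qed.

Lemma tensMBr a (A B C : M) : tensM C (A - a *: B) = tensM C A - a *: tensM C B.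
Proof.
by apply/ffunP => x; rewrite !ffunE !mxE scale_regular mulrBr mulrCA.
Qed.

Lemma tensMZl a (A B : M) : tensM (a *: A) B = a *: tensM A B.
Proof. by apply/ffunP => x; rewrite !ffunE !mxE scale_regular mulrA. Qed.

Lemma tensMZr a (A B : M) : tensM A (a *: B) = a *: tensM A B.
Proof. by apply/ffunP => x; rewrite !ffunE !mxE scale_regular mulrCA. Qed.

Lemma tensM_in (U W : {vspace M}) A B :
  A \in U -> B \in W -> tensM A B \in tens_vs U W.
Proof.
move=> AU BW.
have tensM0l (X : M) : tensM 0 X = 0.
  by apply/ffunP => x; rewrite !ffunE mxE mul0r.
have tensM0r (X : M) : tensM X 0 = 0.
  by apply/ffunP => x; rewrite !ffunE mxE mulr0.
have linl a X Y Z : tensM X Z \in tens_vs U W -> tensM Y Z \in tens_vs U W ->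
    tensM (a *: X + Y) Z \in tens_vs U W.
  by move=> ? ?; rewrite tensM_linl memvD ?memvZ.
have linr a X Y Z : tensM X Y \in tens_vs U W -> tensM X Z \in tens_vs U W ->
    tensM X (a *: Y + Z) \in tens_vs U W.
  by move=> ? ?; rewrite tensM_linr memvD ?memvZ.
rewrite (coord_vbasis AU) (coord_vbasis BW).
elim/big_rec: _ => [|i X _ IH]; first by rewrite tensM0l mem0v.
apply: linl => //; elim/big_rec: _ {IH} => [|j Y _ IH]; first by rewrite tensM0r mem0v.
apply: linr => //; apply/memv_span/allpairsP.
by exists ((vbasis U)`_i, (vbasis W)`_j); rewrite ?mem_nth ?size_tuple.
Qed.

Lemma tens_vs_sub (U W : {vspace M}) (X : {vspace MM}) :
  (forall A B, A \in U -> B \in W -> tensM A B \in X) -> (tens_vs U W <= X)%VS.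
Proof.
move=> UWX; apply/span_subvP => _ /allpairsP[[A B] /= [AU BW ->]].
by apply: UWX; apply: vbasis_mem.
Qed.

Lemma gg_proj_tensM A B : pp (tensM A B) =
  tensM (A - ((\tr D)^-1 * \tr A) *: D) (B - ((\tr D)^-1 * \tr B) *: D).
Proof.
rewrite gg_projE /gg_part !trL_tens trR_tens !hom_linE -!tensM_Dl -tensM_Dr.
rewrite !tensMBl !tensMBr mxtraceZ.
by apply: vect_form_ext => f fl; rewrite !(linear_formE fl); field.
Qed.

Let tracepart A : A - ((\tr D)^-1 * \tr A) *: D \in g.
Proof.
by rewrite gE linearB linearZ /= mulrAC mulVf // mul1r subrr.
Qed.

Lemma gg_proj_in u : pp u \in tens_vs g g.
Proof.
rewrite [u]vec_sum hom_sum memv_suml // => -[[j i] [l k]] _.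
rewrite hom_linE memvZ //.
rewrite -tensM_munit gg_proj_tensM.
by apply: tensM_in; apply: tracepart.
Qed.

(** The nontrivial inclusion comes from [gg_proj]: it fixes the common kernel and sends pure tensors
    to pure tensors of traceless matrices. *)
Lemma tens_vs_ggP u : u \in tens_vs g g <-> in_gg trL trR u.
Proof.
split=> [ug|gu]; last by rewrite -(gg_proj_id gu) gg_proj_in.
have subL : (tens_vs g g <= lker trL)%VS.
  apply: tens_vs_sub => A B; rewrite gE => /eqP trA _.
  by rewrite memv_ker trL_tens trA scale0r.
have subR : (tens_vs g g <= lker trR)%VS.
  apply: tens_vs_sub => A B _; rewrite gE => /eqP trB.
  by rewrite memv_ker trR_tens trB scale0r.
by split; apply/eqP; rewrite -memv_ker; apply: (subvP _ _ ug).
Qed.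

(** [daddv_pi] computes a projection once the two subspaces meet trivially. This holds because
    [gg_proj] is the identity on g (x) g and zero on N; moreover u - pp u lies in N. *)
Lemma proj_ggE u : proj_gg s g u = pp u.
Proof.
set N := (tens_vs (m0 n s) fullv + tens_vs fullv (m0 n s))%VS.
have NE v : v \in N -> pp v = 0.
  move=> vN; apply/eqP; rewrite -memv_ker; apply: subvP vN.
  rewrite subv_add; apply/andP; split; apply: tens_vs_sub => A B.
    move=> /vlineP[a ->] _.
    by rewrite memv_ker tensMZl tensM_Dl hom_linE gg_proj_tensDl scaler0.
  move=> _ /vlineP[a ->].
  by rewrite memv_ker tensMZr tensM_Dr hom_linE gg_proj_tensDr scaler0.
have gN : (tens_vs g g :&: N = 0)%VS.
  apply/eqP; rewrite -subv0; apply/subvP => v; rewrite memv_cap => /andP[vg /NE].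
  by rewrite gg_proj_id ?memv0; [move=> -> | apply/tens_vs_ggP].
have Nl A : tDl A \in N.
  by rewrite -tensM_Dl (subvP (addvSl _ _)) // tensM_in ?memvf ?memv_line.
have Nr A : tDr A \in N.
  by rewrite -tensM_Dr (subvP (addvSr _ _)) // tensM_in ?memvf ?memv_line.
have uN : u - pp u \in N.
  rewrite gg_projE /gg_part opprD addrA opprB addrCA subrr addr0.
  by rewrite memvB ?memvZ // memvD.
rewrite -[in LHS](subrK (pp u) u) hom_linE [proj_gg s g (pp u)]daddv_pi_id ?gg_proj_in //.
by rewrite [proj_gg s g _]daddv_pi_eq0 ?add0r.
Qed.

Lemma I_plusP u : u \in I_plus n s <-> tau u = u.
Proof.
rewrite memv_ker add_lfunE opp_lfunE id_lfunE subr_eq0.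
by split=> [/eqP|->].
Qed.

Lemma I_minusP u : u \in I_minus n s <-> tau u = - u.
Proof.
rewrite memv_ker add_lfunE id_lfunE addr_eq0.
by split=> [/eqP|->].
Qed.

Lemma sym_ggP u : u \in sym_gg s g <-> in_gg trL trR u /\ tau u = u.
Proof.
rewrite memv_cap; split=> [/andP[/I_plusP ? /tens_vs_ggP]|[gu tu]] //.
by apply/andP; split; [apply/I_plusP | apply/tens_vs_ggP].
Qed.

Lemma asym_ggP u : u \in asym_gg s g <-> exists2 v, tau v = - v & u = pp v.
Proof.
split=> [/memv_imgP[v /I_minusP vI ->]|[v /I_minusP vI ->]].
  by exists v; rewrite ?proj_ggE.
by rewrite -proj_ggE memv_img.
Qed.

Lemma sym_asym_disjoint : (sym_gg s g :&: asym_gg s g = 0)%VS.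
Proof.
apply/eqP; rewrite -subv0; apply/subvP => u; rewrite memv_cap => /andP[].
move=> /sym_ggP[gu su] /asym_ggP[v av eu]; rewrite memv0; apply/eqP.
rewrite eu gg_projE; move: su av; rewrite eu gg_projE !tau_RE_PQ // => su av.
exact: (gg_part_sym_anti tf nz2 nzq nzqm nzqp nzq4 nztrD PP QQ PQ tLE tRE dlE drE t2Y tLdr tRdl trt).
Qed.

Lemma sym_asym_split u : in_gg trL trR u ->
  exists2 v, tau v = - v & u - pp v \in sym_gg s g.
Proof.
move=> gu.
have [v av sv] := gg_decomposition tf nz2 nzq nzqm nzqp nzq4 nztrD PP QQ PQ tLE tRE dlE drE
  t2Y tLdr tRdl trt gu.
exists v; rewrite ?tau_RE_PQ //; apply/sym_ggP; rewrite tau_RE_PQ // gg_projE; split=> //.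
have [v1 v2] := gg_projP v; have [u1 u2] := gu.
by rewrite -gg_projE /in_gg !hom_linE v1 v2 u1 u2 subrr.
Qed.

Lemma tau_tilde_split a b : a \in sym_gg s g -> b \in asym_gg s g ->
  tau_tilde s g (a + b) = a - b.
Proof.
move=> ag bg; have sa := sym_asym_disjoint.
have as_ : (asym_gg s g :&: sym_gg s g = 0)%VS by rewrite capvC.
rewrite add_lfunE opp_lfunE !hom_linE (daddv_pi_id sa ag) (daddv_pi_id as_ bg).
rewrite (daddv_pi_eq0 sa bg) (daddv_pi_eq0 as_ ag).
by rewrite addr0 add0r.
Qed.

Lemma q_bracket_sym u : u \in sym_gg s g -> q_bracket u = 0.
Proof.
by move=> /sym_ggP[gu]; rewrite tau_RE_PQ // q_bracketE => /(brk_sym q gu).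
Qed.

Lemma q_bracket_fixed u : u \in tens_vs g g -> tau_tilde s g u = u -> q_bracket u = 0.
Proof.
move=> /tens_vs_ggP /sym_asym_split[v av sv].
have bv : pp v \in asym_gg s g by apply/asym_ggP; exists v.
rewrite -{1 2}[u](subrK (pp v)) tau_tilde_split // => /addrI /eqP.
rewrite -subr_eq0 -opprD oppr_eq0 -mulr2n -scaler_nat scaler_eq0 (negPf nz2) /=.
by move=> /eqP v0; move: sv; rewrite v0 subr0; apply: q_bracket_sym.
Qed.

Lemma q_bracket_in u : u \in tens_vs g g -> q_bracket u \in g.
Proof.
move=> /tens_vs_ggP gu; rewrite gE q_bracketE; apply/eqP.
exact: (tr_brk tf nz2 nzq nzqp PP QQ PQ tLE tRE trt).
Qed.

End TraceZero.

End DeformedAdjoint.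

(** * The deformed adjoint module *)

Section AdjointModule.
Variables (K : fieldType) (n : nat) (s : K).
Local Notation q := (q n s).
Local Notation qh := (q_half n s).
Local Notation M := 'M[K]_n.
Local Notation mu := (munit K n).
Lemma munit_mul (i j k l : nat) : mu i j *m mu k l = ((j == k) && (j < n)%N)%:R *: mu i l.
Proof.
apply/matrixP => a b; rewrite !mxE.
have [jn|nj] := ltnP j n; last first.
  rewrite andbF mul0r big1 // => c _; rewrite !mxE.
  have /negPf -> : c != j :> nat by apply: contraTneq nj => <-; rewrite -ltnNge.
  by rewrite andbF mul0r.
rewrite (bigD1 (Ordinal jn)) //= !mxE big1 ?addr0 => [|c /negPf cj].
  by rewrite /= eqxx andbT -!natrM !mulnb; congr (_%:R); case: eqP; case: eqP => // ->.
have {}cj : (c == j :> nat) = false by exact: cj.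
by rewrite !mxE cj andbF mul0r.
Qed.

(* The eigenvalue of q^(-H_i/2) on the a-th basis vector of V. *)
Definition kv (i a : nat) : K :=
  if a == i then qh^-1 else if a == i.+1 then qh else 1.

Lemma rhoKV_munit i a b : (i.+1 < n)%N -> rhoKV n s i *m mu a b = kv i a *: mu a b.
Proof.
move=> ni; rewrite !mulmxDl mul1mx -!scalemxAl !munit_mul ni (ltnW ni) !andbT /kv.
rewrite ![_ == a]eq_sym.
have [->|ai] := eqVneq a i.
  rewrite (_ : (i == i.+1) = false) ?scale0r ?scaler0 ?addr0 ?scale1r; last by lia.
  by rewrite -[X in X + _]scale1r -scalerDl addrC subrK.
have [->|ai'] := eqVneq a i.+1; rewrite ?scale0r ?scaler0 ?addr0 ?scale1r //.
by rewrite -[X in X + _]scale1r -scalerDl addrC subrK.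
Qed.

Lemma munit_rhoKV i a b : (i.+1 < n)%N -> mu a b *m rhoKV n s i = kv i b *: mu a b.
Proof.
move=> ni; rewrite !mulmxDr mulmx1 -!scalemxAr !munit_mul /kv.
have [->|ai] := eqVneq b i.
  rewrite (ltnW ni) (_ : (i == i.+1) = false) ?scale0r ?scaler0 ?addr0 ?scale1r; last by lia.
  by rewrite -[X in X + _]scale1r -scalerDl addrC subrK.
have [->|ai'] := eqVneq b i.+1; rewrite ?ni /= ?scale0r ?scaler0 ?addr0 ?scale1r //.
by rewrite -[X in X + _]scale1r -scalerDl addrC subrK.
Qed.

Hypothesis nzs : s != 0.
Hypothesis nzqp : q * q + 1 != 0.

Let nzq : q != 0. Proof. by rewrite expf_neq0. Qed.
Let nzqh : qh != 0. Proof. by rewrite expf_neq0. Qed.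
Let qhE : q = qh * qh. Proof. by rewrite /q mul2n -addnn exprD. Qed.

Lemma kv_neq0 i a : kv i a != 0.
Proof. by rewrite /kv; case: ifP => _; [|case: ifP => _]; rewrite ?invr_eq0 ?oner_eq0. Qed.

Lemma actXp_munit i a b : (i.+1 < n)%N ->
  actX s true i (mu a b) = (- q^-1 * kv i a * (b == i)%:R) *: mu a i.+1
                         + (kv i b * (a == i.+1)%:R) *: mu i b.
Proof.
move=> ni; rewrite /actX rhoKV_munit // -scalemxAl -scalemxAr munit_mul.
rewrite munit_mul -scalemxAl munit_rhoKV // !scalerA ni andbT [i.+1 == a]eq_sym.
rewrite [_ * kv i b]mulrC; congr (_ *: _ + _).
have [->|] := eqVneq b i; first by rewrite (ltnW ni) /=; ring.
by rewrite !mulr0.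
Qed.

(** By cyclicity [rhoX] and [rhoKV] become adjacent in both terms. They commute up to a power of q,
    which the antipode coefficient cancels. *)
Lemma trace_actX pos i (A : M) : (i.+1 < n)%N -> \tr (actX s pos i A) = 0.
Proof.
move=> ni; rewrite mxtraceD mxtrace_mulC mulmxA [X in _ + X]mxtrace_mulC mulmxA -mxtraceD.
rewrite -mulmxDl -scalemxAl.
have -> : (if pos then - q^-1 else - q) *: (rhoX K n pos i *m rhoKV n s i)
  + rhoKV n s i *m rhoX K n pos i = 0.
  have e1 : (i.+1 == i) = false by lia.
  case: pos; rewrite /rhoX rhoKV_munit // munit_rhoKV // scalerA -scalerDl /kv !eqxx e1 qhE;
  rewrite (_ : _ + _ = 0) ?scale0r //; field; exact: nzqh.
by rewrite mul0mx mxtrace0.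
Qed.

Lemma trace_actH i (A : M) : \tr (actH i A) = 0.
Proof. by rewrite mxtraceD mulmxN raddfN /= mxtrace_mulC addNr. Qed.

Hypothesis n1 : (1 < n)%N.

(** The raising operators reach everything from the corner: along the last row, up through the
    strictly lower triangle, then to the differences of neighbouring diagonal units, to the
    superdiagonal and across the upper triangle. *)
Lemma submodule_traceless (U : {vspace M}) : submodule s U -> mu n.-1 0 \in U ->
  forall A, \tr A = 0 -> A \in U.
Proof.
move=> subU topU.
have XU i A : (i.+1 < n)%N -> A \in U -> actX s true i A \in U.
  by move=> ni AU; have [_] := subU i A ni AU; apply.
have scaleU a A : a != 0 -> a *: A \in U -> A \in U.
  by move=> a0 /(memvZ a^-1); rewrite scalerA mulVf // scale1r.
have row_last b : (b < n.-1)%N -> mu n.-1 b \in U.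
  elim: b => // b IHb bn.
  have := XU b _ _ (IHb (ltnW bn)); rewrite actXp_munit ?eqxx; try lia.
  rewrite (_ : (n.-1 == b.+1) = false) ?mulr0 ?scale0r ?addr0; last by lia.
  by move=> /(_ _) H; apply: (scaleU _ _ _ (H _)); rewrite ?mulr1 ?mulf_neq0 ?oppr_eq0 ?invr_eq0 ?kv_neq0 //; lia.
(* As long as the target stays strictly below the diagonal, the column index differs from that of
   the generator, so one of the two terms of the action vanishes. *)
have lower k b : (b < n.-1 - k)%N -> mu (n.-1 - k) b \in U.
  elim: k => [|k IHk] bk; first by rewrite subn0 row_last; lia.
  have kE : (n.-1 - k = (n.-1 - k.+1).+1)%N by lia.
  have := XU (n.-1 - k.+1)%N _ _ (IHk _); rewrite kE actXp_munit ?eqxx; try lia.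
  rewrite (_ : (b == n.-1 - k.+1)%N = false) ?mulr0 ?scale0r ?add0r; last by lia.
  by move=> H; apply: (scaleU _ _ _ (H _ _)); rewrite ?mulr1 ?kv_neq0 //; lia.
have low a b : (b < a)%N -> (a < n)%N -> mu a b \in U.
  by move=> ba an; have := lower (n.-1 - a)%N b; rewrite subKn; [apply|]; lia.
(* Both terms of the action survive here; their coefficients are qh^-1 and - qh / q = - qh^-1, so
   the difference comes out undeformed. *)
have diag i : (i.+1 < n)%N -> mu i i - mu i.+1 i.+1 \in U.
  move=> ni; have := XU i _ ni (low _ _ (ltnSn i) ni).
  rewrite actXp_munit // !eqxx !mulr1 /kv !eqxx (_ : (i.+1 == i) = false); last by lia.
  move=> H; apply: (scaleU qh^-1); rewrite ?invr_eq0 //; congr (_ \in U): H.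
  by apply/matrixP => x y; rewrite !mxE qhE; field.
have up1 i : (i.+1 < n)%N -> mu i i.+1 \in U.
  move=> ni; have := XU i _ ni (diag _ ni).
  have -> : actX s true i (mu i i - mu i.+1 i.+1)
      = actX s true i (mu i i) - actX s true i (mu i.+1 i.+1).
    by rewrite /actX !(mulmxBl, mulmxBr) opprD addrACA.
  rewrite !actXp_munit // !eqxx /kv !eqxx (_ : (i.+1 == i) = false); last by lia.
  rewrite (_ : (i == i.+1) = false); last by lia.
  rewrite !(mulr0, mulr1, scale0r, addr0, add0r) -scalerBl; apply: scaleU.
  (* The two contributions have the same sign and add up to a multiple of q^2 + 1, so they do not
     cancel. *)
  have -> : - q^-1 / qh - qh = - ((q * q + 1) / (qh * q)).
    by rewrite qhE; field.
  by rewrite oppr_eq0 !mulf_neq0 ?invr_eq0 ?mulf_neq0.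
have up a k : (a + k.+1 < n)%N -> mu a (a + k.+1) \in U.
  elim: k => [|k IHk] ak; first by rewrite addn1 up1; lia.
  have := XU (a + k.+1)%N _ _ (IHk _); rewrite actXp_munit ?eqxx; try lia.
  rewrite (_ : (a == (a + k.+1).+1) = false) ?mulr0 ?scale0r ?addr0; last by lia.
  rewrite [(a + k.+2)%N]addnS.
  by move=> H; apply: (scaleU _ _ _ (H _ _)); rewrite ?mulr1 ?mulf_neq0 ?oppr_eq0 ?invr_eq0 ?kv_neq0 //; lia.
have upper a b : (a < b)%N -> (b < n)%N -> mu a b \in U.
  by move=> ab bn; have := up a (b - a).-1; rewrite (_ : (a + (b - a).-1.+1 = b)%N); [apply|]; lia.
have diag0 i : (i < n)%N -> mu i i - mu 0 0 \in U.
  elim: i => [|i IHi] ni; first by rewrite subrr mem0v.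
  rewrite -[mu i.+1 i.+1](subrK (mu i i)) -addrA memvD ?IHi; try lia.
  by rewrite -opprB memvN diag.
move=> A trA; rewrite [A]mx_sum_munit.
(* The term subtracted in total is tr A = 0 times the first diagonal unit; every summand now lies in
   U. *)
have -> : \sum_x A x.2 x.1 *: mu x.2 x.1
    = \sum_x A x.2 x.1 *: (mu x.2 x.1 - (x.2 == x.1)%:R *: mu 0 0).
  under [RHS]eq_bigr do rewrite scalerBr scalerA.
  rewrite sumrB -scaler_suml.
  rewrite (_ : \sum_x A x.2 x.1 * (x.2 == x.1)%:R = \tr A) ?trA ?scale0r ?subr0 //.
  rewrite -(pair_bigA _ (fun j i => A i j * (i == j)%:R)) /=; rewrite -[RHS]trA; apply: eq_bigr => j _.
  rewrite (bigD1 j) //= eqxx mulr1 big1 ?addr0 // => i /negPf ->.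
  by rewrite mulr0.
apply: memv_suml => -[j i] _ /=; apply: memvZ.
have [->|ij] := eqVneq i j; first by rewrite scale1r diag0.
rewrite scale0r subr0; have [ltij|ltji|/val_inj eij] := ltngtP i j.
- exact: upper.
- exact: low.
- by rewrite eij eqxx in ij.
Qed.

Lemma adjoint_moduleE (g : {vspace M}) : adjoint_module s g ->
  forall A, (A \in g) = (\tr A == 0).
Proof.
move=> [subg topg ming] A.
pose f : M -> K^o := @mxtrace K n.
have fl : linear f by move=> a B C; rewrite /f linearP.
pose F := GRing.isLinear.Build K M K^o *:%R f fl.
pose trH : 'Hom(M, K^o) := linfun (HB.pack f F : {linear M -> K^o}).
have trHE B : trH B = \tr B by rewrite lfunE.
apply/idP/eqP => [Ag|]; last exact: submodule_traceless.
(* Minimality of [g] is applied to the kernel of the trace, a submodule that contains the generator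
   because 1 < n. *)
have : (g <= lker trH)%VS.
  apply: ming => [i B ni _|].
    split=> [|pos]; rewrite memv_ker trHE ?trace_actH ?trace_actX //.
  rewrite memv_ker trHE /mxtrace big1 // => i _; rewrite mxE.
  by case: eqP => //= ->; rewrite (_ : (n.-1 == 0)%N = false) //; lia.
by move=> /subvP /(_ A Ag); rewrite memv_ker trHE => /eqP.
Qed.

End AdjointModule.

(** * Equivariance *)

Section OuterInner.
Variable K : fieldType.
Local Notation bv := (bvec K).

(** The version of [tmid] with arbitrary vectors in the outer slots. *)
Definition outer (I M J L : finType) (u : vec K I) (v : vec K M) (w : vec K (J * L)%type) :
    vec K ((I * J) * (L * M))%type :=
  [ffun y => u y.1.1 * w (y.1.2, y.2.1) * v y.2.2].

Section OuterSums.
Variables (I M J L X : finType) (c : X -> K).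
Variables (u : vec K I) (v : vec K M) (w : vec K (J * L)%type).

Lemma outer_sum1 (f : X -> vec K I) :
  outer (\sum_x c x *: f x) v w = \sum_x c x *: outer (f x) v w.
Proof.
apply/ffunP => y; rewrite ffunE !sum_ffunE !mulr_suml; apply: eq_bigr => x _.
by rewrite !ffunE !scale_regular !mulrA.
Qed.

Lemma outer_sum2 (f : X -> vec K M) :
  outer u (\sum_x c x *: f x) w = \sum_x c x *: outer u (f x) w.
Proof.
apply/ffunP => y; rewrite ffunE !sum_ffunE !mulr_sumr; apply: eq_bigr => x _.
by rewrite !ffunE !scale_regular mulrCA.
Qed.

Lemma outer_sum3 (f : X -> vec K (J * L)%type) :
  outer u v (\sum_x c x *: f x) = \sum_x c x *: outer u v (f x).
Proof.
apply/ffunP => y; rewrite ffunE !sum_ffunE mulr_sumr mulr_suml; apply: eq_bigr => x _.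
by rewrite !ffunE !scale_regular mulrCA !mulrA.
Qed.

End OuterSums.

Definition mid3 (I M I' M' J L J' L' : finType) (a : 'Hom(vec K I, vec K I'))
    (d : 'Hom(vec K M, vec K M'))
    (G : 'Hom(vec K (J * L)%type, vec K (J' * L')%type)) :
    'Hom(vec K ((I * J) * (L * M))%type, vec K ((I' * J') * (L' * M'))%type) :=
  lin_ext (fun x => outer (a (bv x.1.1)) (d (bv x.2.2)) (G (bv (x.1.2, x.2.1)))).

Lemma mid3_bvec (I M I' M' J L J' L' : finType) (a : 'Hom(vec K I, vec K I'))
    (d : 'Hom(vec K M, vec K M'))
    (G : 'Hom(vec K (J * L)%type, vec K (J' * L')%type)) i j l m :
  mid3 a d G (bv ((i, j), (l, m))) = outer (a (bv i)) (d (bv m)) (G (bv (j, l))).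
Proof. exact: lin_ext_bvec. Qed.

Lemma outer_bvec (I M J L : finType) (i : I) (m : M) (j : J) (l : L) :
  outer (bv i) (bv m) (bv (j, l)) = bv ((i, j), (l, m)).
Proof. exact: tmid_bvec. Qed.

Lemma mid3E (I M I' M' J L J' L' : finType) (a : 'Hom(vec K I, vec K I'))
    (d : 'Hom(vec K M, vec K M'))
    (G : 'Hom(vec K (J * L)%type, vec K (J' * L')%type)) u v w :
  mid3 a d G (outer u v w) = outer (a u) (d v) (G w).
Proof.
rewrite [u in LHS]vec_sum [a u]hom_vec !outer_sum1 hom_sum; apply: eq_bigr => i _.
rewrite hom_linE; congr (_ *: _).
rewrite [v in LHS]vec_sum [d v]hom_vec !outer_sum2 hom_sum; apply: eq_bigr => m _.
rewrite hom_linE; congr (_ *: _).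
rewrite [w in LHS]vec_sum [G w]hom_vec !outer_sum3 hom_sum; apply: eq_bigr => -[j l] _.
by rewrite hom_linE outer_bvec mid3_bvec.
Qed.

Lemma mid3_comp (I M I1 M1 I2 M2 J L J1 L1 J2 L2 : finType)
    (a1 : 'Hom(vec K I1, vec K I2)) (d1 : 'Hom(vec K M1, vec K M2))
    (G1 : 'Hom(vec K (J1 * L1)%type, vec K (J2 * L2)%type))
    (a : 'Hom(vec K I, vec K I1)) (d : 'Hom(vec K M, vec K M1))
    (G : 'Hom(vec K (J * L)%type, vec K (J1 * L1)%type)) :
  (mid3 a1 d1 G1 \o mid3 a d G)%VF = mid3 (a1 \o a)%VF (d1 \o d)%VF (G1 \o G)%VF.
Proof.
apply: hom_vec_ext => -[[i j] [l m]].
by rewrite comp_lfunE !mid3_bvec mid3E !comp_lfunE.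
Qed.

Lemma mid_hom_mid3 (I M J J' L L' : finType)
    (f : 'Hom(vec K (J * L)%type, vec K (J' * L')%type)) :
  mid_hom I M f = mid3 \1%VF \1%VF f.
Proof.
apply: hom_vec_ext => -[[i j] [l m]].
by rewrite mid_hom_bvec mid3_bvec !id_lfunE.
Qed.

Lemma tens_hom_mid3 (I M I' M' J L J' L' : finType) (a : 'Hom(vec K I, vec K I'))
    (b : 'Hom(vec K J, vec K J')) (c : 'Hom(vec K L, vec K L'))
    (d : 'Hom(vec K M, vec K M')) :
  tens_hom (tens_hom a b) (tens_hom c d) = mid3 a d (tens_hom b c).
Proof.
apply: hom_vec_ext => -[[i j] [l m]].
rewrite mid3_bvec !tens_hom_bvec /=.
by apply/ffunP => -[[x y] [z t]]; rewrite !ffunE /= !mulrA.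
Qed.

Lemma mid3D (I M I' M' J L J' L' : finType) (a : 'Hom(vec K I, vec K I'))
    (d : 'Hom(vec K M, vec K M'))
    (G G' : 'Hom(vec K (J * L)%type, vec K (J' * L')%type)) :
  mid3 a d (G + G')%VF = (mid3 a d G + mid3 a d G')%VF.
Proof.
apply: hom_vec_ext => -[[i j] [l m]].
rewrite add_lfunE !mid3_bvec add_lfunE.
by apply/ffunP => y; rewrite !ffunE mulrDr mulrDl.
Qed.

Lemma tens_homDl (I I' J J' : finType) (f f' : 'Hom(vec K I, vec K I'))
    (g : 'Hom(vec K J, vec K J')) :
  tens_hom (f + f')%VF g = (tens_hom f g + tens_hom f' g)%VF.
Proof.
by apply: hom_vec_ext => -[i j]; rewrite add_lfunE !tens_hom_bvec add_lfunE tens_addl.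
Qed.

Lemma tens_homDr (I I' J J' : finType) (g : 'Hom(vec K I, vec K I'))
    (f f' : 'Hom(vec K J, vec K J')) :
  tens_hom g (f + f')%VF = (tens_hom g f + tens_hom g f')%VF.
Proof.
by apply: hom_vec_ext => -[i j]; rewrite add_lfunE !tens_hom_bvec add_lfunE tens_addr.
Qed.

End OuterInner.

(** * Twisted primitive elements acting on four tensor factors *)

Section TwistedPrimitive.
Variables (K : fieldType) (I : finType).
Local Notation End1 := 'End(vec K I).
Local Notation End2 := 'End(vec K (I * I)%type).
Variables (tV tD tVD : End2) (Xv Kv Lv Xd Kd Ld : End1).

(* The coproduct X (x) L + K (x) X of a twisted primitive element. *)
Definition twisted_coprod (J J' : finType) (X1 K1 : 'End(vec K J)) (L2 X2 : 'End(vec K J')) :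
    'End(vec K (J * J')%type) :=
  (tens_hom X1 L2 + tens_hom K1 X2)%VF.

Hypothesis tV_X : (tV \o twisted_coprod Xv Kv Lv Xv = twisted_coprod Xv Kv Lv Xv \o tV)%VF.
Hypothesis tV_K : (tV \o tens_hom Kv Kv = tens_hom Kv Kv \o tV)%VF.
Hypothesis tD_X : (tD \o twisted_coprod Xd Kd Ld Xd = twisted_coprod Xd Kd Ld Xd \o tD)%VF.
Hypothesis tD_L : (tD \o tens_hom Ld Ld = tens_hom Ld Ld \o tD)%VF.
Hypothesis tVD_X : (tVD \o twisted_coprod Xv Kv Ld Xd = twisted_coprod Xd Kd Lv Xv \o tVD)%VF.
Hypothesis tVD_K : (tVD \o tens_hom Kv Kd = tens_hom Kd Kv \o tVD)%VF.
Hypothesis tVD_L : (tVD \o tens_hom Lv Ld = tens_hom Ld Lv \o tVD)%VF.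

Local Notation XM := (twisted_coprod Xv Kv Ld Xd).
Local Notation KM := (tens_hom Kv Kd).
Local Notation LM := (tens_hom Lv Ld).
Local Notation ActM := (twisted_coprod XM KM LM XM).
Local Notation ActE := (twisted_coprod (twisted_coprod Xv Kv Lv Xv) (tens_hom Kv Kv)
  (tens_hom Ld Ld) (twisted_coprod Xd Kd Ld Xd)).

(** Coassociativity: the iterated coproduct is sorted by whether X falls on the first factor, on the
    middle pair or on the last factor. The outer operators agree with those in [ActE_mid3], so a
    crossing of the middle pair has to be checked on that pair only. *)
Lemma ActM_mid3 : ActM = (mid3 Xv Ld (tens_hom Ld Lv)
  + (mid3 Kv Ld (twisted_coprod Xd Kd Lv Xv) + mid3 Kv Xd (tens_hom Kd Kv)))%VF.
Proof.
rewrite /twisted_coprod tens_homDl tens_homDr mid3D !tens_hom_mid3.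
by rewrite !addrA.
Qed.

Lemma ActE_mid3 : ActE = (mid3 Xv Ld (tens_hom Lv Ld)
  + (mid3 Kv Ld (twisted_coprod Xv Kv Ld Xd) + mid3 Kv Xd (tens_hom Kv Kd)))%VF.
Proof.
rewrite /twisted_coprod tens_homDl tens_homDr mid3D !tens_hom_mid3.
by rewrite !addrA.
Qed.

Lemma mid_hom_Act : (mid_hom I I tVD \o ActE = ActM \o mid_hom I I tVD)%VF.
Proof.
rewrite ActE_mid3 ActM_mid3 mid_hom_mid3 !comp_lfunDr !comp_lfunDl !mid3_comp.
by rewrite tVD_X tVD_K tVD_L !comp_lfun1l !comp_lfun1r.
Qed.

Lemma tens_hom_Act : (tens_hom tV tD \o ActE = ActE \o tens_hom tV tD)%VF.
Proof.
have comp (f g f' g' : End2) :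
    (tens_hom f g \o tens_hom f' g')%VF = tens_hom (f \o f')%VF (g \o g')%VF.
  by apply/lfunP => u; rewrite comp_lfunE tens_hom_comp.
rewrite {1 4}/twisted_coprod comp_lfunDr comp_lfunDl !comp.
by rewrite tV_X tV_K tD_X tD_L.
Qed.

End TwistedPrimitive.

(* One weight-raising operator X e_j = c [j = x] e_y on a space with a total
   order lt, together with the diagonal operator of eigenvalues k and its
   inverse: the situation for X_i^+ and X_i^- on V, and, for the opposite
   order, on V^*. *)
Section HeckeEquivariance.
Variables (K : fieldType) (I : finType) (q : K) (lt : rel I).
Local Notation bv := (bvec K).
Local Notation w := (q - q^-1).
Variables (S : 'End(vec K (I * I)%type)) (X Kk Lk : 'End(vec K I)).
Variables (x y : I) (c kappa : K) (k : I -> K).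
Hypothesis SE : forall a b, S (bv (a, b)) =
  if a == b then q *: bv (a, a) else bv (b, a) + (w * (lt b a)%:R) *: bv (a, b).
Hypothesis XE : forall j, X (bv j) = (c * (j == x)%:R) *: bv y.
Hypothesis KE : forall j, Kk (bv j) = k j *: bv j.
Hypothesis LE : forall j, Lk (bv j) = (k j)^-1 *: bv j.
Hypothesis xy : x != y.
Hypothesis nzk : kappa != 0.
Hypothesis kx : k x = kappa.
Hypothesis ky : k y = kappa^-1.
Hypothesis k1 : forall b, b != x -> b != y -> k b = 1.
Hypothesis lt_yx : lt y x = ~~ lt x y.
Hypothesis lt_other : forall b, b != x -> b != y -> lt b x = lt b y /\ lt x b = lt y b.
Hypothesis qE : q = if lt x y then kappa ^- 2 else kappa ^+ 2.

Let tensE := (tens_bvZl, tens_bvZr, tens_addl, tens_addr, tens_bvec).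

Let nzq : q != 0.
Proof. by rewrite qE; case: ifP => _; rewrite ?invr_eq0 expf_neq0. Qed.

(** Essentially a computation on the span of e_x and e_y, where [qE] ties q to the direction of X.
    Any other index has eigenvalue 1 and, by [lt_other], lies on the same side of x and of y. *)
Lemma hecke_twisted_coprod :
  (S \o twisted_coprod X Kk Lk X = twisted_coprod X Kk Lk X \o S)%VF.
Proof.
apply: hom_vec_ext => -[a b]; rewrite !comp_lfunE.
have GE i j : twisted_coprod X Kk Lk X (bv (i, j))
    = (c * (i == x)%:R * (k j)^-1) *: bv (y, j) + (c * (j == x)%:R * k i) *: bv (i, y).
  rewrite add_lfunE !tens_hom_bvec /= !XE KE LE !tensE !scalerA.
  by congr (_ *: _ + _ *: _); ring.
have yx : y != x by rewrite eq_sym.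
rewrite GE SE; have [<-|ab] := eqVneq a b.
  have [->|ax] := eqVneq a x.
    rewrite !hom_linE !GE !SE !eqxx (negPf yx) (negPf xy) lt_yx kx qE.
    by apply: vect_form_ext => f fl /=; rewrite !(linear_formE fl); case: (lt x y) => /=; field; rewrite ?kx ?ky ?invr_eq0 ?nzk ?nzq ?oner_eq0.
  by rewrite /= !(mulr0, mul0r, scale0r, addr0) !hom_linE !GE (negPf ax) /= !(mulr0, mul0r, scale0r, addr0, scaler0).
have [ax|ax] := eqVneq a x; have [bx|bx] := eqVneq b x.
- by move: ab; rewrite ax bx eqxx.
- rewrite ax; have [->|by_] := eqVneq b y.
    rewrite !hom_linE !GE !SE !eqxx (negPf yx) (negPf xy) lt_yx kx ky qE.
    by apply: vect_form_ext => f fl /=; rewrite !(linear_formE fl); case: (lt x y) => /=; field; rewrite ?kx ?ky ?invr_eq0 ?nzk ?nzq ?oner_eq0.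
  have [l1 l2] := lt_other bx by_.
  rewrite !hom_linE !GE !SE !eqxx (negPf bx) [y == b]eq_sym (negPf by_) k1 // l1.
  by apply: vect_form_ext => f fl /=; rewrite !(linear_formE fl) /=; field; rewrite ?kx ?ky ?invr_eq0 ?nzk ?nzq ?oner_eq0.
- rewrite bx; have [->|ay] := eqVneq a y.
    rewrite !hom_linE !GE !SE !eqxx (negPf yx) ?(negPf xy) ?lt_yx kx ky qE.
    by apply: vect_form_ext => f fl /=; rewrite !(linear_formE fl); case: (lt x y) => /=; field; rewrite ?kx ?ky ?invr_eq0 ?nzk ?nzq ?oner_eq0.
  have [l1 l2] := lt_other ax ay.
  rewrite !hom_linE !GE !SE !eqxx (negPf ax) (negPf ay) (negPf yx) (k1 ax ay) l2.
  by apply: vect_form_ext => f fl /=; rewrite !(linear_formE fl) /=; field; rewrite ?kx ?ky ?invr_eq0 ?nzk ?nzq ?oner_eq0.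
by rewrite /= !(mulr0, mul0r, scale0r, addr0) !hom_linE !GE (negPf ax) (negPf bx) /= !(mulr0, mul0r, scale0r, addr0, scaler0).
Qed.

End HeckeEquivariance.

Section DiagonalEquivariance.
Variables (K : fieldType) (n : nat) (s : K).
Local Notation bv := (bvec K).
Local Notation I := 'I_n.

Lemma tau_VV_diag (G : 'End(VV K n)) (e : I -> I -> K) :
  (forall a b, G (bv (a, b)) = e a b *: bv (a, b)) -> (forall a b, e a b = e b a) ->
  (tau_VV n s \o G = G \o tau_VV n s)%VF.
Proof.
move=> GE esym; apply: hom_vec_ext => -[a b]; rewrite !comp_lfunE GE hom_linE tau_VV_bvec.
case: eqVneq => [->|_]; first by rewrite GE.
by rewrite !hom_linE !GE [e b a]esym !scalerDr !scalerA ![e a b * _]mulrC.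
Qed.

Lemma tau_DD_diag (G : 'End(VV K n)) (e : I -> I -> K) :
  (forall a b, G (bv (a, b)) = e a b *: bv (a, b)) -> (forall a b, e a b = e b a) ->
  (tau_DD n s \o G = G \o tau_DD n s)%VF.
Proof.
move=> GE esym; apply: hom_vec_ext => -[a b]; rewrite !comp_lfunE GE hom_linE tau_DD_bvec.
case: eqVneq => [->|_]; first by rewrite GE.
by rewrite !hom_linE !GE [e b a]esym !scalerDr !scalerA ![e a b * _]mulrC.
Qed.

Lemma tau_VD_diag (G G' : 'End(VV K n)) (e : I -> I -> K) (z : K) :
  (forall a b, G (bv (a, b)) = e a b *: bv (a, b)) ->
  (forall a b, G' (bv (b, a)) = e a b *: bv (b, a)) -> (forall a, e a a = z) ->
  (tau_VD n s \o G = G' \o tau_VD n s)%VF.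
Proof.
move=> GE GE' ez; apply: hom_vec_ext => -[a b]; rewrite !comp_lfunE GE hom_linE tau_VD_bvec.
have [->|ab] := eqVneq b a; last by rewrite !hom_linE GE' !scalerA mulrC.
rewrite !hom_linE hom_sum GE' ez.
under [in RHS]eq_bigr => k _ do rewrite GE' ez.
rewrite -scaler_sumr.
by apply: vect_form_ext => f fl; rewrite !(linear_formE fl); ring.
Qed.

End DiagonalEquivariance.

Section MixedEquivariance.
Variables (K : fieldType) (n : nat) (s : K).
Local Notation q := (q n s).
Local Notation w := (omega n s).
Local Notation I := 'I_n.
Local Notation bv := (bvec K).
Variables (Xv Kv Lv Xd Kd Ld : 'End(vec K I)).
Variables (x y : I) (kappa : K) (k : I -> K).
Hypothesis nzs : s != 0.
Hypothesis XvE : forall j, Xv (bv j) = (- kappa ^+ 2 * (j == x)%:R) *: bv y.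
Hypothesis XdE : forall j, Xd (bv j) = (j == y)%:R *: bv x.
Hypothesis KvE : forall j, Kv (bv j) = k j *: bv j.
Hypothesis LvE : forall j, Lv (bv j) = (k j)^-1 *: bv j.
Hypothesis KdE : forall j, Kd (bv j) = (k j)^-1 *: bv j.
Hypothesis LdE : forall j, Ld (bv j) = k j *: bv j.
Hypothesis xy : x != y.
Hypothesis nzk : kappa != 0.
Hypothesis kx : k x = kappa.
Hypothesis ky : k y = kappa^-1.
Hypothesis k1 : forall b, b != x -> b != y -> k b = 1.
Hypothesis lt_yx : (y < x)%N = ~~ (x < y)%N.
Hypothesis lt_other : forall b : I, b != x -> b != y -> (b < x)%N = (b < y)%N.
Hypothesis qE : q = if (x < y)%N then kappa ^- 2 else kappa ^+ 2.

Let tensE := (tens_bvZl, tens_bvZr, tens_addl, tens_addr, tens_bvec).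
Let nzq : q != 0. Proof. by rewrite expf_neq0. Qed.
Let nzqr : q_root s != 0. Proof. by rewrite expf_neq0. Qed.

Lemma tau_VD_twisted_coprod :
  (tau_VD n s \o twisted_coprod Xv Kv Ld Xd = twisted_coprod Xd Kd Lv Xv \o tau_VD n s)%VF.
Proof.
apply: hom_vec_ext => -[a b]; rewrite !comp_lfunE.
have GE i j : twisted_coprod Xv Kv Ld Xd (bv (i, j))
    = (- kappa ^+ 2 * (i == x)%:R * k j) *: bv (y, j) + ((j == y)%:R * k i) *: bv (i, x).
  rewrite add_lfunE !tens_hom_bvec /= XvE XdE KvE LdE !tensE !scalerA.
  by congr (_ *: _ + _ *: _); ring.
have GE' j i : twisted_coprod Xd Kd Lv Xv (bv (j, i))
    = ((j == y)%:R * (k i)^-1) *: bv (x, i) + (- kappa ^+ 2 * (i == x)%:R * (k j)^-1) *: bv (j, y).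
  rewrite add_lfunE !tens_hom_bvec /= XvE XdE KdE LvE !tensE !scalerA.
  by congr (_ *: _ + _ *: _); ring.
have yx : y != x by rewrite eq_sym.
(* Only j = x and j = y contribute, with opposite values, so the image of a tail of [tau_VD] depends
   only on which of x and y it contains. *)
have G'diag j : twisted_coprod Xd Kd Lv Xv (bv (j, j))
    = (j == y)%:R *: (kappa *: bv (x, y)) - (j == x)%:R *: (kappa *: bv (x, y)).
  rewrite GE'; have [->|jy] := eqVneq j y.
    rewrite ky (negPf yx).
    by apply: vect_form_ext => f fl /=; rewrite !(linear_formE fl) /=; field; rewrite ?kx ?ky ?invr_eq0 ?nzk ?nzq ?oner_eq0.
  have [->|jx] := eqVneq j x.
    rewrite kx.
    by apply: vect_form_ext => f fl /=; rewrite !(linear_formE fl) /=; field; rewrite ?kx ?ky ?invr_eq0 ?nzk ?nzq ?oner_eq0.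
  by rewrite !(mulr0, mul0r, scale0r) subrr addr0.
have G'sum (i : I) : twisted_coprod Xd Kd Lv Xv (\sum_(m < n | (i < m)%N) bv (m, m))
    = ((i < y)%:R - (i < x)%:R) *: (kappa *: bv (x, y)).
  rewrite hom_sum; under eq_bigr => j _ do rewrite G'diag.
  by rewrite sumrB !(sum_delta_gt _ _ (fun=> kappa *: bv (x, y))) scalerBl.
have tauE i : q_root s *: tau_VD n s (bv (i, i))
    = q *: bv (i, i) + w *: \sum_(m < n | (i < m)%N) bv (m, m).
  by rewrite tau_VD_bvec eqxx scalerA divff // scale1r.
apply: (scalerI nzqr); rewrite GE.
have [<-|ab] := eqVneq a b.
  rewrite -[RHS]hom_linE tauE [RHS]hom_linE !hom_linE G'diag G'sum.
  have [->|ax] := eqVneq a x.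
    rewrite tau_VD_bvec (negPf xy) kx ltnn qE /omega qE.
    by apply: vect_form_ext => f fl /=; rewrite !(linear_formE fl); case: (x < y)%N => /=; field; rewrite ?kx ?ky ?invr_eq0 ?nzk ?nzq ?oner_eq0.
  have [->|ay] := eqVneq a y.
    rewrite /= !(mulr0, mul0r, scale0r, add0r) tau_VD_bvec (negPf xy) ky ltnn lt_yx qE /omega qE.
    by apply: vect_form_ext => f fl /=; rewrite !(linear_formE fl); case: (x < y)%N => /=; field; rewrite ?kx ?ky ?invr_eq0 ?nzk ?nzq ?oner_eq0.
  have -> : (a < x)%N = (a < y)%N by exact: lt_other.
  by rewrite /= !(mulr0, mul0r, scale0r, add0r, subrr, scaler0).
rewrite [tau_VD n s (bv (a, b))]tau_VD_bvec [b == a]eq_sym (negPf ab).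
rewrite [twisted_coprod _ _ _ _ (_ *: _)]hom_linE GE' scalerA divff // scale1r !hom_linE.
have [ax|ax] := eqVneq a x; have [bey|bey] := eqVneq b y.
- rewrite ax bey !tau_VD_bvec !eqxx.
  (* No index lies between x and y, so the tails starting at x and at y differ by an end term
     only. *)
  have sumE : \sum_(m < n | (x < m)%N) bv (m, m)
      = \sum_(m < n | (y < m)%N) bv (m, m) + (x < y)%:R *: bv (y, y)
        - (~~ (x < y)%N)%:R *: bv (x, x).
    have sumE z : \sum_(m < n | (z < m)%N) bv (m, m)
        = (z < x)%:R *: bv (x, x) + ((z < y)%:R *: bv (y, y)
          + \sum_(m < n | (m != x) && (m != y)) (z < m)%:R *: bv (m, m)).
      rewrite big_mkcond (bigD1 x) //= (bigD1 y) ?[y == x]eq_sym //=.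
      congr (_ + (_ + _)); try by case: ifP => _; rewrite ?scale1r ?scale0r.
      by apply: eq_bigr => m _; case: ifP => _; rewrite ?scale1r ?scale0r.
    rewrite !sumE !ltnn lt_yx.
    have -> : \sum_(m < n | (m != x) && (m != y)) (x < m)%:R *: bv (m, m)
        = \sum_(m < n | (m != x) && (m != y)) (y < m)%:R *: bv (m, m).
      apply: eq_bigr => m /andP[mx my].
      have flip (z : I) : m != z -> (z < m)%N = ~~ (m < z)%N.
        by move=> mz; rewrite ltn_neqAle -leqNgt val_eqE [z == m]eq_sym mz.
      by rewrite !flip // lt_other.
    by apply: vect_form_ext => f fl; rewrite !(linear_formE fl); case: (x < y)%N => /=; ring.
  rewrite sumE kx ky qE /omega qE.
  by apply: vect_form_ext => f fl /=; rewrite !(linear_formE fl); case: (x < y)%N => /=; field; rewrite ?nzqr ?kx ?ky ?invr_eq0 ?nzk ?nzq ?oner_eq0.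
- have bx : b != x by rewrite -ax eq_sym.
  rewrite /= !(mulr0, mul0r, scale0r, add0r, addr0) tau_VD_bvec (negPf bey) (k1 bx bey).
  by apply: vect_form_ext => f fl /=; rewrite !(linear_formE fl) /=; field; rewrite ?nzqr ?oner_eq0.
- have ay : a != y by rewrite -bey.
  rewrite /= !(mulr0, mul0r, scale0r, add0r, addr0) tau_VD_bvec [x == a]eq_sym (negPf ax) (k1 ax ay).
  by apply: vect_form_ext => f fl /=; rewrite !(linear_formE fl) /=; field; rewrite ?nzqr ?oner_eq0.
by rewrite /= !(mulr0, mul0r, scale0r, add0r, addr0, scaler0).
Qed.

End MixedEquivariance.

Section BracketEquivariance.
Variables (K : fieldType) (n : nat) (s : K).
Local Notation q := (q n s).
Local Notation qh := (q_half n s).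
Local Notation w := (omega n s).
Local Notation I := 'I_n.
Local Notation M := 'M[K]_n.
Local Notation MM := (MM K n).
Local Notation bv := (bvec K).
Local Notation mu := (munit K n).
Hypothesis nzs : s != 0.
Hypothesis nz2 : 2 != 0 :> K.
Hypothesis nzqp : q * q + 1 != 0.

Let nzq : q != 0. Proof. by rewrite expf_neq0. Qed.
Let nzqh : qh != 0. Proof. by rewrite expf_neq0. Qed.
Let qhE : q = qh * qh. Proof. by rewrite /Defs.q mul2n -addnn exprD. Qed.

(* Under M* = V (x) V*, right multiplication acts on V and left multiplication
   acts on V*. *)
Definition rmul (B : M) : 'End(vec K I) := lin_ext (fun j => [ffun k => B j k] : vec K I).
Definition lmul (B : M) : 'End(vec K I) := lin_ext (fun j => [ffun k => B k j] : vec K I).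

Lemma rmul_bvec B j : rmul B (bv j) = [ffun k => B j k].
Proof. exact: lin_ext_bvec. Qed.
Lemma lmul_bvec B j : lmul B (bv j) = [ffun k => B k j].
Proof. exact: lin_ext_bvec. Qed.

Lemma vecM_mul (A B C : M) : vecM (B *m A *m C) = tens_hom (rmul C) (lmul B) (vecM A).
Proof.
rewrite hom_vec; apply/ffunP => -[a b]; rewrite !ffunE sum_ffunE mxE /=.
under eq_bigr => j _ do rewrite mxE mulr_suml.
rewrite (pair_bigA _ (fun j i => B b i * A i j * C j a)) /=; apply: eq_bigr => -[j i] _ /=.
rewrite tens_hom_bvec rmul_bvec lmul_bvec !ffunE scale_regular /=; ring.
Qed.

Lemma tens_hom_tensM (F G : 'End(VV K n)) (A B A' B' : M) :
  F (vecM A) = vecM A' -> G (vecM B) = vecM B' -> tens_hom F G (tensM A B) = tensM A' B'.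
Proof. by move=> FA GB; rewrite tens_homE FA GB. Qed.

(** [tau_VV] is a combination of [S_VV] and the identity, so commutation can be tested on the Hecke
    operator. *)
Lemma tau_VV_comm (G : 'End(VV K n)) :
  (S_VV n s \o G = G \o S_VV n s)%VF -> (tau_VV n s \o G = G \o tau_VV n s)%VF.
Proof.
have tauE : tau_VV n s = ((q + q^-1)^-1 *: (2 *: S_VV n s - w *: \1))%VF.
  by rewrite S_VV_unlock; vect_linear; field; rewrite nz2 nzqp nzq.
move=> /lfunP e; apply/lfunP => u; have {e} := e u; rewrite !comp_lfunE => e.
have tauE' v : tau_VV n s v = (q + q^-1)^-1 *: (2 *: S_VV n s v - w *: v).
  by rewrite tauE scale_lfunE add_lfunE opp_lfunE !scale_lfunE id_lfunE.
by rewrite !tauE' e !hom_linE.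
Qed.

Lemma tau_DD_comm (G : 'End(VV K n)) :
  (S_DD n s \o G = G \o S_DD n s)%VF -> (tau_DD n s \o G = G \o tau_DD n s)%VF.
Proof.
have tauE : tau_DD n s = ((q + q^-1)^-1 *: (2 *: S_DD n s - w *: \1))%VF.
  by rewrite S_DD_unlock; vect_linear; field; rewrite nz2 nzqp nzq.
move=> /lfunP e; apply/lfunP => u; have {e} := e u; rewrite !comp_lfunE => e.
have tauE' v : tau_DD n s v = (q + q^-1)^-1 *: (2 *: S_DD n s v - w *: v).
  by rewrite tauE scale_lfunE add_lfunE opp_lfunE !scale_lfunE id_lfunE.
by rewrite !tauE' e !hom_linE.
Qed.

Section TwistedAction.
Variables (Xv Kv Lv Xd Kd Ld : 'End(vec K I)) (aX aK aL : M -> M).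
Local Notation XM := (twisted_coprod Xv Kv Ld Xd).
Local Notation KM := (tens_hom Kv Kd).
Local Notation LM := (tens_hom Lv Ld).
Local Notation ActM := (twisted_coprod XM KM LM XM).
Hypothesis aXE : forall A, vecM (aX A) = XM (vecM A).
Hypothesis aKE : forall A, vecM (aK A) = KM (vecM A).
Hypothesis aLE : forall A, vecM (aL A) = LM (vecM A).
Hypothesis tV_X : (tau_VV n s \o twisted_coprod Xv Kv Lv Xv
  = twisted_coprod Xv Kv Lv Xv \o tau_VV n s)%VF.
Hypothesis tV_K : (tau_VV n s \o tens_hom Kv Kv = tens_hom Kv Kv \o tau_VV n s)%VF.
Hypothesis tD_X : (tau_DD n s \o twisted_coprod Xd Kd Ld Xd
  = twisted_coprod Xd Kd Ld Xd \o tau_DD n s)%VF.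
Hypothesis tD_L : (tau_DD n s \o tens_hom Ld Ld = tens_hom Ld Ld \o tau_DD n s)%VF.
Hypothesis tVD_X : (tau_VD n s \o twisted_coprod Xv Kv Ld Xd
  = twisted_coprod Xd Kd Lv Xv \o tau_VD n s)%VF.
Hypothesis tVD_K : (tau_VD n s \o tens_hom Kv Kd = tens_hom Kd Kv \o tau_VD n s)%VF.
Hypothesis tVD_L : (tau_VD n s \o tens_hom Lv Ld = tens_hom Ld Lv \o tau_VD n s)%VF.
Hypothesis trX : forall A, \tr (aX A) = 0.
Hypothesis trK : forall A, \tr (aK A) = \tr A.

Lemma ActM_tensM A B : ActM (tensM A B) = tensM (aX A) (aL B) + tensM (aK A) (aX B).
Proof.
rewrite add_lfunE; by congr (_ + _); apply: tens_hom_tensM; rewrite ?aXE ?aKE ?aLE.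
Qed.

(** The crossing [Phi] intertwines the actions on the two orderings of the factors; its inverse
    [Psi] therefore intertwines them in the other direction. *)
Lemma tau_RE_ActM u : tau_RE n s (ActM u) = ActM (tau_RE n s u).
Proof.
have PhiAct := mid_hom_Act tVD_X tVD_K tVD_L.
have TAct := tens_hom_Act tV_X tV_K tD_X tD_L.
rewrite !comp_lfunE tau_VD_inv //.
have PsiAct v : mid_hom I I (tau_DV n s) (ActM v) = twisted_coprod
    (twisted_coprod Xv Kv Lv Xv) (tens_hom Kv Kv) (tens_hom Ld Ld)
    (twisted_coprod Xd Kd Ld Xd) (mid_hom I I (tau_DV n s) v).
  have PhiK' x : mid_hom I I (tau_VD n s) (mid_hom I I (tau_DV n s) x) = x.
    by have := PhiK nzs x; rewrite Phi_unlock Psi_unlock.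
  have PsiK' x : mid_hom I I (tau_DV n s) (mid_hom I I (tau_VD n s) x) = x.
    by have := PsiK nzs x; rewrite Phi_unlock Psi_unlock.
  by rewrite -{1}[v]PhiK' -[ActM (mid_hom _ _ _ _)]comp_lfunE -PhiAct comp_lfunE PsiK'.
rewrite PsiAct -[tens_hom (tau_VV _ _) _ (twisted_coprod _ _ _ _ _)]comp_lfunE TAct.
by rewrite comp_lfunE -[LHS]comp_lfunE PhiAct comp_lfunE.
Qed.

(** The trace is annihilated by X and fixed by K, so only the summand K (x) X of the coproduct
    survives on the traced factor. *)
Lemma trL_ActM u : vecM (trL K n (ActM u)) = XM (vecM (trL K n u)).
Proof.
rewrite [u]vec_sum !hom_sum.
have vecM_sum (J : finType) (F : J -> M) : vecM (\sum_x F x) = \sum_x vecM (F x).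
  exact: linear_sum.
rewrite !vecM_sum hom_sum; apply: eq_bigr => -[[j i] [l k]] _.
rewrite !hom_linE !linearZ /=; congr (_ *: _).
rewrite -tensM_munit ActM_tensM hom_linE !trL_tens trX scale0r add0r trK.
by rewrite !linearZ /= aXE.
Qed.

Lemma vecM_inj : injective (@vecM K n).
Proof.
by move=> A B /ffunP e; apply/matrixP => i j; have := e (j, i); rewrite !ffunE.
Qed.

Lemma q_bracket_ActM A B : let b A B := q_bracket n s (tensM A B) in
  aX (b A B) = b (aX A) (aL B) + b (aK A) (aX B).
Proof.
move=> b; rewrite /b -hom_linE -ActM_tensM; apply: vecM_inj.
rewrite aXE /q_bracket.
set gamma := (X in (X *: _)%VF).
have brE u : (gamma *: (trL K n \o tau_RE n s))%VF u = gamma *: trL K n (tau_RE n s u).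
  by rewrite scale_lfunE; congr (_ *: _); rewrite comp_lfunE.
by rewrite !brE tau_RE_ActM !linearZ /= trL_ActM.
Qed.

End TwistedAction.

Let kvK i (a b : I) : rhoKV n s i a b = (a == b)%:R * kv n s i a.
Proof.
rewrite /rhoKV !mxE /kv; have [<-|ab] := eqVneq a b.
  rewrite !andbb mul1r; have [->|ai] := eqVneq (a : nat) i.
    by rewrite (_ : (i == i.+1) = false) /=; [ring | lia].
  by case: eqP => _ /=; ring.
have ab' : (a == b :> nat) = false by apply/negbTE; rewrite val_eqE.
have ne z : ((a == z :> nat) && (b == z :> nat)) = false.
  by case: eqP => //= az; case: eqP => // bz; move: ab'; rewrite az bz eqxx.
by rewrite !ne /=; ring.
Qed.

Let rhoK_kv i (a b : I) : rhoK n s i a b = (a == b)%:R * (kv n s i a)^-1.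
Proof.
rewrite /rhoK !mxE /kv; have [<-|ab] := eqVneq a b.
  rewrite !andbb mul1r; have [->|ai] := eqVneq (a : nat) i.
    by rewrite (_ : (i == i.+1) = false) /= ?invrK; [ring | lia].
  by case: eqP => _ /=; rewrite ?invr1; ring.
have ab' : (a == b :> nat) = false by apply/negbTE; rewrite val_eqE.
have ne z : ((a == z :> nat) && (b == z :> nat)) = false.
  by case: eqP => //= az; case: eqP => // bz; move: ab'; rewrite az bz eqxx.
by rewrite !ne /=; ring.
Qed.

Lemma q_bracket_actX pos i A B : (i.+1 < n)%N ->
  let b A B := q_bracket n s (tensM A B) in
  actX s pos i (b A B) = b (actX s pos i A) (actKV s i B) + b (actK s i A) (actX s pos i B).
Proof.
move=> ni b.
have ni' := ltnW ni.
pose o := Ordinal ni'; pose o1 := Ordinal ni.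
(* On V, through right multiplication, the generator moves e_x to e_y; on V* it moves f^y to f^x.
   [kappa] is the eigenvalue of q^(-H_i/2) at x. *)
pose x := if pos then o else o1; pose y := if pos then o1 else o.
pose k (a : I) := kv n s i a.
pose kappa := k x.
pose c := if pos then - q^-1 else - q.
have xy : x != y by rewrite /x /y -val_eqE; case: (pos) => /=; lia.
have nzk : kappa != 0 by exact: kv_neq0.
have k_o : k o = qh^-1 by rewrite /k /kv eqxx.
have k_o1 : k o1 = qh by rewrite /k /kv /= eqxx ifN //; lia.
have ky : k y = kappa^-1 by rewrite /kappa /x /y; case: (pos); rewrite k_o k_o1 ?invrK.
have k1 a : a != x -> a != y -> k a = 1.
  by rewrite /x /y /k /kv -!val_eqE; case: (pos) => /= /negPf e1 /negPf e2; rewrite ?e1 e2 ?e1.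
have cE : c = - kappa ^+ 2.
  by rewrite /c /kappa /x; case: (pos); rewrite ?k_o ?k_o1 qhE expr2 ?invfM.
have lt_yx : (y < x)%N = ~~ (x < y)%N by rewrite /x /y; case: (pos) => /=; lia.
have lt_other (a : I) : a != x -> a != y -> (a < x)%N = (a < y)%N.
  by rewrite /x /y -!val_eqE; case: (pos) => /=; lia.
have lt_other' (a : I) : a != x -> a != y -> (x < a)%N = (y < a)%N.
  by rewrite /x /y -!val_eqE; case: (pos) => /=; lia.
have qE : q = if (x < y)%N then kappa ^- 2 else kappa ^+ 2.
  rewrite /kappa /x /y; case: (pos) => /=; first by rewrite ltnSn k_o exprVn invrK qhE.
  by rewrite ltnNge leqnSn k_o1 qhE.
pose Xv := rmul (c *: rhoX K n pos i); pose Kv := rmul (rhoKV n s i).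
pose Lv := rmul (rhoK n s i); pose Xd := lmul (rhoX K n pos i).
pose Kd := lmul (rhoK n s i); pose Ld := lmul (rhoKV n s i).
have XvE j : Xv (bv j) = (- kappa ^+ 2 * (j == x)%:R) *: bv y.
  rewrite rmul_bvec -cE; apply/ffunP => a; rewrite !ffunE !mxE scale_regular -mulrA -natrM mulnb.
  by rewrite /x /y; case: (pos); rewrite mxE -!val_eqE.
have XdE j : Xd (bv j) = (j == y)%:R *: bv x.
  rewrite lmul_bvec; apply/ffunP => a; rewrite !ffunE scale_regular -natrM mulnb.
  by rewrite /x /y; case: (pos); rewrite mxE -!val_eqE andbC.
have KvE j : Kv (bv j) = k j *: bv j.
  by rewrite rmul_bvec; apply/ffunP => a; rewrite !ffunE kvK scale_regular mulrC eq_sym.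
have LvE j : Lv (bv j) = (k j)^-1 *: bv j.
  by rewrite rmul_bvec; apply/ffunP => a; rewrite !ffunE rhoK_kv scale_regular mulrC eq_sym.
have KdE j : Kd (bv j) = (k j)^-1 *: bv j.
  rewrite lmul_bvec; apply/ffunP => a; rewrite !ffunE rhoK_kv scale_regular mulrC.
  by case: eqVneq => [->|]; rewrite ?mulr0.
have LdE j : Ld (bv j) = k j *: bv j.
  rewrite lmul_bvec; apply/ffunP => a; rewrite !ffunE kvK scale_regular mulrC.
  by case: eqVneq => [->|]; rewrite ?mulr0.
have tens_diag (F G : 'End(vec K I)) (e e' : I -> K) :
    (forall j, F (bv j) = e j *: bv j) -> (forall j, G (bv j) = e' j *: bv j) ->
    forall a b, tens_hom F G (bv (a, b)) = (e a * e' b) *: bv (a, b).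
  move=> FE GE a b'; rewrite tens_hom_bvec FE GE tens_bvZl tens_bvZr tens_bvec.
  by rewrite scalerA.
have vecMD (C C' : M) : vecM (C + C') = vecM C + vecM C' by exact: linearD.
apply: (@q_bracket_ActM Xv Kv Lv Xd Kd Ld).
- by move=> C; rewrite vecMD !vecM_mul add_lfunE.
- by move=> C; rewrite vecM_mul.
- by move=> C; rewrite vecM_mul.
- apply: tau_VV_comm.
  apply: (hecke_twisted_coprod (lt := fun a b : I => (a < b)%N) _ XvE KvE LvE xy nzk erefl ky
    k1 lt_yx _ qE); first exact: S_VV_bvec.
  by move=> a ax ay; rewrite lt_other ?lt_other'.
- by apply: (tau_VV_diag s (tens_diag _ _ _ _ KvE KvE)) => a b'; rewrite mulrC.
- apply: tau_DD_comm.
  (* For V* the order is reversed, x and y are exchanged and the eigenvalues are inverted. *)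
  apply: (hecke_twisted_coprod (lt := fun a b : I => (b < a)%N) (c := 1) (kappa := kappa)
    (k := fun a => (k a)^-1) (x := y) (y := x) (q := q)); rewrite ?ky ?invrK // 1?eq_sym //.
  + exact: S_DD_bvec.
  + by move=> j; rewrite mul1r XdE.
  + by move=> j; rewrite invrK LdE.
  + by move=> a ay ax; rewrite k1 ?invr1.
  + by move=> a ay ax; rewrite lt_other ?lt_other'.
- by apply: (tau_DD_diag s (tens_diag _ _ _ _ LdE LdE)) => a b'; rewrite mulrC.
- exact: (tau_VD_twisted_coprod nzs XvE XdE KvE LvE KdE LdE xy nzk erefl ky k1 lt_yx lt_other qE).
- apply: (tau_VD_diag s (tens_diag _ _ _ _ KvE KdE) (z := 1)) => [a b'|a].
    by rewrite (tens_diag _ _ _ _ KdE KvE) mulrC.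
  by rewrite divff // kv_neq0.
- apply: (tau_VD_diag s (tens_diag _ _ _ _ LvE LdE) (z := 1)) => [a b'|a].
    by rewrite (tens_diag _ _ _ _ LdE LvE) mulrC.
  by rewrite mulVf // kv_neq0.
- by move=> C; rewrite trace_actX.
move=> C; rewrite mxtrace_mulC mulmxA.
have -> : rhoKV n s i *m rhoK n s i = 1%:M.
  apply/matrixP => a b'; rewrite !mxE (bigD1 a) //= kvK rhoK_kv eqxx mul1r mulrCA.
  rewrite divff ?kv_neq0 // mulr1 big1 ?addr0 // => m /negPf am.
  by rewrite kvK eq_sym am !mul0r.
by rewrite mul1mx.
Qed.

Lemma q_bracket_actH i A B : (i.+1 < n)%N -> let b A B := q_bracket n s (tensM A B) in
  actH i (b A B) = b (actH i A) B + b A (actH i B).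
Proof.
move=> ni b.
pose Hv := rmul (- rhoH K n i); pose Hd := lmul (rhoH K n i); pose one := (\1%VF : 'End(vec K I)).
pose e (a : I) : K := (a == i :> nat)%:R - (a == i.+1 :> nat)%:R.
have HE (a b' : I) : rhoH K n i a b' = (a == b')%:R * e a.
  rewrite !mxE /e; have [<-|ab] := eqVneq a b'; first by rewrite !andbb mul1r.
  have ab' : (a == b' :> nat) = false by apply/negbTE; rewrite val_eqE.
  have ne z : ((a == z :> nat) && (b' == z :> nat)) = false.
    by case: eqP => //= az; case: eqP => // bz; move: ab'; rewrite az bz eqxx.
  by rewrite !ne subrr mul0r.
have HvE j : Hv (bv j) = - e j *: bv j.
  rewrite rmul_bvec; apply/ffunP => a; rewrite !ffunE mxE HE scale_regular.
  by rewrite eq_sym mulrC mulNr.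
have HdE j : Hd (bv j) = e j *: bv j.
  rewrite lmul_bvec; apply/ffunP => a; rewrite !ffunE HE scale_regular mulrC.
  by case: eqVneq => [->|]; rewrite ?mulr0.
have oneE j : one (bv j) = 1 *: bv j by rewrite id_lfunE scale1r.
have diagE (F G : 'End(vec K I)) (e1 e2 : I -> K) :
    (forall j, F (bv j) = e1 j *: bv j) -> (forall j, G (bv j) = e2 j *: bv j) ->
    forall a b', twisted_coprod F one one G (bv (a, b')) = (e1 a + e2 b') *: bv (a, b').
  move=> FE GE a b'; rewrite add_lfunE !tens_hom_bvec /= FE GE !id_lfunE.
  by rewrite tens_bvZl tens_bvZr tens_bvec scalerDl.
have comm1 (F : 'End(VV K n)) : (F \o tens_hom one one = tens_hom one one \o F)%VF.
  by apply/lfunP => u; rewrite !comp_lfunE !tens_hom_id.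
have one_rmul : rmul 1%:M = one.
  by apply: hom_vec_ext => j; rewrite rmul_bvec id_lfunE; apply/ffunP => a; rewrite !ffunE mxE eq_sym.
have one_lmul : lmul 1%:M = one.
  by apply: hom_vec_ext => j; rewrite lmul_bvec id_lfunE; apply/ffunP => a; rewrite !ffunE mxE.
have vecMD (C C' : M) : vecM (C + C') = vecM C + vecM C' by exact: linearD.
(* H_i is primitive: the group-like factors K and L are the identity. *)
apply: (@q_bracket_ActM Hv one one Hd one one (actH i) id id).
- move=> C; rewrite vecMD -[C *m _]mul1mx -[rhoH _ _ _ *m C]mulmx1 mulmxA !vecM_mul.
  by rewrite one_rmul one_lmul add_lfunE.
- by move=> C; rewrite tens_hom_id.
- by move=> C; rewrite tens_hom_id.
- by apply: (tau_VV_diag s (diagE _ _ _ _ HvE HvE)) => a b'; rewrite addrC.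
- exact: comm1.
- by apply: (tau_DD_diag s (diagE _ _ _ _ HdE HdE)) => a b'; rewrite addrC.
- exact: comm1.
- apply: (tau_VD_diag s (diagE _ _ _ _ HvE HdE) (z := 0)) => [a b'|a].
    by rewrite (diagE _ _ _ _ HdE HvE) addrC.
  by rewrite addNr.
- exact: comm1.
- exact: comm1.
- by move=> C; rewrite trace_actH.
by [].
Qed.

End BracketEquivariance.

(** * The isomorphism *)

Section KLinear.
Variable K : fieldType.

(** A [kalgebra] carries no module structure; its scalars act by multiplication with the central
    elements [kalg_scalar]. *)
Definition klinear (V : lmodType K) (B : kalgebra K) (F : V -> B) : Prop :=
  forall a x y, F (a *: x + y) = kalg_scalar B a * F x + F y.

Section Basic.
Variables (V : lmodType K) (B : kalgebra K) (F : V -> B).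
Hypothesis Fl : klinear F.

Lemma klinearD x y : F (x + y) = F x + F y.
Proof. by rewrite -[x]scale1r Fl rmorph1 mul1r scale1r. Qed.

Lemma klinear0 : F 0 = 0.
Proof. by apply: (addrI (F 0)); rewrite -klinearD !addr0. Qed.

Lemma klinearZ a x : F (a *: x) = kalg_scalar B a * F x.
Proof. by rewrite -[a *: x]addr0 Fl klinear0 addr0. Qed.

Lemma klinearN x : F (- x) = - F x.
Proof. by apply: (addrI (F x)); rewrite -klinearD !subrr klinear0. Qed.

Lemma klinear_sum (J : Type) (r : seq J) (P : pred J) (f : J -> V) :
  F (\sum_(i <- r | P i) f i) = \sum_(i <- r | P i) F (f i).
Proof. exact: (big_morph F klinearD klinear0). Qed.

End Basic.

Lemma klinear_morph (V : lmodType K) (B B' : kalgebra K) (F : V -> B)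
    (f : {rmorphism B -> B'}) : klinear F -> kalg_morphism f -> klinear (f \o F).
Proof. by move=> Fl fK a x y; rewrite /= Fl rmorphD rmorphM fK. Qed.

Lemma klinear_comp (V W : vectType K) (B : kalgebra K) (F : W -> B) (f : 'Hom(V, W)) :
  klinear F -> klinear (F \o f).
Proof. by move=> Fl a x y; rewrite /= !hom_linE Fl. Qed.

Lemma klinear_add (V : lmodType K) (B : kalgebra K) (F G : V -> B) :
  klinear F -> klinear G -> klinear (fun x => F x + G x).
Proof. by move=> Fl Gl a x y; rewrite Fl Gl mulrDr addrACA. Qed.

Lemma klinear_scale (V : lmodType K) (B : kalgebra K) (F : V -> B) b :
  klinear F -> klinear (fun x => kalg_scalar B b * F x).
Proof.
move=> Fl a x y; rewrite Fl mulrDr; congr (_ + _).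
by rewrite mulrA -rmorphM [b * a]mulrC rmorphM mulrA.
Qed.

Lemma klinear_form (V : vectType K) (B : kalgebra K) (f : V -> K) b :
  linear_form f -> klinear (fun x => kalg_scalar B (b * f x)).
Proof.
by move=> fl a x y; rewrite -rmorphM -rmorphD fl; congr (kalg_scalar B _); ring.
Qed.
Lemma klinear_vec_ext (J : finType) (B : kalgebra K) (F G : vec K J -> B) :
  klinear F -> klinear G -> (forall x, F (bvec K x) = G (bvec K x)) -> F =1 G.
Proof.
move=> Fl Gl FG u; rewrite [u]vec_sum !klinear_sum //; apply: eq_bigr => x _.
by rewrite !klinearZ // FG.
Qed.

Lemma klinear_span_ext (V : vectType K) (B : kalgebra K) (F G : V -> B) (X : seq V) :
  klinear F -> klinear G -> (forall x, x \in X -> F x = G x) ->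
  forall u, u \in <<X>>%VS -> F u = G u.
Proof.
move=> Fl Gl FG u /(@coord_span _ _ _ (in_tuple X)) ->.
rewrite !klinear_sum //; apply: eq_bigr => i _.
by rewrite !klinearZ // FG // mem_nth.
Qed.

End KLinear.

Section Monomials.
Variables (K : fieldType) (n : nat) (B : kalgebra K).
Local Notation I := 'I_n.
Local Notation M := 'M[K]_n.
Local Notation MM := (MM K n).
Variable v : I * I -> B.

Definition lin1 (A : M) : B := \sum_x kalg_scalar B (A x.2 x.1) * v x.
Definition lin2 (u : MM) : B := \sum_x kalg_scalar B (u x) * (v x.1 * v x.2).

Lemma lin1_klinear : klinear lin1.
Proof.
move=> a A A'; rewrite /lin1 mulr_sumr -big_split; apply: eq_bigr => x _ /=.
by rewrite !mxE rmorphD rmorphM mulrDl mulrA.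
Qed.

Lemma lin2_klinear : klinear lin2.
Proof.
move=> a A A'; rewrite /lin2 mulr_sumr -big_split; apply: eq_bigr => x _ /=.
by rewrite !ffunE scale_regular rmorphD rmorphM mulrDl -mulrA.
Qed.

Lemma lin2_bvec x : lin2 (bvec K x) = v x.1 * v x.2.
Proof.
rewrite /lin2 (bigD1 x) //= big1 ?addr0 => [|y /negPf yx].
  by rewrite ffunE eqxx rmorph1 mul1r.
by rewrite ffunE yx rmorph0 mul0r.
Qed.

Lemma lin1_munit i j : lin1 (munit K n (i : I) (j : I)) = v (j, i).
Proof.
rewrite /lin1 (bigD1 (j, i)) //= big1 ?addr0 => [|[a b] ab].
  by rewrite mxE !eqxx rmorph1 mul1r.
rewrite mxE /= (_ : (b == i :> nat) && (a == j :> nat) = false) ?rmorph0 ?mul0r //.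
by apply: contraNF ab => /andP[/eqP/val_inj -> /eqP/val_inj ->].
Qed.

Lemma lin2_tensM A A' : lin2 (tensM A A') = lin1 A * lin1 A'.
Proof.
rewrite /lin1 big_distrlr /= pair_bigA; apply: eq_bigr => x _ /=.
rewrite !ffunE rmorphM -!mulrA; congr (_ * _).
by rewrite mulrA kalg_central -mulrA.
Qed.

End Monomials.

Lemma lin1_morph (K : fieldType) n (B B' : kalgebra K) (f : {rmorphism B -> B'})
    (v : 'I_n * 'I_n -> B) A : kalg_morphism f -> f (lin1 v A) = lin1 (f \o v) A.
Proof. by move=> fK; rewrite rmorph_sum; apply: eq_bigr => x _; rewrite rmorphM fK. Qed.

Lemma lin2_morph (K : fieldType) n (B B' : kalgebra K) (f : {rmorphism B -> B'})
    (v : 'I_n * 'I_n -> B) u : kalg_morphism f -> f (lin2 v u) = lin2 (f \o v) u.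
Proof. by move=> fK; rewrite rmorph_sum; apply: eq_bigr => x _; rewrite !rmorphM fK. Qed.

(** * The reflection equation as the antisymmetric quadratic relations *)

Section REalgebra.
Variables (K : fieldType) (n : nat) (s : K).
Local Notation q := (q n s).
Local Notation w := (omega n s).
Local Notation h := (q + q^-1).
Local Notation I := 'I_n.
Local Notation M := 'M[K]_n.
Local Notation MM := (MM K n).
Local Notation bv := (bvec K).
Local Notation P := (opP n s).
Local Notation Q := (opQ n s).
Hypothesis nzs : s != 0.
Hypothesis nz2 : 2 != 0 :> K.
Hypothesis nzqp : q * q + 1 != 0.

Let nzq : q != 0. Proof. by rewrite expf_neq0. Qed.
Let nzqr : q_root s != 0. Proof. by rewrite expf_neq0. Qed.

Section Generators.
Variables (B : kalgebra K) (v : I * I -> B).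

(** The image of [L2] under L^d_c |-> v (c, d); the order (c, d) is that of e_c (x) f^d. *)
Definition gen2 : mat2 n B := fun x y =>
  let: (a, c) := x in let: (b, d) := y in if a == b then v (c, d) else 0.
Definition S2 : mat2 n B := fun x y => kalg_scalar B (Smat s x y).

Local Notation LSL := (mat2_mul (mat2_mul gen2 S2) gen2).

Lemma mat2_mulA (A : pzRingType) (F G H : mat2 n A) x y :
  mat2_mul (mat2_mul F G) H x y = mat2_mul F (mat2_mul G H) x y.
Proof.
rewrite /mat2_mul.
under eq_bigr => z _ do rewrite mulr_suml.
rewrite exchange_big; apply: eq_bigr => z _ /=.
by rewrite mulr_sumr; apply: eq_bigr => t _; rewrite mulrA.
Qed.

Lemma big_pairE (J J' : finType) (A : nmodType) (F : J * J' -> A) :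
  \sum_y F y = \sum_a \sum_b F (a, b).
Proof. by rewrite pair_bigA; apply: eq_bigr => -[]. Qed.

(** The matrix S between the two copies of L contracts the neighbouring indices exactly as q^(1/n)
    [tau_VD] crosses the middle factors. *)
Lemma LSL_Phi (a c b d : I) :
  LSL (a, c) (b, d) = lin2 v (q_root s *: Phi n s (bv ((c, a), (b, d)))).
Proof.
have -> : LSL (a, c) (b, d) = \sum_c' \sum_d'
    kalg_scalar B (Smat s (a, c') (b, d')) * (v (c, c') * v (d', d)).
  rewrite mat2_mulA /mat2_mul big_pairE.
  rewrite (bigD1 a) //= [X in _ + X]big1 ?addr0 => [|a' /negPf aa']; last first.
    by apply: big1 => c' _; rewrite eq_sym aa' mul0r.
  apply: eq_bigr => c' _; rewrite eqxx.
  rewrite big_pairE.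
  rewrite (bigD1 b) //= [X in _ + X]big1 ?addr0 => [|b' /negPf bb']; last first.
    by apply: big1 => d' _; rewrite bb' mulr0.
  rewrite mulr_sumr; apply: eq_bigr => d' _; rewrite eqxx /S2.
  by rewrite mulrA -kalg_central mulrA.
have lin2l := lin2_klinear v.
rewrite Phi_bvec; have [->|ba] := eqVneq b a.
  rewrite scalerA divff // scale1r (klinearD lin2l) !(klinearZ lin2l) (klinear_sum lin2l).
  rewrite lin2_bvec /=; pose T k := v (c, k) * v (k, d).
  rewrite (_ : \sum_(k < n | (a < k)%N) _ = \sum_(k < n | (a < k)%N) T k); last first.
    by apply: eq_bigr => k _; rewrite lin2_bvec.
  transitivity (\sum_c' (kalg_scalar B (q * (c' == a)%:R) * T c'
    + kalg_scalar B (w * (a < c')%:R) * T c')).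
    apply: eq_bigr => c' _; rewrite (bigD1 c') //= big1 ?addr0 => [|d' dc'].
      by rewrite /Smat !eqxx /= addr0 andbT -mulrDl -rmorphD [c' == a]eq_sym.
    by rewrite /Smat eqxx [c' == d']eq_sym (negPf dc') /= !andbF !mulr0 !addr0 rmorph0 mul0r.
  rewrite big_split /= (bigD1 a) //= big1 ?addr0 => [|k /negPf ka]; last first.
    by rewrite ka mulr0 rmorph0 mul0r.
  rewrite eqxx mulr1 mulr_sumr [in RHS]big_mkcond; congr (_ + _).
  by apply: eq_bigr => k _; case: ifP => _; rewrite ?mulr1 ?mulr0 ?rmorph0 ?mul0r.
have ab : (a == b) = false by rewrite eq_sym (negPf ba).
rewrite scalerA divff // scale1r lin2_bvec (bigD1 b) //= (bigD1 a) //=.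
rewrite big1 ?addr0 => [|d' /negPf da]; last first.
  by rewrite /Smat ab eqxx da /= !mulr0 !addr0 rmorph0 mul0r.
rewrite big1 ?addr0 => [|c' /negPf cb]; last first.
  by apply: big1 => d' _; rewrite /Smat ab cb /= !mulr0 !addr0 rmorph0 mul0r.
by rewrite /Smat ab !eqxx /= !mulr0 add0r addr0 rmorph1 mul1r.
Qed.

Lemma sum_bvec (J : finType) (c : J -> K) (y : J) :
  (\sum_x c x *: bv x : vec K J) y = c y.
Proof.
rewrite sum_ffunE (bigD1 y) //= big1 ?addr0 => [|x /negPf xy].
  by rewrite !ffunE eqxx scale_regular mulr1.
by rewrite !ffunE eq_sym xy scaler0.
Qed.

Lemma S_DD_Smat (z : I * I) : S_DD n s (bv z) = \sum_y Smat s y z *: bv y.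
Proof.
apply/ffunP => -[p1 p2]; rewrite (sum_bvec (fun y => Smat s y z)).
case: z => b d; rewrite S_DD_bvec //.
case: (eqVneq b d) => [->|bd]; rewrite !ffunE ?scale_regular !xpair_eqE /Smat.
  case: (eqVneq p1 d) => [->|p1d] /=; last by rewrite ?andbF /=; ring.
  by case: (eqVneq p2 d) => [->|p2d] /=; rewrite ?ltnn ?eqxx ?andbF //=; ring.
case: (eqVneq p1 b) => [->|p1b] /=.
  by rewrite (negPf bd) /=; case: (eqVneq p2 d) => [->|p2d] /=; rewrite ?andbF ?(negPf bd) /=; ring.
by rewrite [d == p1]eq_sym andbC /=; ring.
Qed.

Lemma S_VV_Smat (a c : I) : S_VV n s (bv (c, a)) = \sum_y Smat s (a, c) y *: bv (y.2, y.1).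
Proof.
rewrite (reindex (fun y : I * I => (y.2, y.1))) /=; last first.
  by exists (fun y => (y.2, y.1)) => -[].
apply/ffunP => -[p1 p2].
rewrite (eq_bigr (fun y : I * I => Smat s (a, c) (y.2, y.1) *: bv y)); last by case.
rewrite (sum_bvec (fun y => Smat s (a, c) (y.2, y.1))).
rewrite S_VV_bvec //.
case: (eqVneq c a) => [->|ca]; rewrite !ffunE ?scale_regular !xpair_eqE /Smat /=.
  by case: (eqVneq p2 a) => _ /=; case: (eqVneq p1 a) => _ /=; rewrite ?ltnn ?andbF /=; ring.
case: (eqVneq p2 c) => [->|_] /=.
  by rewrite [a == c]eq_sym (negPf ca) ?andbF ?andbT /=; ring.
by case: (eqVneq p2 a) => _ /=; case: (eqVneq p1 c) => _; rewrite ?andbF /=; case: (a < c)%N => /=; ring.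
Qed.

Lemma tens_sumr (J J' X : finType) (u : vec K J) (c : X -> K) (f : X -> vec K J') :
  tens u (\sum_x c x *: f x) = \sum_x c x *: tens u (f x).
Proof.
apply/ffunP => y; rewrite ffunE !sum_ffunE mulr_sumr; apply: eq_bigr => x _.
by rewrite !ffunE !scale_regular mulrCA.
Qed.

Lemma tens_suml (J J' X : finType) (u : vec K J') (c : X -> K) (f : X -> vec K J) :
  tens (\sum_x c x *: f x) u = \sum_x c x *: tens (f x) u.
Proof.
apply/ffunP => y; rewrite ffunE !sum_ffunE mulr_suml; apply: eq_bigr => x _.
by rewrite !ffunE !scale_regular mulrA.
Qed.

Definition RE_element (x z : I * I) : B :=
  mat2_mul LSL S2 x z
    - mat2_mul (mat2_mul (mat2_mul S2 gen2) S2) gen2 x z.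

(** Right multiplication by S acts on the column indices, the V*-factors, as [S_DD]; left
    multiplication acts on the row indices, the V-factors, as [S_VV]. Their [omega] terms cancel in
    the difference, which leaves (h/2)(Q - P). *)
Lemma RE_elementE (a c : I) (z : I * I) :
  RE_element (a, c) z = lin2 v ((q_root s * h / 2)
    *: (Q (Phi n s (bv ((c, a), z))) - P (Phi n s (bv ((c, a), z))))).
Proof.
have lin2l := lin2_klinear v.
have qhE : forall u, (q_root s * h / 2) *: (Q (Phi n s u) - P (Phi n s u))
    = q_root s *: Phi n s (tens_hom \1%VF (S_DD n s) u)
      - q_root s *: Phi n s (tens_hom (S_VV n s) \1%VF u).
  move=> u; rewrite opPE opQE PsiK // S_DD_unlock S_VV_unlock !scalerDr !scalerA.
  rewrite tens_hom_scaleDl tens_hom_scaleDr !hom_linE.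
  by apply: vect_form_ext => f fl; rewrite !(linear_formE fl); field; rewrite nz2 nzq.
have termE x u : lin2 v (q_root s *: Phi n s (x *: u))
    = kalg_scalar B x * lin2 v (q_root s *: Phi n s u).
  by rewrite hom_linE scalerA mulrC -scalerA (klinearZ lin2l).
rewrite qhE (klinearD lin2l) (klinearN lin2l) !tens_hom_bvec /= !id_lfunE.
rewrite S_DD_Smat S_VV_Smat tens_sumr tens_suml !hom_sum !scaler_sumr !(klinear_sum lin2l).
congr (_ - _).
  by apply: eq_bigr => -[b d] _; rewrite LSL_Phi termE tens_bvec kalg_central.
rewrite mat2_mulA mat2_mulA [LHS]/mat2_mul; apply: eq_bigr => -[b d] _.
by case: z => b' d'; rewrite -mat2_mulA LSL_Phi termE tens_bvec.
Qed.

End Generators.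

Lemma anti_QP u : tau_RE n s (Q u - P u) = - (Q u - P u).
Proof.
rewrite tau_RE_PQ // !hom_linE opQ_involution // -opPQ // opP_involution //.
by rewrite opprB.
Qed.

Definition Lg (x : I * I) : L_algebra K n := Lgen K x.2 x.1.

Lemma RE_relationsP r : RE_relations s r ->
  exists2 u, tau_RE n s u = - u & r = lin2 Lg u.
Proof.
move=> [[a c] [z ->]].
exists ((q_root s * h / 2) *: (Q (Phi n s (bv ((c, a), z))) - P (Phi n s (bv ((c, a), z))))).
  by rewrite hom_linE anti_QP scalerN.
exact: (RE_elementE Lg).
Qed.

Lemma quot_RE_anti u : tau_RE n s u = - u -> quot_pi (RE_relations s) (lin2 Lg u) = 0.
Proof.
move=> au; have lin2l := lin2_klinear Lg.
have Qu : Q u = - P u.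
  by have := congr1 P au; rewrite tau_RE_PQ // opP_involution // hom_linE.
have nzh : h != 0.
  have -> : h = (q * q + 1) / q by field.
  by rewrite mulf_neq0 ?invr_eq0.
have nzc : q_root s * h / 2 != 0 by rewrite !mulf_neq0 ?invr_eq0.
(* For antisymmetric [u] one has Q P u = - u, so Q v - P v is proportional to [u] when [v] is a
   multiple of [P u]; the scalar is adjusted accordingly. *)
pose v := (- (2^-1 / (q_root s * h / 2))) *: P u.
have -> : u = (q_root s * h / 2) *: (Q v - P v).
  rewrite /v !hom_linE -opPQ // Qu hom_linE opP_involution //.
  by apply: vect_form_ext => f fl; rewrite !(linear_formE fl); field; rewrite nz2 nzqr nzq nzqp.
(* Since [Phi] is onto, [v] is a combination of the images of basis vectors, and each of these
   yields a defining relation. *)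
rewrite -[v](PhiK nzs) [Psi n s v]vec_sum !hom_sum -sumrB scaler_sumr.
rewrite (klinear_sum lin2l) rmorph_sum big1 // => -[[c a] z] _.
rewrite !hom_linE -scalerBr scalerA mulrC -scalerA (klinearZ lin2l) -(RE_elementE Lg).
rewrite rmorphM [X in _ * X]quot_pi_rel ?mulr0 //.
by exists (a, c), z.
Qed.

End REalgebra.

(** * Comparison of the two sets of relations under the shift of L *)

Section Isomorphism.
Variables (K : fieldType) (n : nat) (s : K).
Local Notation q := (q n s).
Local Notation w := (omega n s).
Local Notation I := 'I_n.
Local Notation M := 'M[K]_n.
Local Notation MM := (MM K n).
Local Notation bv := (bvec K).
Local Notation mu := (munit K n).
Local Notation D := (Dmx n s).
Local Notation tDl := (tensDl n s).
Local Notation tDr := (tensDr n s).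
Local Notation trL := (trL K n).
Local Notation trR := (trR K n).
Local Notation tau := (tau_RE n s).
Local Notation pp := (gg_proj n s).
Local Notation br := (q_bracket n s).
Hypothesis nzs : s != 0.
Hypothesis nz2 : 2 != 0 :> K.
Hypothesis nzqm : q * q - 1 != 0.
Hypothesis nzqp : q * q + 1 != 0.
Hypothesis nzq4 : q ^+ 4 + 1 != 0.
Hypothesis nztD : TrqId n s != 0.
Variable g : {vspace M}.
Hypothesis gE : forall A, (A \in g) = (\tr A == 0).
Variable lambda : K.
Local Notation t0 := (lambda * (w / TrqId n s)).
Local Notation sc C := (kalg_scalar C).

Let nzq : q != 0. Proof. by rewrite expf_neq0. Qed.
Let nztrD : \tr D != 0. Proof. by rewrite trace_D. Qed.
Let nzw : w != 0.
Proof.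
have -> : w = (q * q - 1) / q by rewrite /omega; field.
by rewrite mulf_neq0 ?invr_eq0.
Qed.

Definition on_munit (C : kalgebra K) (k : M -> C) (x : I * I) : C := k (mu x.2 x.1).

Lemma lin1_on_munit (C : kalgebra K) (k : M -> C) X : klinear k -> lin1 (on_munit k) X = k X.
Proof.
move=> kl; rewrite [in RHS](mx_sum_munit X) (klinear_sum kl).
by apply: eq_bigr => x _; rewrite (klinearZ kl).
Qed.

Lemma lin2_on_munit (C : kalgebra K) (k : M -> C) X Y : klinear k ->
  lin2 (on_munit k) (tensM X Y) = k X * k Y.
Proof. by move=> kl; rewrite lin2_tensM !lin1_on_munit. Qed.

(** The relations are stated for values in an arbitrary algebra, so that the two quotients can be
    compared by their universal properties. *)
Definition RE_family (C : kalgebra K) (v : I * I -> C) : Prop :=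
  lin1 v D = sc C lambda /\ forall u, tau u = - u -> lin2 v u = 0.

Definition S_family (C : kalgebra K) (k : M -> C) : Prop :=
  klinear k /\ forall X Y, X \in g -> Y \in g ->
  k X * k Y - lin2 (on_munit k) (tau_tilde s g (tensM X Y)) = sc C t0 * k (br (tensM X Y)).

(** [pp v] lies in the (-1)-eigenspace of [tau_tilde], so the relation reads 2 (pp v) = t0 [pp v].
    [q_bracket_anti] evaluates the bracket, and its denominator [omega] cancels against [t0]. *)
Lemma S_family_antisym (C : kalgebra K) (k : M -> C) : S_family k ->
  forall v, tau v = - v ->
  lin2 (on_munit k) (pp v) = - sc C (lambda / \tr D) * k (trL v + trR v).
Proof.
move=> [kl kS] v av; have l2 := lin2_klinear (on_munit k).
have kSu u : u \in tens_vs g g ->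
    lin2 (on_munit k) u - lin2 (on_munit k) (tau_tilde s g u) = sc C t0 * k (br u).
  move=> ug; pose F x := lin2 (on_munit k) x + sc C (-1) * lin2 (on_munit k) (tau_tilde s g x).
  have FE x : lin2 (on_munit k) x - lin2 (on_munit k) (tau_tilde s g x) = F x.
    by rewrite /F rmorphN rmorph1 mulN1r.
  rewrite FE; apply: (klinear_span_ext (F := F) (G := fun x => sc C t0 * k (br x)) _ _ _ ug).
  - by apply: klinear_add => //; apply: klinear_scale; apply: (klinear_comp _ l2).
  - by apply: klinear_scale; apply: (klinear_comp _ kl).
  move=> x /allpairsP[[X Y] /= [Xg Yg ->]]; rewrite -FE lin2_on_munit //.
  by apply: kS; apply: vbasis_mem.
have pg : pp v \in tens_vs g g by rewrite gg_proj_in.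
have pa : pp v \in asym_gg s g by apply/asym_ggP => //; exists v.
have := kSu _ pg.
have -> : tau_tilde s g (pp v) = - pp v.
  by rewrite -{1}[pp v]add0r (tau_tilde_split nzs nz2 nzqm nzqp nzq4 nztD gE) ?mem0v ?sub0r.
rewrite (klinearN l2) opprK q_bracket_anti // (klinearZ kl) mulrA -rmorphM => e.
have e2 : sc C 2 * lin2 (on_munit k) (pp v) = lin2 (on_munit k) (pp v) + lin2 (on_munit k) (pp v).
  by rewrite -[2]/(1 + 1) rmorphD rmorph1 mulrDl mul1r.
have half : sc C 2^-1 * sc C 2 = 1 by rewrite -rmorphM mulVf // rmorph1.
rewrite -[LHS]mul1r -half -mulrA e2 e mulrA -rmorphM -rmorphN.
by congr (sc C _ * _); rewrite trace_D; field; rewrite nztD nzw nz2.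
Qed.

Definition piM (X : M) : M := X - ((\tr D)^-1 * \tr X) *: D.

Lemma piM_linear a X Y : piM (a *: X + Y) = a *: piM X + piM Y.
Proof.
by rewrite /piM linearP; vect_linear; ring.
Qed.

Lemma piMZ a X : piM (a *: X) = a *: piM X.
Proof. by rewrite /piM mxtraceZ scalerBr scalerA mulrCA. Qed.

Lemma piM_id X : \tr X = 0 -> piM X = X.
Proof. by move=> trX; rewrite /piM trX mulr0 scale0r subr0. Qed.

Lemma piM_in X : piM X \in g.
Proof. by rewrite gE /piM linearB linearZ /= mulrAC mulVf // mul1r subrr. Qed.

(* L = L_0 + lambda / Tr_q(Id), with L_0 the component in g. *)
Definition shifted (C : kalgebra K) (k : M -> C) (X : M) : C :=
  k (piM X) + sc C (lambda / \tr D * \tr X).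

Lemma shifted_klinear (C : kalgebra K) (k : M -> C) : klinear k -> klinear (shifted k).
Proof.
move=> kl; apply: klinear_add; last exact: klinear_form (@trace_form K n).
by move=> a X Y; rewrite piM_linear kl.
Qed.

(** The product of two shifted entries expands into a quadratic term in [pp u], a linear term in trL
    u + trR u and a constant tr (trL u). For antisymmetric [u] the constant vanishes, and the other
    two cancel by [S_family_antisym]. *)
Lemma shifted_RE_family (C : kalgebra K) (k : M -> C) :
  S_family k -> RE_family (on_munit (shifted k)).
Proof.
move=> kS; have [kl _] := kS; have sl := shifted_klinear kl.
have l2 := lin2_klinear (on_munit k).
split.
  rewrite lin1_on_munit // /shifted divfK // /piM mulVf // scale1r subrr.
  by rewrite (klinear0 kl) add0r.
move=> u au.
pose F (u : MM) : C := lin2 (on_munit k) (pp u)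
  + (sc C (lambda / \tr D) * k (piM (trL u + trR u))
     + sc C ((lambda / \tr D) ^+ 2 * \tr (trL u))).
have lin2F : lin2 (on_munit (shifted k)) =1 F.
  apply: klinear_vec_ext; first exact: lin2_klinear.
    apply: klinear_add; first exact: (klinear_comp _ l2).
    apply: klinear_add.
      apply: klinear_scale => a x y.
      by rewrite !hom_linE addrACA -scalerDr piM_linear kl.
    apply: klinear_form => a x y; rewrite !hom_linE; exact: trace_form.
  move=> [[j i] [l m]]; rewrite -tensM_munit lin2_on_munit //.
  move: (mu i j) (mu m l) => X Y.
  rewrite /F gg_proj_tensM // -[X - _]/(piM X) -[Y - _]/(piM Y).
  rewrite lin2_on_munit // trL_tens trR_tens piM_linear kl piMZ (klinearZ kl) mxtraceZ.
  rewrite /shifted mulrDl !mulrDr -!addrA; congr (_ + _).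
  rewrite -kalg_central !mulrA -!rmorphM addrCA.
  by congr (_ + (_ + _)); congr (sc C _); ring.
have tr0 := trace_trL_anti nzs nz2 nzqp au.
rewrite lin2F /F S_family_antisym // tr0 mulr0 rmorph0 addr0.
rewrite piM_id ?mulNr ?addNr // linearD /= -trace_trL_trR tr0.
by rewrite addr0.
Qed.

Lemma lin1_tensDl (C : kalgebra K) (v : I * I -> C) X : RE_family v ->
  lin2 v (tDl X) = sc C lambda * lin1 v X /\ lin2 v (tDr X) = sc C lambda * lin1 v X.
Proof.
by move=> [vD _]; rewrite -tensM_Dl -tensM_Dr !lin2_tensM vD kalg_central.
Qed.

(** On the symmetric part of [u] both sides vanish. On the rest, [pp x], the left side is twice the
    value of [pp x]; there [x] itself is a relation, and each factor D in the correction terms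
    becomes [lambda]. *)
Lemma RE_family_S_relation (C : kalgebra K) (v : I * I -> C) u : RE_family v ->
  u \in tens_vs g g ->
  lin2 v u - lin2 v (tau_tilde s g u) = sc C t0 * lin1 v (br u).
Proof.
move=> vRE ug; have [_ vA] := vRE.
have l1 := lin1_klinear v; have l2 := lin2_klinear v.
have gu : in_gg trL trR u by apply/(tens_vs_ggP nztD gE).
have [x xa xs] := sym_asym_split nzs nz2 nzqm nzqp nzq4 nztD gE gu.
have xg : pp x \in asym_gg s g by apply/(asym_ggP nzs nz2 nzqp nztD gE); exists x.
rewrite -{1 2 3}[u](subrK (pp x)) (tau_tilde_split nzs nz2 nzqm nzqp nzq4 nztD gE) //.
rewrite hom_linE (q_bracket_sym nzs nztD gE) // add0r q_bracket_anti //.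
rewrite (klinearD l2 (u - pp x)) (klinearD l2 (u - pp x)) (klinearN l2) opprD opprK addrACA subrr add0r.
rewrite gg_proj_anti // (klinearD l2) (klinearN l2) (klinearZ l2) (klinearD l2) vA // sub0r.
have [-> _] := lin1_tensDl (trL x) vRE; have [_ ->] := lin1_tensDl (trR x) vRE.
rewrite -mulrDr -(klinearD l1) (klinearZ l1) !mulrA -!rmorphM -mulNr -rmorphN -mulrDl -rmorphD.
by congr (sc C _ * _); rewrite trace_D; field; rewrite nztD nzw.
Qed.

Definition g_basis (i : 'I_(\dim g)) : M := (vbasis g)`_i.

Definition RE_presentation (A : kalgebra K) (LA : I * I -> A) : Prop :=
  [/\ RE_family LA,
      forall (C : kalgebra K) (v : I * I -> C), RE_family v ->
        exists f : {rmorphism A -> C}, kalg_morphism f /\ forall x, f (LA x) = v x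
    & forall (C : kalgebra K) (f f' : {rmorphism A -> C}), kalg_morphism f ->
        kalg_morphism f' -> (forall x, f (LA x) = f' (LA x)) -> f =1 f'].

Definition S_presentation (B : kalgebra K) (jB : M -> B) : Prop :=
  [/\ S_family jB,
      forall (C : kalgebra K) (k : M -> C), S_family k ->
        exists f : {rmorphism B -> C},
          kalg_morphism f /\ forall X, X \in g -> f (jB X) = k X
    & forall (C : kalgebra K) (f f' : {rmorphism B -> C}), kalg_morphism f ->
        kalg_morphism f' -> (forall X, X \in g -> f (jB X) = f' (jB X)) -> f =1 f'].

(** Both composites fix the generators, hence are identities by the uniqueness clauses. On [LA] the
    scalar added by the shift cancels the one coming from lin1 LA D = lambda. *)
Lemma presentations_isomorphic (A B : kalgebra K) (LA : I * I -> A) (jB : M -> B) :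
  RE_presentation LA -> S_presentation jB -> kalg_isomorphic A B.
Proof.
move=> [LRE LU LE] [jS jU jE]; have [jl _] := jS.
have [f [fK fL]] := LU B _ (shifted_RE_family jS).
have l1 := lin1_klinear LA.
have l1S : S_family (lin1 LA).
  split=> // X Y Xg Yg.
  have l2E u : lin2 (on_munit (lin1 LA)) u = lin2 LA u.
    apply: (klinear_vec_ext (lin2_klinear _) (lin2_klinear _)) => x.
    by rewrite !lin2_bvec /on_munit !lin1_munit -!surjective_pairing.
  rewrite l2E -lin2_tensM; apply: RE_family_S_relation => //.
  exact: tensM_in.
have [f' [f'K f'j]] := jU A _ l1S.
have f_l1 X : f (lin1 LA X) = shifted jB X.
  rewrite lin1_morph // -(lin1_on_munit X (shifted_klinear jl)).
  by apply: eq_bigr => x _; rewrite /= fL.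
exists f; split; last exact: fK.
exists f'.
  pose h : {rmorphism A -> A} := (f' \o f)%FUN.
  pose idA : {rmorphism A -> A} := idfun.
  apply: (LE A h idA) => [a|a|x]; rewrite //= ?fK ?f'K //.
  rewrite fL /on_munit /shifted rmorphD f'K f'j ?piM_in //.
  rewrite /piM (klinearD l1) (klinearN l1) (klinearZ l1) lin1_munit -surjective_pairing.
  have [-> _] := LRE; rewrite -rmorphM -addrA -rmorphN -rmorphD.
  rewrite (_ : - _ + _ = 0) ?rmorph0 ?addr0 //; ring.
pose h : {rmorphism B -> B} := (f \o f')%FUN.
pose idB : {rmorphism B -> B} := idfun.
apply: (jE B h idB) => [a|a|X Xg]; rewrite //= ?f'K ?fK //.
rewrite f'j // f_l1 /shifted; have /eqP trX : \tr X == 0 by rewrite -gE.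
by rewrite piM_id // trX mulr0 rmorph0 addr0.
Qed.

End Isomorphism.

Section KQuotient.
Variables (K : fieldType) (A : kalgebra K) (X : set A).

Lemma kquot_hom (C : kalgebra K) (f : {rmorphism A -> C}) : kalg_morphism f ->
  (forall x, X x -> f x = 0) ->
  exists g : {rmorphism kquot X -> C}, kalg_morphism g /\ forall x, g (quot_pi X x) = f x.
Proof.
move=> fK fX; have [g gf] := quot_hom fX.
by exists g; split=> // a; rewrite -fK -gf.
Qed.

Lemma kquot_hom_eq (C : kalgebra K) (f g : {rmorphism kquot X -> C}) :
  (forall x, f (quot_pi X x) = g (quot_pi X x)) -> f =1 g.
Proof. by move=> fg y; have [x ->] := quot_pi_surj y. Qed.

End KQuotient.

Lemma rmorph_relator (A C : pzRingType) (f : {rmorphism A -> C}) a b c t d :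
  f (a * b - c - t * d) = f a * f b - f c - f t * f d.
Proof. by rewrite !rmorphB !rmorphM. Qed.

(** * The universal properties of the two quotient algebras *)

Section Presentations.
Variables (K : fieldType) (n : nat) (s : K).
Local Notation q := (q n s).
Local Notation w := (omega n s).
Local Notation I := 'I_n.
Local Notation M := 'M[K]_n.
Local Notation MM := (MM K n).
Local Notation mu := (munit K n).
Local Notation D := (Dmx n s).
Local Notation tau := (tau_RE n s).
Local Notation br := (q_bracket n s).
Hypothesis nzs : s != 0.
Hypothesis nz2 : 2 != 0 :> K.
Hypothesis nzqm : q * q - 1 != 0.
Hypothesis nzqp : q * q + 1 != 0.
Hypothesis nzq4 : q ^+ 4 + 1 != 0.
Hypothesis nztD : TrqId n s != 0.
Variable g : {vspace M}.
Hypothesis gE : forall A, (A \in g) = (\tr A == 0).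
Variable lambda : K.
Local Notation t0 := (lambda * (w / TrqId n s)).
Local Notation sc C := (kalg_scalar C).

Lemma lin1_D : lin1 (Lg K (n := n)) D
  = \sum_(i < n) kalg_scalar (L_algebra K n) (q ^- (2 * i)) * Lgen K i i.
Proof.
rewrite /lin1 big_pairE; apply: eq_bigr => j _ /=.
rewrite (bigD1 j) //= big1 ?addr0 => [|i ij].
  by have -> : D j j = q ^- (2 * j) by rewrite Dmx_diag eqxx mul1r.
by rewrite Dmx_diag (negPf ij) mul0r rmorph0 mul0r.
Qed.

Definition A_RE_gen (x : I * I) : A_RE_at n s lambda :=
  quot_pi [set TrqL n s - kalg_scalar (A_RE n s) lambda]%classic
    (quot_pi (RE_relations s) (Lg K x)).

Lemma A_RE_presentation : RE_presentation s lambda A_RE_gen.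
Proof.
pose X1 := RE_relations s (K := K) (n := n).
pose X2 := [set TrqL n s - kalg_scalar (A_RE n s) lambda]%classic.
pose p1 : {rmorphism L_algebra K n -> kquot X1} := quot_pi X1.
pose p2 : {rmorphism kquot X1 -> kquot X2} := quot_pi X2.
have p1K : kalg_morphism p1 by [].
have p2K : kalg_morphism p2 by [].
split.
- split.
    rewrite -[lin1 _ _](lin1_morph (f := p2) (p1 \o Lg K (n := n)) D p2K).
    rewrite -(lin1_morph (Lg K (n := n)) D p1K) lin1_D.
    apply/eqP; rewrite -subr_eq0 -[sc _ lambda]/(p2 (sc (A_RE n s) lambda)).
    by rewrite -rmorphB; apply/eqP/quot_pi_rel.
  move=> u au.
  rewrite -[lin2 _ _](lin2_morph (f := p2) (p1 \o Lg K (n := n)) u p2K).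
  by rewrite -(lin2_morph (Lg K (n := n)) u p1K) [p1 _]quot_RE_anti // rmorph0.
- move=> C v [vD vA].
  have [f0 [f0K f0v]] := free_algebra_hom (fun x : I * I => v (x.2, x.1)).
  have f0L x : f0 (Lg K x) = v x by rewrite f0v -surjective_pairing.
  have f0lin1 Y : f0 (lin1 (Lg K (n := n)) Y) = lin1 v Y.
    by rewrite lin1_morph //; apply: eq_bigr => x _; rewrite /= f0L.
  have f0lin2 u : f0 (lin2 (Lg K (n := n)) u) = lin2 v u.
    by rewrite lin2_morph //; apply: eq_bigr => x _; rewrite /= !f0L.
  have [f1 [f1K f1p]] : exists f1 : {rmorphism kquot X1 -> C},
      kalg_morphism f1 /\ forall x, f1 (quot_pi X1 x) = f0 x.
    apply: kquot_hom => // r /(RE_relationsP nzs nz2 nzqp)[u au ->].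
    by rewrite f0lin2 vA.
  have [f2 [f2K f2p]] : exists f2 : {rmorphism kquot X2 -> C},
      kalg_morphism f2 /\ forall x, f2 (quot_pi X2 x) = f1 x.
    apply: kquot_hom => // r ->; rewrite rmorphB f1K.
    by rewrite /TrqL f1p -lin1_D f0lin1 vD subrr.
  by exists f2; split=> // x; rewrite f2p f1p f0L.
move=> C f f' fK f'K ff'; apply: kquot_hom_eq => y.
pose g1 : {rmorphism kquot X1 -> C} := (f \o p2)%FUN.
pose g2 : {rmorphism kquot X1 -> C} := (f' \o p2)%FUN.
apply: (kquot_hom_eq (f := g1) (g := g2)) y => y.
pose h1 : {rmorphism L_algebra K n -> C} := (g1 \o p1)%FUN.
pose h2 : {rmorphism L_algebra K n -> C} := (g2 \o p1)%FUN.
apply: (free_algebra_hom_eq (f := h1) (g := h2)) y => [a|[i j]].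
  by rewrite [LHS]fK [RHS]f'K.
exact: (ff' (j, i)).
Qed.

Lemma tau_tilde_in u : u \in tens_vs g g -> tau_tilde s g u \in tens_vs g g.
Proof.
move=> ug; have gu : in_gg (trL K n) (trR K n) u by apply/(tens_vs_ggP nztD gE).
have [x xa xs] := sym_asym_split nzs nz2 nzqm nzqp nzq4 nztD gE gu.
have xg : gg_proj n s x \in asym_gg s g by apply/(asym_ggP nzs nz2 nzqp nztD gE); exists x.
rewrite -[u](subrK (gg_proj n s x)) (tau_tilde_split nzs nz2 nzqm nzqp nzq4 nztD gE) //.
by apply: memvB; [move: xs; rewrite memv_cap => /andP[] | rewrite gg_proj_in].
Qed.

Lemma g_incl_klinear : @klinear K M (Tg_t g) (g_incl g).
Proof.
move=> a X Y; rewrite /g_incl /=.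
rewrite -polyCM -polyCD mulr_sumr -big_split; congr (_ %:P); apply: eq_bigr => i _ /=.
by rewrite linearP scalerDl -scalerA mul_malgC.
Qed.

Lemma g_incl_basis i : g_incl g (g_basis (g := g) i) = (<< fmu i >> : {malg K[{fmonom _}]})%:P.
Proof.
rewrite /g_incl; congr (_ %:P); rewrite (bigD1 i) //= big1 ?addr0 => [|j ji].
  by rewrite coord_free ?(basis_free (vbasisP g)) // eqxx scale1r.
by rewrite coord_free ?(basis_free (vbasisP g)) // eq_sym (negPf ji) scale0r.
Qed.

Definition S_qt_gen (X : M) : S_qt_at s g br t0 :=
  quot_pi [set quot_pi (S_relations s br) (t_var g) - kalg_scalar (S_qt s g br) t0]%classic
    (quot_pi (S_relations s br) (g_incl g X)).

Lemma gg_inclE u : gg_incl g u = lin2 (on_munit (C := Tg_t g) (g_incl g)) u.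
Proof. by []. Qed.

Lemma S_relation_image (C : kalgebra K) (p : {rmorphism Tg_t g -> C}) X Y :
  kalg_morphism p -> p (t_var g) = sc C t0 ->
  (forall r, S_relations s br r -> p r = 0) -> X \in g -> Y \in g ->
  p (g_incl g X) * p (g_incl g Y)
    - lin2 (on_munit (C := C) (p \o g_incl g)) (tau_tilde s g (tensM X Y))
  = sc C t0 * p (g_incl g (br (tensM X Y))).
Proof.
move=> pK pt rel Xg Yg.
have r0 : p (g_incl g X * g_incl g Y - gg_incl g (tau_tilde s g (tensM X Y))
             - t_var g * g_incl g (br (tensM X Y))) = 0.
  by apply: rel; exists X, Y.
move: r0; rewrite gg_inclE; set a := g_incl g X; set b := g_incl g Y.
set c := lin2 _ _; set d := g_incl g (br _).
have -> : p (a * b - c - t_var g * d) = p a * p b - p c - sc C t0 * p d.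
  by rewrite -pt; exact: rmorph_relator.
have -> : p c = lin2 (on_munit (C := C) (p \o g_incl g)) (tau_tilde s g (tensM X Y)).
  by rewrite /c lin2_morph.
by move/eqP; rewrite subr_eq0 => /eqP.
Qed.

Lemma S_qt_presentation : S_presentation s g lambda S_qt_gen.
Proof.
pose X1 := @S_relations K n s g br.
pose X2 : set (kquot X1) := [set quot_pi X1 (t_var g) - kalg_scalar (S_qt s g br) t0]%classic.
pose p1 : {rmorphism Tg_t g -> kquot X1} := quot_pi X1.
pose p2 : {rmorphism kquot X1 -> kquot X2} := quot_pi X2.
pose p : {rmorphism Tg_t g -> kquot X2} := (p2 \o p1)%FUN.
have pK : kalg_morphism p by [].
have pt : p (t_var g) = sc (kquot X2) t0.
  apply/eqP; rewrite -subr_eq0 -[sc _ t0]/(p2 (sc (S_qt s g br) t0)).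
  by rewrite -[p _]/(p2 (quot_pi X1 (t_var g))) -rmorphB; apply/eqP/quot_pi_rel.
have jl : klinear (p \o g_incl g) := klinear_morph g_incl_klinear pK.
split.
- split=> // X Y Xg Yg.
  apply: (S_relation_image pK pt) => //.
  move=> r Xr; have p1r : p1 r = 0 := quot_pi_rel Xr.
  exact: etrans (congr1 p2 p1r) (rmorph0 p2).
- move=> C k [kl kS].
  (* The indeterminate is sent to the scalar [t0], which is central as the evaluation of polynomials
     requires. *)
  have t0C x : GRing.comm (sc C t0) x by exact: kalg_central.
  have [f0 [f0K f0b f0X]] := free_algebra_t_hom (fun i : 'I_(\dim g) => k (g_basis i)) t0C.
  have f0g X : X \in g -> f0 (g_incl g X) = k X.
    move=> Xg; have l0 : klinear (f0 \o g_incl g) := klinear_morph g_incl_klinear f0K.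
    apply: (klinear_span_ext (X := vbasis g) l0 kl); last by rewrite (span_basis (vbasisP g)).
    move=> x /(nthP 0) xg; case: xg => i; rewrite size_tuple => ig <-.
    by rewrite /= (g_incl_basis (Ordinal ig)) f0b.
  have f0gg u : u \in tens_vs g g -> f0 (gg_incl g u) = lin2 (on_munit k) u.
    have l0 : klinear (f0 \o lin2 (on_munit (C := Tg_t g) (g_incl g))).
      exact: klinear_morph (lin2_klinear _) f0K.
    move=> ug; apply: (klinear_span_ext l0 (lin2_klinear _) _ ug).
    move=> x /allpairsP[[X Y] /= [Xg Yg ->]].
    have e : lin2 (on_munit (C := Tg_t g) (g_incl g)) (tensM X Y) = g_incl g X * g_incl g Y.
      by apply: lin2_on_munit; exact: g_incl_klinear.
    apply: (etrans (congr1 f0 e)).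
    apply: (etrans (rmorphM f0 (g_incl g X) (g_incl g Y))).
    apply: (etrans _ (esym (lin2_on_munit X Y kl))).
    by congr (_ * _); apply: f0g; apply: vbasis_mem.
  have [f1 [f1K f1p]] : exists f1 : {rmorphism kquot X1 -> C},
      kalg_morphism f1 /\ forall x, f1 (quot_pi X1 x) = f0 x.
    apply: kquot_hom => // r [X [Y [Xg Yg ->]]].
    have XYg : tensM X Y \in tens_vs g g by exact: tensM_in.
    have brg : br (tensM X Y) \in g by exact: (q_bracket_in nzs nz2 nzqp nztD gE).
    apply: (etrans (rmorph_relator f0 _ _ _ _ _)).
    have /eqP := kS X Y Xg Yg.
    rewrite -(f0gg _ (tau_tilde_in XYg)) -(f0g _ Xg) -(f0g _ Yg) -(f0g _ brg) -f0X.
    by rewrite -subr_eq0 => /eqP.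
  have [f2 [f2K f2p]] : exists f2 : {rmorphism kquot X2 -> C},
      kalg_morphism f2 /\ forall x, f2 (quot_pi X2 x) = f1 x.
    apply: kquot_hom => // r ->; rewrite rmorphB f1K f1p f0X subrr.
    by [].
  by exists f2; split=> // X Xg; rewrite f2p f1p f0g.
move=> C f f' fK f'K ff'; apply: kquot_hom_eq => y.
pose g1 : {rmorphism kquot X1 -> C} := (f \o p2)%FUN.
pose g2 : {rmorphism kquot X1 -> C} := (f' \o p2)%FUN.
apply: (kquot_hom_eq (f := g1) (g := g2)) y => y.
pose h1 : {rmorphism Tg_t g -> C} := (g1 \o p1)%FUN.
pose h2 : {rmorphism Tg_t g -> C} := (g2 \o p1)%FUN.
apply: (free_algebra_t_hom_eq (f := h1) (g := h2)) y => [a|i|].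
- by rewrite [LHS]fK [RHS]f'K.
- by rewrite -g_incl_basis; apply: ff'; apply: vbasis_mem; rewrite mem_nth // size_tuple.
by rewrite [LHS](congr1 f pt) [RHS](congr1 f' pt) fK f'K.
Qed.

Theorem A_RE_S_qt_isomorphic :
  kalg_isomorphic (A_RE_at n s lambda) (S_qt_at s g br t0).
Proof.
exact: (presentations_isomorphic nzs nz2 nzqm nzqp nzq4 nztD gE A_RE_presentation
  S_qt_presentation).
Qed.

End Presentations.

(** * The limit s = 1 *)

Section ValueAtOne.
Variable C : fieldType.
Local Notation Cs := {fraction {poly C}}.
Implicit Types (f g : Cs) (a b : C).

Lemma tofrac_neq0 (p : {poly C}) : p.[1] != 0 -> tofrac p != 0 :> Cs.
Proof. by apply: contraNneq => /eqP; rewrite tofrac_eq0 => /eqP ->; rewrite horner0. Qed.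

Lemma value_at1_poly (p : {poly C}) : value_at1 (tofrac p) p.[1].
Proof. by exists p, 1; rewrite hornerC oner_neq0 rmorph1 !divr1. Qed.

Lemma value_at1_const a : value_at1 (tofrac a%:P) a.
Proof. by have := value_at1_poly a%:P; rewrite hornerC. Qed.

Lemma value_at1_nat k : value_at1 (k%:R : Cs) k%:R.
Proof. by have := value_at1_const k%:R; rewrite !rmorph_nat. Qed.

Lemma value_at1_0 : value_at1 (0 : Cs) 0.
Proof. exact: value_at1_nat 0. Qed.

Lemma value_at1_1 : value_at1 (1 : Cs) 1.
Proof. exact: value_at1_nat 1. Qed.

Lemma value_at1_var : value_at1 (tofrac 'X : Cs) 1.
Proof. by have := value_at1_poly 'X; rewrite hornerX. Qed.

Lemma value_at1_add f g a b : value_at1 f a -> value_at1 g b -> value_at1 (f + g) (a + b).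
Proof.
move=> [p [r [r0 -> ->]]] [p' [r' [r'0 -> ->]]].
exists (p * r' + p' * r), (r * r'); rewrite hornerM mulf_neq0 //; split=> //.
  by rewrite addf_div ?tofrac_neq0 // !rmorphD !rmorphM.
by rewrite addf_div // hornerD !hornerM.
Qed.

Lemma value_at1_mul f g a b : value_at1 f a -> value_at1 g b -> value_at1 (f * g) (a * b).
Proof.
move=> [p [r [r0 -> ->]]] [p' [r' [r'0 -> ->]]].
exists (p * p'), (r * r'); rewrite !hornerM mulf_neq0 //; split=> //.
  by rewrite mulf_div !rmorphM.
by rewrite mulf_div.
Qed.

Lemma value_at1_opp f a : value_at1 f a -> value_at1 (- f) (- a).
Proof.
move=> fa; rewrite -[- f]mulN1r -[- a]mulN1r; apply: value_at1_mul fa.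
by have := value_at1_const (- 1); rewrite !rmorphN !rmorph1.
Qed.

Lemma value_at1_sub f g a b : value_at1 f a -> value_at1 g b -> value_at1 (f - g) (a - b).
Proof. by move=> fa gb; apply: value_at1_add => //; apply: value_at1_opp. Qed.

Lemma value_at1_exp f a k : value_at1 f a -> value_at1 (f ^+ k) (a ^+ k).
Proof.
move=> fa; elim: k => [|k IHk]; first exact: value_at1_1.
by rewrite !exprS; apply: value_at1_mul.
Qed.

Lemma value_at1_inv f a : a != 0 -> value_at1 f a -> value_at1 f^-1 a^-1.
Proof.
move=> a0 [p [r [r0 -> aE]]]; exists r, p; rewrite aE !invf_div; split=> //.
by apply: contraNneq a0 => p0; rewrite aE p0 mul0r.
Qed.

Lemma value_at1_sum (I : finType) (P : pred I) (F : I -> Cs) (G : I -> C) :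
  (forall i, value_at1 (F i) (G i)) ->
  value_at1 (\sum_(i | P i) F i) (\sum_(i | P i) G i).
Proof.
move=> FG; elim/big_rec2: _ => [|i x y _ xy]; first exact: value_at1_0.
exact: value_at1_add.
Qed.

Lemma value_at1_0_eq a : value_at1 (0 : Cs) a -> a = 0.
Proof.
move=> [p [r [r0 /esym/eqP e ->]]].
move: e; rewrite mulf_eq0 invr_eq0 (negPf (tofrac_neq0 r0)) orbF tofrac_eq0 => /eqP ->.
by rewrite horner0 mul0r.
Qed.

(** Most nonvanishing conditions on functions of s are read off from their value at s = 1. *)
Lemma value_at1_neq0 f a : a != 0 -> value_at1 f a -> f != 0.
Proof. by move=> a0 fa; apply: contraNneq a0 => f0; apply/eqP/value_at1_0_eq; rewrite -f0. Qed.

End ValueAtOne.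

(** * Entrywise limits of linear operators *)

Section LimitsOfOperators.
Variable C : fieldType.
Local Notation Cs := {fraction {poly C}}.

Definition vec_value_at1 (I : finType) (u : vec Cs I) (u1 : vec C I) : Prop :=
  forall x, value_at1 (u x) (u1 x).

Definition hom_value_at1 (I J : finType) (f : 'Hom(vec Cs I, vec Cs J))
    (f1 : 'Hom(vec C I, vec C J)) : Prop :=
  forall x, vec_value_at1 (f (bvec Cs x)) (f1 (bvec C x)).

Lemma vec_value_at1_bvec (I : finType) (x : I) : vec_value_at1 (bvec Cs x) (bvec C x).
Proof. by move=> y; rewrite !ffunE; apply: value_at1_nat. Qed.

Lemma vec_value_at1_scale (I : finType) a a1 (u : vec Cs I) (u1 : vec C I) :
  value_at1 a a1 -> vec_value_at1 u u1 -> vec_value_at1 (a *: u) (a1 *: u1).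
Proof. by move=> aa uu x; rewrite !ffunE; apply: value_at1_mul. Qed.

Lemma vec_value_at1_add (I : finType) (u v : vec Cs I) (u1 v1 : vec C I) :
  vec_value_at1 u u1 -> vec_value_at1 v v1 -> vec_value_at1 (u + v) (u1 + v1).
Proof. by move=> uu vv x; rewrite !ffunE; apply: value_at1_add. Qed.

Lemma vec_value_at1_sub (I : finType) (u v : vec Cs I) (u1 v1 : vec C I) :
  vec_value_at1 u u1 -> vec_value_at1 v v1 -> vec_value_at1 (u - v) (u1 - v1).
Proof. by move=> uu vv x; rewrite !ffunE; apply: value_at1_sub. Qed.

Lemma vec_value_at1_sum (I J : finType) (P : pred J) (F : J -> vec Cs I) (G : J -> vec C I) :
  (forall i, vec_value_at1 (F i) (G i)) ->
  vec_value_at1 (\sum_(i | P i) F i) (\sum_(i | P i) G i).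
Proof. by move=> FG x; rewrite !sum_ffunE; apply: value_at1_sum => i; apply: FG. Qed.

Lemma hom_value_at1_app (I J : finType) (f : 'Hom(vec Cs I, vec Cs J))
    (f1 : 'Hom(vec C I, vec C J)) u u1 :
  hom_value_at1 f f1 -> vec_value_at1 u u1 -> vec_value_at1 (f u) (f1 u1).
Proof.
move=> ff uu; rewrite (hom_vec f) (hom_vec f1); apply: vec_value_at1_sum => x.
exact: vec_value_at1_scale (uu x) (ff x).
Qed.

Lemma hom_value_at1_tens (I J I' J' : finType)
    (f : 'Hom(vec Cs I, vec Cs I')) (g : 'Hom(vec Cs J, vec Cs J')) f1 g1 :
  hom_value_at1 f f1 -> hom_value_at1 g g1 ->
  hom_value_at1 (tens_hom f g) (tens_hom f1 g1).
Proof.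
by move=> ff gg x y; rewrite !tens_hom_bvec !ffunE; apply: value_at1_mul; [apply: ff|apply: gg].
Qed.

Lemma hom_value_at1_mid (I M J J' L L' : finType)
    (f : 'Hom(vec Cs (J * L)%type, vec Cs (J' * L')%type)) f1 :
  hom_value_at1 f f1 -> hom_value_at1 (mid_hom I M f) (mid_hom I M f1).
Proof.
move=> ff [[i j] [l m]] y; rewrite !mid_hom_bvec !ffunE.
by apply: value_at1_mul; [apply: value_at1_mul; [|apply: ff]|]; apply: value_at1_nat.
Qed.

End LimitsOfOperators.

Lemma tau_REE (K : fieldType) n (s : K) u : s != 0 ->
  tau_RE n s u = Phi n s (tens_hom (tau_VV n s) (tau_DD n s) (Psi n s u)).
Proof. by move=> nzs; rewrite Phi_unlock Psi_unlock !comp_lfunE tau_VD_inv. Qed.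

Section ClassicalOperators.
Variables (C : fieldType) (n : nat).
Local Notation I := 'I_n.
Local Notation bv := (bvec C).
Hypothesis nz2 : 2 != 0 :> C.

Lemma q_at1 : q n (1 : C) = 1.
Proof. exact: expr1n. Qed.

Lemma q_root_at1 : q_root (1 : C) = 1.
Proof. exact: expr1n. Qed.

Lemma omega_at1 : omega n (1 : C) = 0.
Proof. by rewrite /omega q_at1 invr1 subrr. Qed.

Lemma tau_VV_at1 (i j : I) : tau_VV n 1 (bv (i, j)) = bv (j, i).
Proof.
rewrite tau_VV_bvec q_at1 expr1n subrr mul0r mulr0 scale0r add0r mulr1 divff // scale1r.
by case: eqP => [->|].
Qed.

Lemma tau_DD_at1 (i j : I) : tau_DD n 1 (bv (i, j)) = bv (j, i).
Proof.
rewrite tau_DD_bvec q_at1 expr1n subrr mul0r mulr0 scale0r add0r mulr1 divff // scale1r.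
by case: eqP => [->|].
Qed.

Lemma tau_VD_at1 (i j : I) : tau_VD n 1 (bv (i, j)) = bv (j, i).
Proof.
rewrite tau_VD_bvec q_at1 q_root_at1 omega_at1 invr1 !scale0r addr0 !scale1r.
by case: eqP => [->|].
Qed.

Lemma tau_DV_at1 (i j : I) : tau_DV n 1 (bv (i, j)) = bv (j, i).
Proof.
rewrite tau_DV_bvec q_at1 q_root_at1 omega_at1 invr1 mul0r !scale0r subr0 !scale1r.
by case: eqP => [->|].
Qed.

Lemma Psi_at1 (j i l k : I) : Psi n 1 (bv ((j, i), (l, k))) = bv ((j, l), (i, k)).
Proof. by rewrite Psi_unlock mid_hom_bvec tau_DV_at1 tmid_bvec. Qed.

Lemma Phi_at1 (j i l k : I) : Phi n 1 (bv ((j, i), (l, k))) = bv ((j, l), (i, k)).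
Proof. by rewrite Phi_unlock mid_hom_bvec tau_VD_at1 tmid_bvec. Qed.

Lemma tau_RE_at1 (j i l k : I) :
  tau_RE n 1 (bv ((j, i), (l, k))) = bv ((l, k), (j, i)).
Proof.
by rewrite tau_REE ?oner_neq0 // Psi_at1 tens_hom_bvec tau_VV_at1 tau_DD_at1 tens_bvec Phi_at1.
Qed.

Lemma munit_mulmx (i j k l : I) :
  munit C n i j *m munit C n k l = (j == k)%:R *: munit C n i l.
Proof.
rewrite !munit_delta; case: eqP => [->|/eqP jk]; first by rewrite mul_delta_mx scale1r.
by rewrite mul_delta_mx_0 // scale0r.
Qed.

Lemma tr_mid_tensM_at1 A B : tr_mid n (1 : C) (tensM A B) = B *m A.
Proof.
apply: (bilinear_mx_ext (f := fun A B => tr_mid n 1 (tensM A B)) (g := fun A B => B *m A)).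
- by move=> X a Y Z; rewrite tensM_linr linearP.
- by move=> X a Y Z; rewrite tensM_linl linearP.
- by move=> X a Y Z; rewrite mulmxDl -scalemxAl.
- by move=> X a Y Z; rewrite mulmxDr -scalemxAr.
move=> i j k l; rewrite tensM_munit tr_midE Psi_at1 trM_bvec q_root_at1 invr1 scale1r.
by rewrite munit_mulmx eq_sym.
Qed.

Lemma tau_RE_tensM_at1 (A B : 'M[C]_n) : tau_RE n 1 (tensM A B) = tensM B A.
Proof.
apply: (bilinear_mx_ext (f := fun A B => tau_RE n 1 (tensM A B))
  (g := fun A B => tensM B A)).
- by move=> X a Y Z; rewrite tensM_linr linearP.
- by move=> X a Y Z; rewrite tensM_linl linearP.
- by move=> X a Y Z; rewrite tensM_linl.
- by move=> X a Y Z; rewrite tensM_linr.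
by move=> i j k l; rewrite !tensM_munit tau_RE_at1.
Qed.

End ClassicalOperators.

Section ClassicalLimit.
Variables (C : fieldType) (n : nat).
Local Notation Cs := {fraction {poly C}}.
Local Notation s := (tofrac 'X : Cs).
Local Notation I := 'I_n.
Hypothesis nz2 : 2 != 0 :> C.

Lemma q_value_at1 : value_at1 (q n s) (q n (1 : C)).
Proof. exact/value_at1_exp/value_at1_var. Qed.

Lemma qV_value_at1 : value_at1 (q n s)^-1 (q n (1 : C))^-1.
Proof. by apply: value_at1_inv q_value_at1; rewrite q_at1 oner_neq0. Qed.

Lemma q_root_value_at1 : value_at1 (q_root s) (q_root (1 : C)).
Proof. exact/value_at1_exp/value_at1_var. Qed.

Lemma q_rootV_value_at1 : value_at1 (q_root s)^-1 (q_root (1 : C))^-1.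
Proof. by apply: value_at1_inv q_root_value_at1; rewrite q_root_at1 oner_neq0. Qed.

Lemma omega_value_at1 : value_at1 (omega n s) (omega n (1 : C)).
Proof. exact: value_at1_sub q_value_at1 qV_value_at1. Qed.

Lemma qXV_value_at1 k : value_at1 (q n s ^- k) (q n (1 : C) ^- k).
Proof.
apply: value_at1_inv; last exact/value_at1_exp/q_value_at1.
by rewrite q_at1 expr1n oner_neq0.
Qed.

Lemma TrqId_value_at1 : value_at1 (TrqId n s) n%:R.
Proof.
have -> : n%:R = TrqId n (1 : C).
  rewrite /TrqId; under eq_bigr => i _ do rewrite q_at1 expr1n invr1.
  by rewrite sumr_const card_ord.
by apply: value_at1_sum => i; apply: qXV_value_at1.
Qed.

Lemma sgn_lt_value_at1 (i j : I) : value_at1 (sgn_lt Cs i j) (sgn_lt C i j).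
Proof.
by rewrite /sgn_lt; case: ifP => _; [|apply: value_at1_opp]; apply: value_at1_1.
Qed.

Let q2_value : value_at1 (1 + q n s ^+ 2) (1 + q n (1 : C) ^+ 2).
Proof. exact/value_at1_add/value_at1_exp/q_value_at1/value_at1_1. Qed.

Let q2V_value : value_at1 (1 + q n s ^+ 2)^-1 (1 + q n (1 : C) ^+ 2)^-1.
Proof. by apply: value_at1_inv q2_value; rewrite q_at1 expr1n. Qed.

Let coef_diag : value_at1 ((1 - q n s ^+ 2) / (1 + q n s ^+ 2))
  ((1 - q n (1 : C) ^+ 2) / (1 + q n (1 : C) ^+ 2)).
Proof.
apply: value_at1_mul q2V_value.
exact/value_at1_sub/value_at1_exp/q_value_at1/value_at1_1.
Qed.

Let coef_flip : value_at1 (2 * q n s / (1 + q n s ^+ 2))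
  (2 * q n (1 : C) / (1 + q n (1 : C) ^+ 2)).
Proof.
by apply: value_at1_mul q2V_value; apply: value_at1_mul q_value_at1; apply: value_at1_nat.
Qed.

Lemma tau_VV_value_at1 : hom_value_at1 (tau_VV n s) (tau_VV n (1 : C)).
Proof.
move=> [i j]; rewrite !tau_VV_bvec; case: ifP => _; first exact: vec_value_at1_bvec.
apply: vec_value_at1_add; apply: vec_value_at1_scale; try exact: vec_value_at1_bvec.
  exact: value_at1_mul (sgn_lt_value_at1 i j) coef_diag.
exact: coef_flip.
Qed.

Lemma tau_DD_value_at1 : hom_value_at1 (tau_DD n s) (tau_DD n (1 : C)).
Proof.
move=> [i j]; rewrite !tau_DD_bvec; case: ifP => _; first exact: vec_value_at1_bvec.
apply: vec_value_at1_add; apply: vec_value_at1_scale; try exact: vec_value_at1_bvec.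
  exact: value_at1_mul (sgn_lt_value_at1 j i) coef_diag.
exact: coef_flip.
Qed.

Lemma tau_VD_value_at1 : hom_value_at1 (tau_VD n s) (tau_VD n (1 : C)).
Proof.
move=> [j i]; rewrite !tau_VD_bvec; case: ifP => _; apply: vec_value_at1_scale;
  try exact: q_rootV_value_at1; last exact: vec_value_at1_bvec.
apply: vec_value_at1_add; apply: vec_value_at1_scale.
- exact: q_value_at1.
- exact: vec_value_at1_bvec.
- exact: omega_value_at1.
by apply: vec_value_at1_sum => k; apply: vec_value_at1_bvec.
Qed.

Lemma tau_DV_value_at1 : hom_value_at1 (tau_DV n s) (tau_DV n (1 : C)).
Proof.
move=> [i j]; rewrite !tau_DV_bvec; case: ifP => _; apply: vec_value_at1_scale;
  try exact: q_root_value_at1; last exact: vec_value_at1_bvec.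
apply: vec_value_at1_sub; apply: vec_value_at1_scale.
- exact: qV_value_at1.
- exact: vec_value_at1_bvec.
- exact: value_at1_mul omega_value_at1 (value_at1_exp _ q_value_at1).
apply: vec_value_at1_sum => k; apply: vec_value_at1_scale; first exact: qXV_value_at1.
exact: vec_value_at1_bvec.
Qed.

Lemma s_neq0 : s != 0.
Proof. by apply: tofrac_neq0; rewrite hornerX oner_neq0. Qed.

Lemma Psi_value_at1 u u1 : vec_value_at1 u u1 ->
  vec_value_at1 (Psi n s u) (Psi n (1 : C) u1).
Proof.
rewrite !Psi_unlock; apply: hom_value_at1_app.
exact/hom_value_at1_mid/tau_DV_value_at1.
Qed.

Lemma Phi_value_at1 u u1 : vec_value_at1 u u1 ->
  vec_value_at1 (Phi n s u) (Phi n (1 : C) u1).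
Proof.
rewrite !Phi_unlock; apply: hom_value_at1_app.
exact/hom_value_at1_mid/tau_VD_value_at1.
Qed.

Lemma tau_RE_value_at1 u u1 : vec_value_at1 u u1 ->
  vec_value_at1 (tau_RE n s u) (tau_RE n (1 : C) u1).
Proof.
move=> uu; rewrite (tau_REE u s_neq0) (tau_REE u1 (oner_neq0 C)).
apply: Phi_value_at1; apply: hom_value_at1_app; last exact: Psi_value_at1.
exact: hom_value_at1_tens tau_VV_value_at1 tau_DD_value_at1.
Qed.

Lemma trM_value_at1 (u : MM Cs n) (u1 : MM C n) : vec_value_at1 u u1 ->
  mx_value_at1 (trM Cs n u) (trM C n u1).
Proof.
move=> uu i j; rewrite (hom_vec (trM Cs n)) (hom_vec (trM C n)) !summxE.
apply: value_at1_sum => -[[c a] [b d]]; rewrite !mxE !trM_bvec !mxE.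
apply: value_at1_mul; first exact: uu.
by apply: value_at1_mul; apply: value_at1_nat.
Qed.

Lemma tr_mid_value_at1 (u : MM Cs n) (u1 : MM C n) : vec_value_at1 u u1 ->
  mx_value_at1 (tr_mid n s u) (tr_mid n 1 u1).
Proof.
move=> uu i j; rewrite !tr_midE !mxE; apply: value_at1_mul; first exact: q_rootV_value_at1.
exact/trM_value_at1/Psi_value_at1.
Qed.

Lemma tensM_value_at1 (A B : 'M[Cs]_n) (A1 B1 : 'M[C]_n) :
  mx_value_at1 A A1 -> mx_value_at1 B B1 -> vec_value_at1 (tensM A B) (tensM A1 B1).
Proof. by move=> AA BB x; rewrite !ffunE; apply: value_at1_mul; [apply: AA|apply: BB]. Qed.

Lemma munit_value_at1 i j : mx_value_at1 (munit Cs n i j) (munit C n i j).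
Proof. by move=> a b; rewrite !mxE; apply: value_at1_nat. Qed.

Lemma two_neq0 : 2 != 0 :> Cs.
Proof. exact: value_at1_neq0 nz2 (value_at1_nat _ 2). Qed.

Lemma qq_add1_neq0 : q n s * q n s + 1 != 0.
Proof.
apply: (@value_at1_neq0 _ _ (q n 1 * q n 1 + 1)); first by rewrite q_at1 mulr1.
apply: value_at1_add (value_at1_1 _).
exact: value_at1_mul q_value_at1 q_value_at1.
Qed.

Lemma q4_add1_neq0 : q n s ^+ 4 + 1 != 0.
Proof.
apply: (@value_at1_neq0 _ _ (q n 1 ^+ 4 + 1)); first by rewrite q_at1 expr1n.
exact: value_at1_add (value_at1_exp _ q_value_at1) (value_at1_1 _).
Qed.

Lemma TrqId_neq0 : n%:R != 0 :> C -> TrqId n s != 0.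
Proof. by move=> nzn; apply: value_at1_neq0 nzn TrqId_value_at1. Qed.

(** The value at s = 1 is zero, so the size of the polynomial s^(4n) - 1 is used instead. *)
Lemma qq_sub1_neq0 : (0 < n)%N -> q n s * q n s - 1 != 0.
Proof.
move=> n0; rewrite /q -exprD -tofracXn -tofrac1 -tofracB tofrac_eq0.
by rewrite -size_poly_eq0 size_XnsubC // addn_gt0 muln_gt0 n0.
Qed.

(** The defining formula is singular at s = 1, so the limit is taken in [q_bracket_tr_mid], valid on
    g (x) g. At s = 1 the middle contraction sends A (x) B to B A and [tau_RE] is the flip. *)
Lemma q_bracket_tends (g : {vspace 'M[Cs]_n}) : (0 < n)%N -> n%:R != 0 :> C ->
  (forall A, (A \in g) = (\tr A == 0)) -> tends_to_Lie_bracket g (q_bracket n s).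
Proof.
move=> n0 nzn gE A B A1 B1 Ag Bg AA BB i j.
have nztD := TrqId_neq0 nzn.
have ABg : in_gg (trL Cs n) (trR Cs n) (tensM A B).
  by apply/(tens_vs_ggP nztD gE); apply: tensM_in.
rewrite (q_bracket_tr_mid s_neq0 two_neq0 (qq_sub1_neq0 n0) qq_add1_neq0 q4_add1_neq0 ABg).
have -> : A1 *m B1 - B1 *m A1 =
  - ((q n 1 + (q n 1)^-1) ^+ 2 / (2 * ((q n 1 + (q n 1)^-1) ^+ 2 - 2)))
    *: (tr_mid n 1 (tensM A1 B1) - tr_mid n 1 (tau_RE n 1 (tensM A1 B1))).
  rewrite tau_RE_tensM_at1 // !tr_mid_tensM_at1 q_at1 invr1.
  (* At q = 1 one has h = 2, and the coefficient is 4/(2 * 2). *)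
  have -> : (1 + 1) ^+ 2 / (2 * ((1 + 1) ^+ 2 - 2)) = 1 :> C.
    have -> : 2 * ((1 + 1) ^+ 2 - 2) = (1 + 1) ^+ 2 :> C by ring.
    by rewrite divff // expf_neq0.
  by rewrite scaleN1r opprB.
have vh : value_at1 (q n s + (q n s)^-1) (q n (1 : C) + (q n 1)^-1).
  exact: value_at1_add q_value_at1 qV_value_at1.
have vAB := tensM_value_at1 AA BB.
rewrite !mxE; apply: value_at1_mul; last first.
  apply: value_at1_sub; apply: tr_mid_value_at1 => //; exact: tau_RE_value_at1.
apply/value_at1_opp/value_at1_mul; first exact: value_at1_exp.
apply: value_at1_inv; last first.
  apply: value_at1_mul (value_at1_nat _ 2) _.
  exact: value_at1_sub (value_at1_exp _ vh) (value_at1_nat _ 2).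
rewrite q_at1 invr1.
have -> : 2 * ((1 + 1) ^+ 2 - 2) = 2 * 2 :> C by ring.
by rewrite mulf_neq0.
Qed.

(** A zero bracket would have a zero limit, but the commutator of e^1_2 and e^2_1 has entry 1 in
    position (1,1). *)
Lemma q_bracket_neq0 (g : {vspace 'M[Cs]_n}) : (1 < n)%N -> n%:R != 0 :> C ->
  (forall A, (A \in g) = (\tr A == 0)) ->
  exists2 u, u \in tens_vs g g & q_bracket n s u != 0.
Proof.
move=> n1 nzn gE; have n0 := ltnW n1.
pose i0 := Ordinal n0; pose i1 := Ordinal n1.
have in_g (i j : I) : i != j -> munit Cs n i j \in g.
  by move=> ij; rewrite gE trace_munit (negPf ij).
have a : munit Cs n i0 i1 \in g by exact: in_g.
have b : munit Cs n i1 i0 \in g by exact: in_g.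
exists (tensM (munit Cs n i0 i1) (munit Cs n i1 i0)); first exact: tensM_in.
have := q_bracket_tends n0 nzn gE a b (munit_value_at1 i0 i1) (munit_value_at1 i1 i0) i0 i0.
move=> lim; apply/eqP => br0; move: lim; rewrite br0 mxE => /value_at1_0_eq.
rewrite !munit_mulmx !mxE /= => /eqP.
by rewrite !mul1r subr0 oner_eq0.
Qed.

End ClassicalLimit.

Theorem theorem10p1 (R : realType) (n : nat) (hn : (1 < n)%N)
    (g : {vspace 'M[{fraction {poly R[i]}}]_n}) :
  let s : {fraction {poly R[i]}} := tofrac 'X in
  adjoint_module s g ->
  exists br : 'Hom(MM {fraction {poly R[i]}} n, 'M[{fraction {poly R[i]}}]_n),
    [/\ deformed_bracket s g br,
        tends_to_Lie_bracket g br
      & forall lambda : R[i],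
          kalg_isomorphic
            (A_RE_at n s (tofrac lambda%:P))
            (S_qt_at s g br ((tofrac lambda%:P) * (omega n s / TrqId n s)))].
Proof.
move=> s adj.
have natC_neq0 k : (0 < k)%N -> k%:R != 0 :> R[i].
  by move=> k0; rewrite Num.Theory.pnatr_eq0 -lt0n.
have n0 := ltnW hn.
have nz2 : 2 != 0 :> R[i] := natC_neq0 2 isT.
have nzn := natC_neq0 n n0.
have nzs : s != 0 := s_neq0 _.
have nz2s := two_neq0 nz2.
have nzqp := qq_add1_neq0 n nz2.
have nzqm := qq_sub1_neq0 R[i] n0.
have nzq4 := q4_add1_neq0 n nz2.
have nztD := TrqId_neq0 nzn.
have gE := adjoint_moduleE nzs nzqp hn adj.
exists (q_bracket n s); split.
- split.
  + by move=> u; apply: (q_bracket_in nzs nz2s nzqp nztD gE).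
  + exact: q_bracket_neq0 gE.
  + move=> i A B ni _ _; split; first exact: (q_bracket_actH nzs A B ni).
    by move=> pos; exact: (q_bracket_actX nzs nz2s nzqp pos A B ni).
  + by move=> u; apply: (q_bracket_fixed nzs nz2s nzqm nzqp nzq4 nztD gE).
- exact: (q_bracket_tends nz2 n0 nzn gE).
by move=> lambda; exact: (A_RE_S_qt_isomorphic nzs nz2s nzqm nzqp nzq4 nztD gE).
Qed.
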